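(* Let $K$ be a $p$-field, let $f,g:U\to K$ be non-zero $K$-analytic functions on an open set $U\subset K^n$ such that $f/g$ is not constant, and let $\Phi$ be a test function with support in $U$. Fix an embedded resolution $\sigma:X_K\to U$ of $D_K=f^{-1}\{0\}\cup g^{-1}\{0\}$, with associated data $N_i,v_i$ ($i\in T$), index sets $T_+,T_-$ and numbers $\alpha=\alpha_\Phi(\sigma,D_K)$, $\beta=\beta_\Phi(\sigma,D_K)$. Then: (1) the integral $Z_\Phi(\omega;f/g)$ converges for $\omega\in\Omega_{(\beta,\alpha)}(K^\times)$; (2) $Z_\Phi(\omega;f/g)$ has a meromorphic continuation to $\Omega(K^\times)$ as a rational function of $\omega(\mathfrak p)=q^{-s}$, and its poles are of the form $$s=-\frac{v_i}{N_i}+\frac{2\pi\sqrt{-1}}{N_i\ln q}\,k,\qquad k\in\mathbb Z,$$ for $i\in T_+\cup T_-$. In addition, the order of any pole is at most $n$.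
   Context: A $p$-field $K$ is a finite extension of $\mathbb Q_p$; $R_K$ is its valuation ring, $q$ the cardinality of its residue field, $\mathfrak p$ a fixed uniformizer, $ord$ the valuation, $|z|_K=q^{-ord(z)}$, and $ac\,z=z\mathfrak p^{-ord(z)}$ for $z\in K^\times$. $\Omega(K^\times)$ is the group of quasicharacters (continuous homomorphisms $K^\times\to\mathbb C^\times$). Each $\omega\in\Omega(K^\times)$ is written $\omega(z)=\omega_s(z)\chi(ac\,z)$ with $\omega_s(z)=|z|_K^s$, $\omega(\mathfrak p)=q^{-s}$, and $\chi=\omega|_{R_K^\times}$ a character of $R_K^\times$; here $s$ is determined modulo $(2\pi i/\ln q)\mathbb Z$, and $\Omega(K^\times)\cong(\mathbb C \bmod (2\pi i/\ln q)\mathbb Z)\times (R_K^\times)^*$ is a one-dimensional complex manifold. $\Omega_{(\beta,\alpha)}(K^\times)$ is the set of $\omega$ with $\beta<\operatorname{Re}(s)<\alpha$. Meromorphy, rationality and poles are understood for each fixed $\chi$ in the variable $s$ (or $q^{-s}$). A test function is a locally constant $\mathbb C$-valued function with compact support. The zeta function is $$Z_\Phi(\omega;f/g)=\int_{U\smallsetminus D_K}\Phi(x)\,\omega\!\left(\frac{f(x)}{g(x)}\right)|dx|_K,$$ with $|dx|_K$ the normalized Haar measure on $K^n$. An embedded resolution of $D_K$ is a proper $K$-analytic map $\sigma:X_K\to U$ from an $n$-dimensional $K$-analytic manifold, locally a composition of finitely many blow-ups at closed submanifolds, an isomorphism outside $\sigma^{-1}(D_K)$, with $\sigma^{-1}(D_K)=\bigcup_{i\in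 T}E_i$, where the $E_i$ are closed submanifolds of codimension one, each equipped with nonnegative integers $N_{f,i},N_{g,i}$ and a positive integer $v_i$, such that around every $b\in X_K$ there are local coordinates $y_1,\dots,y_n$ in which, if $E_1,\dots,E_r$ are the $E_i$ containing $b$, $E_i$ is given by $y_i=0$ ($1\le i\le r$), and $$\sigma^*(dx_1\wedge\dots\wedge dx_n)=\eta(y)\prod_{i=1}^r y_i^{v_i-1}dy_1\wedge\dots\wedge dy_n,\quad f\circ\sigma=\varepsilon_f(y)\prod_{i=1}^r y_i^{N_{f,i}},\quad g\circ\sigma=\varepsilon_g(y)\prod_{i=1}^r y_i^{N_{g,i}},$$ with $\eta,\varepsilon_f,\varepsilon_g$ units in the local ring of $X_K$ at $b$. Over some open neighborhood $U_\Phi$ of $\operatorname{supp}\Phi$, $\sigma$ is a composition of finitely many blow-ups. Put $N_i=N_{f,i}-N_{g,i}$; $T_+=\{i\in T: N_i>0,\ E_i\cap\sigma^{-1}(\operatorname{supp}\Phi)\ne\emptyset\}$ and $T_-=\{i\in T: N_i<0,\ E_i\cap\sigma^{-1}(\operatorname{supp}\Phi)\neq\emptyset\}$. Then $\alpha=\min_{i\in T_-}v_i/|N_i|$ (and $\alpha=+\infty$ if $T_-=\emptyset$), $\beta=\max_{i\in T_+}(-v_i/N_i)$ (and $\beta=-\infty$ if $T_+=\emptyset$). *)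

(* Defs.v *)
From HB Require Import structures.
From mathcomp Require Import all_boot all_order all_algebra all_field.
From mathcomp Require Import finmap.
From mathcomp Require Import complex.
From mathcomp Require Import all_classical all_reals all_analysis.

Set Implicit Arguments.
Unset Strict Implicit.
Unset Printing Implicit Defensive.

Import Order.TTheory GRing.Theory Num.Theory.
Import numFieldNormedType.Exports.

Local Open Scope classical_set_scope.
Local Open Scope ring_scope.
Local Open Scope complex_scope.

(** * [p]-fields *)

Section Valuation.
Variables (F : fieldType) (v : F -> int).

(* [v x >= k] under the convention [v 0 = +oo]; the value of [v] at [0] is
   never used. *)
Definition vge (k : int) (x : F) : bool := (x == 0) || (k <= v x).

Definition is_valuation : Prop :=
  (forall x y, x != 0 -> y != 0 -> v (x * y) = v x + v y) /\
  (forall k x y, vge k x -> vge k y -> vge k (x + y)).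

Definition vcauchy (u : nat -> F) : Prop :=
  forall k, exists N, forall i j, (N <= i)%N -> (N <= j)%N ->
    vge k (u i - u j).

Definition vcvg (u : nat -> F) (l : F) : Prop :=
  forall k, exists N, forall i, (N <= i)%N -> vge k (u i - l).

End Valuation.

Definition rat_pval (p : nat) (r : rat) : int :=
  (logn p `|numq r|)%:Z - (logn p `|denq r|)%:Z.

(* The field of [p]-adic numbers: a completion of [rat] for the [p]-adic
   valuation, hence unique up to a unique isomorphism of valued fields. *)
Record padics (p : nat) := Padics {
  padics_field :> fieldType;
  pval : padics_field -> int;
  pval_valuation : is_valuation pval;
  pval_ratr : forall r : rat, r != 0 ->
    ratr r != 0 :> padics_field /\ pval (ratr r) = rat_pval p r;
  padics_dense : forall (x : padics_field) (k : int),
    exists r : rat, vge pval k (x - ratr r);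
  padics_complete : forall u : nat -> padics_field, vcauchy pval u ->
    exists l, vcvg pval u l
}.

(* A finite extension of [Q_p] with its normalized valuation, i.e. the unique
   valuation with value group [int] that extends a multiple of [pval], a chosen
   uniformizer, and the cardinality [pf_q] of its residue field, counted
   through a system of representatives. *)
Record pfield (p : nat) := PField {
  pf_base : padics p;
  pf_ext : fieldExtType pf_base;
  pf_ord : pf_ext -> int;
  pf_ord_valuation : is_valuation pf_ord;
  pf_ord_ext : exists2 e : nat, (0 < e)%N &
    forall c : pf_base, c != 0 -> pf_ord c%:A = pval c *+ e;
  pf_unif : pf_ext;
  pf_unif_neq0 : pf_unif != 0;
  pf_ord_unif : pf_ord pf_unif = 1;
  pf_q : nat;
  pf_residue : exists rep : 'I_pf_q -> pf_ext,
    (forall i, vge pf_ord 0 (rep i)) /\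
    (forall x, vge pf_ord 0 x -> exists! i, vge pf_ord 1 (x - rep i))
}.

Definition pf_sort p (K : pfield p) : Type := pf_ext K.
Coercion pf_sort : pfield >-> Sortclass.

HB.instance Definition _ p (K : pfield p) :=
  GRing.Field.copy (pf_sort K) (pf_ext K).

Definition ord p (K : pfield p) : K -> int := @pf_ord p K.
Definition unif p (K : pfield p) : K := pf_unif K.
Definition vring p (K : pfield p) : set K := [set x | vge (@ord p K) 0 x].
Definition vunit p (K : pfield p) : set K := [set x | x != 0 /\ ord x = 0].

Section Topology.
Variables (p : nat) (K : pfield p).

Definition pf_nbhs (x : K) : set_system K :=
  [set A | exists k, forall y, vge (@ord p K) k (y - x) -> A y].

HB.instance Definition _ := hasNbhs.Build (pf_sort K) pf_nbhs.
HB.instance Definition _ := isPointed.Build (pf_sort K) (0 : K).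

Lemma pf_nbhs_filter (x : K) : ProperFilter (nbhs x).
Proof.
apply: Build_ProperFilter_ex.
  by move=> A [k kA]; exists x; apply: kA; rewrite subrr /vge eqxx.
split; first by exists 0.
  move=> A B [k kA] [l lB]; exists (Num.max k l) => y; rewrite /vge.
  case/orP => [y0|]; first by split; [apply: kA|apply: lB]; rewrite /vge y0.
  rewrite ge_max => /andP[ky ly].
  by split; [apply: kA|apply: lB]; rewrite /vge (ky, ly) orbT.
by move=> A B AB [k kA]; exists k => y /kA /AB.
Qed.

Lemma pf_nbhs_singleton (x : K) (A : set K) : nbhs x A -> A x.
Proof. by move=> [k kA]; apply: kA; rewrite subrr /vge eqxx. Qed.

Lemma pf_nbhs_nbhs (x : K) (A : set K) : nbhs x A -> nbhs x (nbhs^~ A).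
Proof.
move=> [k kA]; exists k => y yx; exists k => z zy; apply: kA.
have [_ vD] := pf_ord_valuation K.
by rewrite -(subrKA y); exact: (vD k (z - y : K) (y - x : K)).
Qed.

HB.instance Definition _ := Nbhs_isNbhsTopological.Build (pf_sort K)
  pf_nbhs_filter pf_nbhs_singleton pf_nbhs_nbhs.

End Topology.

(** * Analytic functions *)

Section Analytic.
Variables (p : nat) (K : pfield p).

(* Convergence along the finite subsets of [I]; in [K] a family that is
   summable in this sense is just one whose terms tend to [0]. *)
Definition has_sum (I : choiceType) (u : I -> K) (l : K) : Prop :=
  forall k : int, exists A0 : {fset I}, forall A : {fset I}, fsubset A0 A ->
    vge (@ord p K) k (\sum_(i <- A) u i - l).

Definition monomial n (z : 'rV[K]_n) (m : {ffun 'I_n -> nat}) : K :=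
  \prod_(i < n) z 0 i ^+ m i.

Definition analytic_at n (f : 'rV[K]_n -> K) (a : 'rV[K]_n) : Prop :=
  exists c : {ffun 'I_n -> nat} -> K, \forall x \near a,
    has_sum (fun m => c m * monomial (x - a) m) (f x).

Definition analytic_on n (A : set 'rV[K]_n) (f : 'rV[K]_n -> K) : Prop :=
  forall a, A a -> analytic_at f a.

Definition vanalytic_at n m (h : 'rV[K]_n -> 'rV[K]_m) (a : 'rV[K]_n) : Prop :=
  forall j, analytic_at (fun x => h x 0 j) a.

Definition is_partial n (f : 'rV[K]_n -> K) (a : 'rV[K]_n) (i : 'I_n) (d : K) :
    Prop :=
  (fun t : K => (f (a + t *: delta_mx 0 i) - f a) / t) @ (0 : K)^' --> d.

(* [J i j] is the derivative of the [j]-th component in the [i]-th variable. *)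
Definition is_jacobian n (h : 'rV[K]_n -> 'rV[K]_n) (a : 'rV[K]_n)
    (J : 'M[K]_n) : Prop :=
  forall i j, is_partial (fun x => h x 0 j) a i (J i j).

End Analytic.

(** * Analytic manifolds *)

Section Manifold.
Variables (p : nat) (K : pfield p) (n : nat).
Local Notation Kn := 'rV[K]_n.

Section Chart.
Variable X : topologicalType.

(* [cinv] is only meaningful on [cimg]. *)
Record chart := Chart { cdom : set X; cmap : X -> Kn; cinv : Kn -> X }.

Definition cimg (c : chart) : set Kn := cmap c @` cdom c.

Definition is_chart (c : chart) : Prop :=
  [/\ open (cdom c), open (cimg c),
      forall x, cdom c x -> cinv c (cmap c x) = x,
      forall x, cdom c x -> {for x, continuous (cmap c)}
    & forall y, cimg c y -> {for y, continuous (cinv c)}].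

Definition compatible (c c' : chart) : Prop :=
  forall x, cdom c x -> cdom c' x ->
    vanalytic_at (cmap c' \o cinv c) (cmap c x) /\
    vanalytic_at (cmap c \o cinv c') (cmap c' x).

End Chart.

Record kmanifold := KManifold {
  kman_top :> topologicalType;
  atlas : set (chart kman_top);
  kman_hausdorff : hausdorff_space kman_top;
  atlas_chart : forall c, atlas c -> is_chart c;
  atlas_cover : forall x, exists2 c, atlas c & cdom c x;
  atlas_compat : forall c c', atlas c -> atlas c' -> compatible c c'
}.

(* Membership in the maximal atlas: [c] is a system of local coordinates. *)
Definition local_chart (X : kmanifold) (c : chart X) : Prop :=
  is_chart c /\ forall c', atlas c' -> compatible c c'.

(* An analytic isomorphism of an open subset [A] of [X] with an open subset [B]
   of [K^n] is the same thing as a chart on [A] with image [B]. *)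
Definition iso_onto (X : kmanifold) (A : set X) (h : X -> Kn) (B : set Kn) :
    Prop :=
  (exists k, local_chart (Chart A h k)) /\ h @` A = B.

Definition man_analytic_at (X : kmanifold) (u : X -> K) (x : X) : Prop :=
  forall c, atlas c -> cdom c x -> analytic_at (u \o cinv c) (cmap c x).

Definition map_analytic_at (X Y : kmanifold) (h : X -> Y) (x : X) : Prop :=
  {for x, continuous h} /\
  forall c c', atlas c -> atlas c' -> cdom c x -> cdom c' (h x) ->
    vanalytic_at (cmap c' \o h \o cinv c) (cmap c x).

Definition analytic_iso (X Y : kmanifold) (A : set X) (B : set Y) (h : X -> Y) :
    Prop :=
  [/\ open A, open B & exists k : Y -> X,
    (forall x, A x -> [/\ B (h x), k (h x) = x & map_analytic_at h x]) /\
    (forall y, B y -> [/\ A (k y), h (k y) = y & map_analytic_at k y])].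

Definition adapted_chart (X : kmanifold) (m : nat) (Z : set X) (c : chart X) :
    Prop :=
  [/\ (m <= n)%N, local_chart c &
    forall x, cdom c x -> Z x <-> forall i : 'I_n, (i < m)%N -> cmap c x 0 i = 0].

Definition closed_submanifold (X : kmanifold) (m : nat) (Z : set X) : Prop :=
  closed Z /\
  forall x, Z x -> exists2 c, adapted_chart m Z c & cdom c x.

(** Blow-ups *)

(* The blow-down map in the [j]-th standard affine chart of the blow-up of
   [K^n] along [x_0 = ... = x_(m-1) = 0]. *)
Definition blowdown (m : nat) (j : 'I_n) (w : Kn) : Kn :=
  \row_i if ((i < m)%N && (i != j)) then w 0 i * w 0 j else w 0 i.

(* Over a chart [c] adapted to the center, the blow-up is the submanifold
   [{(x, [xi]) | x_i xi_j = x_j xi_i for i, j < m}] of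
   [cdom c * P^(m-1)(K)]; [xi : Y -> K^n] gives the homogeneous coordinates
   (only its first [m] entries matter), and the affine charts [xi_j != 0] have
   coordinates [xi_i / xi_j] for [i < m], [i != j], together with [x_j] and
   [x_i] for [i >= m]. *)
Definition is_blowup_over (Y M : kmanifold) (m : nat) (pi : Y -> M)
    (c : chart M) : Prop :=
  exists xi : Y -> Kn,
    (forall y, cdom c (pi y) ->
      (exists i : 'I_n, (i < m)%N /\ xi y 0 i != 0) /\
      (forall i j : 'I_n, (i < m)%N -> (j < m)%N ->
        cmap c (pi y) 0 i * xi y 0 j = cmap c (pi y) 0 j * xi y 0 i)) /\
    (forall j : 'I_n, (j < m)%N ->
      iso_onto [set y | cdom c (pi y) /\ xi y 0 j != 0]
        (fun y => \row_i if ((i < m)%N && (i != j)) then xi y 0 i / xi y 0 j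
                         else cmap c (pi y) 0 i)
        [set w | cimg c (blowdown m j w)]).

(* The blow-up of [M] at the closed submanifold [Z], nowhere of codimension 0. *)
Definition is_blowup (Y M : kmanifold) (Z : set M) (pi : Y -> M) : Prop :=
  [/\ closed Z, analytic_iso (pi @^-1` (~` Z)) (~` Z) pi &
    forall z, Z z -> exists (m : nat) (c : chart M),
      [/\ (0 < m)%N, adapted_chart m Z c, cdom c z & is_blowup_over m pi c]].

(* Compositions of finitely many blow-ups ending at an open subset of [K^n]. *)
Inductive blowup_tower (V : set Kn) : forall Y : kmanifold, (Y -> Kn) -> Prop :=
| tower_base (Y : kmanifold) (pi : Y -> Kn) :
    iso_onto setT pi V -> blowup_tower V pi
| tower_step (Y Y' : kmanifold) (pi : Y -> Kn) (rho : Y' -> Y) (Z : set Y) :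
    blowup_tower V pi -> is_blowup Z rho -> blowup_tower V (pi \o rho).

Definition composition_of_blowups_over (X : kmanifold) (sigma : X -> Kn)
    (V : set Kn) : Prop :=
  exists (Y : kmanifold) (pi : Y -> Kn) (h : X -> Y),
    [/\ blowup_tower V pi, analytic_iso (sigma @^-1` V) setT h
      & forall x, V (sigma x) -> pi (h x) = sigma x].

(** Embedded resolutions *)

Definition zero_divisor (U : set Kn) (f g : Kn -> K) : set Kn :=
  [set x | U x /\ (f x = 0 \/ g x = 0)].

Record resolution_data := ResolutionData {
  res_man :> kmanifold;
  res_map : res_man -> Kn;
  res_idx : Type;
  res_E : res_idx -> set res_man;
  res_Nf : res_idx -> nat;
  res_Ng : res_idx -> nat;
  res_v : res_idx -> nat
}.

Definition unit_germ (X : kmanifold) (b : X) (u : X -> K) : Prop :=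
  (\forall x \near b, man_analytic_at u x) /\ u b != 0.

(* Normal crossings at [b]: the [res_E (e i)], [i < r], are the [res_E] that
   contain [b]. *)
Definition monomial_at (f g : Kn -> K) (S : resolution_data) (b : S) : Prop :=
  exists (r : nat) (rn : (r <= n)%N) (e : 'I_r -> res_idx S) (c : chart S)
    (eta epsf epsg : S -> K),
  let y (i : 'I_r) (x : S) := cmap c x 0 (widen_ord rn i) in
  [/\ injective e /\ (forall t, res_E t b <-> exists i, e i = t),
      [/\ local_chart c, cdom c b &
        forall i x, cdom c x -> res_E (e i) x <-> y i x = 0],
      [/\ unit_germ b eta, unit_germ b epsf & unit_germ b epsg],
      \forall x \near b, exists2 J : 'M[K]_n,
        is_jacobian (@res_map S \o cinv c) (cmap c x) J &
        \det J = eta x * \prod_(i < r) y i x ^+ (res_v (e i)).-1 &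
      \forall x \near b,
        f (res_map x) = epsf x * \prod_(i < r) y i x ^+ res_Nf (e i) /\
        g (res_map x) = epsg x * \prod_(i < r) y i x ^+ res_Ng (e i)].

Definition embedded_resolution (U : set Kn) (f g : Kn -> K)
    (S : resolution_data) : Prop :=
  let sigma := @res_map S in
  let D := zero_divisor U f g in
  [/\ [/\ forall x, U (sigma x),
          forall x j, man_analytic_at (fun z => sigma z 0 j) x &
          forall C, C `<=` U -> compact C -> compact (sigma @^-1` C)],
      forall x, U x -> exists V, [/\ open V, V x, V `<=` U
        & composition_of_blowups_over sigma V],
      iso_onto (~` (sigma @^-1` D)) sigma (U `\` D),
      [/\ sigma @^-1` D = \bigcup_t res_E t,
          forall t, closed_submanifold 1 (@res_E S t) &
          forall t, (0 < @res_v S t)%N] &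
      forall b : S, monomial_at f g b].

Definition res_N (S : resolution_data) (t : res_idx S) : int :=
  (res_Nf t)%:Z - (res_Ng t)%:Z.

End Manifold.

(** * Zeta functions *)

Section Zeta.
Variables (R : realType) (p : nat) (K : pfield p).
Local Notation C := R[i].

(* Only the values at nonzero arguments are meaningful. *)
Definition quasicharacter (w : K -> C) : Prop :=
  [/\ forall x, x != 0 -> w x != 0,
      forall x y, x != 0 -> y != 0 -> w (x * y) = w x * w y &
      forall x, x != 0 -> {for x, continuous (w : K -> C^o)}].

(* Only the values on the units of the valuation ring are meaningful. *)
Definition unit_character (chi : K -> C) : Prop :=
  [/\ forall x, vunit x -> chi x != 0,
      forall x y, vunit x -> vunit y -> chi (x * y) = chi x * chi y &
      {within @vunit p K, continuous (chi : K -> C^o)}].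

(* [a] to the power [s], for a real [a > 0] *)
Definition cpow (a : R) (s : C) : C :=
  (expR (complex.Re s * ln a) * cos (complex.Im s * ln a)) +i*
  (expR (complex.Re s * ln a) * sin (complex.Im s * ln a)).

Definition qpow (s : C) : C := cpow (pf_q K)%:R s.

Definition Omega (beta alpha : \bar R) (w : K -> C) : Prop :=
  quasicharacter w /\
  exists s : C, w (unif K) = qpow (- s) /\
    (beta < (complex.Re s)%:E < alpha)%E.

(* Order at [s] of the pole of [P.[q^-s] / Q.[q^-s]] for coprime [P] and
   [Q != 0] ([0] when there is no pole): since [s |-> q^-s] is a local
   biholomorphism, it is the multiplicity of the root [q^-s] of [Q]. *)
Definition pole_order (Q : {poly C}) (s : C) : nat := mup (qpow (- s)) Q.

Variable n : nat.
Local Notation Kn := 'rV[K]_n.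

Definition borelKn := g_sigma_algebraType (@open Kn).

Definition normalized_haar (mu : {measure set borelKn -> \bar R}) : Prop :=
  (forall (a : Kn) (A : set Kn), measurable (A : set borelKn) ->
    mu ((fun x : Kn => x + a) @^-1` A) = mu A) /\
  mu [set x : Kn | forall i, vring (x 0 i)] = 1%E.

Definition csupp (Phi : Kn -> C) : set Kn := closure [set x | Phi x != 0].

Definition test_function (Phi : Kn -> C) : Prop :=
  (forall x, \forall y \near x, Phi y = Phi x) /\ compact (csupp Phi).

Definition cintegrable (mu : {measure set borelKn -> \bar R}) (D : set Kn)
    (h : Kn -> C) : Prop :=
  mu.-integrable (D : set borelKn) (fun x => (complex.Re (h x))%:E) /\
  mu.-integrable (D : set borelKn) (fun x => (complex.Im (h x))%:E).

Definition cintegral (mu : {measure set borelKn -> \bar R}) (D : set Kn)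
    (h : Kn -> C) : C :=
  (Rintegral mu (D : set borelKn) (fun x => complex.Re (h x))) +i*
  (Rintegral mu (D : set borelKn) (fun x => complex.Im (h x))).

Definition zeta_integrand (Phi : Kn -> C) (f g : Kn -> K) (w : K -> C)
    (x : Kn) : C := Phi x * w (f x / g x).

Definition zeta_converges mu (U : set Kn) Phi (f g : Kn -> K) w : Prop :=
  cintegrable mu (U `\` zero_divisor U f g) (zeta_integrand Phi f g w).

Definition zeta mu (U : set Kn) Phi (f g : Kn -> K) w : C :=
  cintegral mu (U `\` zero_divisor U f g) (zeta_integrand Phi f g w).

Definition T_plus (Phi : Kn -> C) (S : resolution_data K n) :
    set (res_idx S) :=
  [set t | 0 < res_N t /\ (res_E t `&` @res_map _ _ _ S @^-1` csupp Phi) !=set0].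

Definition T_minus (Phi : Kn -> C) (S : resolution_data K n) :
    set (res_idx S) :=
  [set t | res_N t < 0 /\ (res_E t `&` @res_map _ _ _ S @^-1` csupp Phi) !=set0].

Arguments T_plus Phi S _ : clear implicits.
Arguments T_minus Phi S _ : clear implicits.

(* The index sets are finite for an embedded resolution, so these are a minimum
   and a maximum, with the values [+oo] and [-oo] on the empty set. *)
Definition alpha (Phi : Kn -> C) (S : resolution_data K n) : \bar R :=
  ereal_inf [set ((res_v t)%:R / `|res_N t|%:~R)%:E | t in T_minus Phi S].

Definition beta (Phi : Kn -> C) (S : resolution_data K n) : \bar R :=
  ereal_sup [set (- (res_v t)%:R / (res_N t)%:~R)%:E | t in T_plus Phi S].

End Zeta.

Arguments T_plus {R p K n} Phi S _.
Arguments T_minus {R p K n} Phi S _.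

(* Main.v *)
Require Import Defs.
From HB Require Import structures.
From mathcomp Require Import all_boot all_order all_algebra all_field.
From mathcomp Require Import finmap complex perm.
From mathcomp Require Import all_classical all_reals all_analysis.
From mathcomp Require Import measurable_realfun.
From mathcomp Require Import zify lra ring.

Set Implicit Arguments.
Unset Strict Implicit.
Unset Printing Implicit Defensive.

Import Order.TTheory GRing.Theory Num.Theory.
Import numFieldNormedType.Exports.

Local Open Scope classical_set_scope.
Local Open Scope ring_scope.
Local Open Scope complex_scope.

(** The idea is to compute the integral on the resolution. By properness the
    preimage of the support of [Phi] is compact, and in suitable local
    coordinates both [f / g] and the Jacobian of [sigma] are monomials up to
    factors that become constant on a small ball after applying the character.
    Unless [Phi = 0], its support contains a ball, so the balls of [K^n] are
    compact and the preimage is a finite disjoint union of polydiscs of this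
    kind. On each of them the integral is a product of one-variable integrals,
    and the one over a disc around [y_i = 0] is a geometric series of ratio
    [q^(-v_i) t^(N_i)] with [t = q^-s]. It converges for [beta < Re s < alpha],
    its sum has a simple pole where [q^(-v_i) t^(N_i) = 1], and at most [n] such
    factors occur in a product.

    The change of variables only uses that [sigma] is strictly differentiable
    off the divisor: it then maps small balls onto translates of their images
    under the derivative, whose measure is given by the determinant. *)

(** * Compactness *)

(** The rational function has to be the same for all [s]. It is therefore chosen before [t = q^-s],
    and the pieces on which the integrand is computed depend on the character only through an [e]
    with [chi = 1] on [1 + P^e], never on [t]. Continuation is then immediate: on the strip the zeta
    function is the value at [t] of a fixed quotient of polynomials.

    Disjoint decompositions come from cells that are classes of an equivalence relation, as
    ultrametric balls are. Polydiscs are integrated by induction on the number of punctured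
    coordinates, so additivity of the integral takes the place of Fubini's theorem.

    The resolution data give the Jacobian as a matrix of partial derivatives, whereas local
    inversion needs uniform control near a point. Off the divisor [sigma] is itself a chart, so its
    expression in other coordinates is strictly differentiable, and the strict derivative is
    identified with the given matrix. *)

Section CellPartition.
Variables (T : topologicalType).

Lemma compact_finite_cover (A : set T) : compact A -> cover_compact A.
Proof.
move=> cA.
have [->|/set0P[x0 Ax0]] := eqVneq A set0.
  by move=> I D f _ _; exists fset0%fset => // x; rewrite inE.
(* [compact_cover] is about pointed spaces; a point of the nonempty [A] serves as base point. *)
pose T' : ptopologicalType := HB.pack_for ptopologicalType T (isPointed.Build T x0).
have : @compact T' A := cA.
by rewrite compact_cover.
Qed.

(** Two cells that meet coincide, so a finite subcover by cells becomes a partition once repetitions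
    are dropped, and [G] only has to be additive over disjoint unions. *)
Lemma partition_ind (G : set T -> Prop) (cell : T -> set T) (A : set T) :
  G set0 ->
  (forall B C, B `<=` A -> C `<=` A -> B `&` C = set0 -> G B -> G C -> G (B `|` C)) ->
  compact A ->
  (forall x, A x -> open (cell x)) ->
  (forall x, A x -> cell x x) ->
  (forall x y, A x -> cell x y -> A y /\ cell y = cell x) ->
  (forall x, A x -> G (cell x)) -> G A.
Proof.
move=> G0 GU /compact_finite_cover cA co cx ce Gc.
have [|D' D'A AD'] := cA T A cell co; first by move=> x Ax; exists x => //; exact: cx.
have cA' x : A x -> cell x `<=` A by move=> Ax y /(ce _ _ Ax)[].
pose P (s : seq T) := \big[setU/set0]_(x <- s) cell x.
have key (s : seq T) : (forall x, x \in s -> A x) -> G (P s) /\ P s `<=` A /\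
   forall x, x \in s -> cell x `<=` P s.
  elim: s => [|x s IH] sA; first by rewrite /P big_nil; do 2?split.
  have [y ys|GP [PA cP]] := IH; first by apply: sA; rewrite inE ys orbT.
  have Ax : A x by apply: sA; rewrite mem_head.
  have sub : P (x :: s) `<=` A.
    by rewrite /P big_cons => y [/(cA' _ Ax)//|/PA].
  split; last first.
    split=> // y; rewrite inE => /predU1P[->|ys]; rewrite /P big_cons.
      by move=> z; left.
    by move=> z zy; right; exact: cP zy.
  (* A cell that meets the union of the previous ones is one of them. *)
  have [[z [zx]]|disj] := pselect ((cell x `&` P s) !=set0).
    rewrite {1}/P -bigcup_seq => -[y /= ys zy].
    have Ay : A y by apply: sA; rewrite inE ys orbT.
    have [_ e1] := ce _ _ Ax zx; have [_ e2] := ce _ _ Ay zy.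
    rewrite /P big_cons (_ : _ `|` _ = P s)//.
    by apply/setUidr; rewrite -e1 e2; exact: cP.
  rewrite /P big_cons; apply: GU => //; first exact: cA'.
    by apply: contrapT => /eqP/set0P.
  exact: Gc.
have [GP [PA cP]] : G (P D') /\ P D' `<=` A /\
    forall x, x \in enum_fset D' -> cell x `<=` P D'.
  by apply: key => x xD'; apply/set_mem/D'A.
suff -> : A = P D' by [].
rewrite eqEsubset; split => // x /AD'[y /= yD' xy]; exact: cP xy.
Qed.
End CellPartition.

(** * Valuations and balls *)

Section Valuations.
Variables (p : nat) (K : pfield p).
Local Notation V := (vge (@ord p K)).
Local Notation ord := (@ord p K).
Local Notation unif := (@unif p K).

Lemma ordM (x y : K) : x != 0 -> y != 0 -> ord (x * y) = ord x + ord y.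
Proof. by have [+ _] := pf_ord_valuation K; exact. Qed.

Lemma vgeD k (x y : K) : V k x -> V k y -> V k (x + y).
Proof. by have [_ +] := pf_ord_valuation K; exact. Qed.

Lemma vge0 k : V k 0. Proof. by rewrite /vge eqxx. Qed.

Lemma vgeE k (x : K) : x != 0 -> V k x = (k <= ord x).
Proof. by rewrite /vge => /negbTE->. Qed.

Lemma ord_one : ord 1 = 0.
Proof.
have := ordM (oner_neq0 K) (oner_neq0 K); rewrite mulr1 => /eqP.
by rewrite -subr_eq0 opprD addNKr oppr_eq0 => /eqP.
Qed.

Lemma ordN (x : K) : ord (- x) = ord x.
Proof.
have [->|x0] := eqVneq x 0; first by rewrite oppr0.
have N1 : -1 != 0 :> K by rewrite oppr_eq0 oner_eq0.
have := ordM N1 N1; rewrite mulrNN mulr1 ord_one => h.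
by rewrite -mulN1r ordM//; lia.
Qed.

Lemma vgeN k (x : K) : V k (- x) = V k x.
Proof. by rewrite /vge oppr_eq0 ordN. Qed.

Lemma vgeB k (x y : K) : V k x -> V k y -> V k (x - y).
Proof. by move=> ? ?; rewrite vgeD// vgeN. Qed.

Lemma vgeBC k (x y : K) : V k (x - y) = V k (y - x).
Proof. by rewrite -vgeN opprB. Qed.

Lemma vge_trans k (x y z : K) : V k (x - y) -> V k (y - z) -> V k (x - z).
Proof. by move=> xy yz; rewrite -(subrKA y) vgeD. Qed.

Lemma vgeW k l (x : K) : l <= k -> V k x -> V l x.
Proof. by rewrite /vge => lk /orP[->//|kx]; rewrite (le_trans lk kx) orbT. Qed.

Lemma vgeM k l (x y : K) : V k x -> V l y -> V (k + l) (x * y).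
Proof.
have [->|x0] := eqVneq x 0; first by rewrite mul0r !vge0.
have [->|y0] := eqVneq y 0; first by rewrite mulr0 !vge0.
by rewrite !vgeE ?mulf_neq0// ordM//; lia.
Qed.

Lemma vgeMl k (x y : K) : V 0 x -> V k y -> V k (x * y).
Proof. by move=> ? ?; rewrite -(add0r k) vgeM. Qed.

Lemma vge_sum k I (r : seq I) (P : pred I) (F : I -> K) :
  (forall i, P i -> V k (F i)) -> V k (\sum_(i <- r | P i) F i).
Proof.
by move=> h; elim/big_rec: _ => [|i x Pi]; [exact: vge0|apply: vgeD; exact: h].
Qed.

Lemma ordV (x : K) : x != 0 -> ord x^-1 = - ord x.
Proof.
move=> x0; have := ordM x0 (invr_neq0 x0); rewrite divff// ord_one; lia.
Qed.

Lemma unif_neq0 : unif != 0. Proof. exact: pf_unif_neq0. Qed.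

Lemma ord_unif : ord unif = 1. Proof. exact: pf_ord_unif. Qed.

Lemma ordX (x : K) n : x != 0 -> ord (x ^+ n) = n%:Z * ord x.
Proof.
move=> x0; elim: n => [|n IH]; first by rewrite expr0 ord_one mul0r.
by rewrite exprS ordM ?expf_neq0// IH; lia.
Qed.

Lemma ordXz (x : K) (m : int) : x != 0 -> ord (x ^ m) = m * ord x.
Proof.
move=> x0; case: m => n; first exact: ordX.
by rewrite NegzE -exprnN ordV ?expf_neq0// ordX//; lia.
Qed.

Lemma unifX_neq0 m : unif ^ m != 0. Proof. by rewrite expfz_neq0// unif_neq0. Qed.

Lemma ord_unifX m : ord (unif ^ m) = m.
Proof. by rewrite ordXz ?unif_neq0// ord_unif mulr1. Qed.

Lemma vge_inj (x : K) : (forall k : int, V k x) -> x = 0.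
Proof.
move=> h; apply/eqP; apply: contraT => x0.
by have := h (ord x + 1); rewrite vgeE//; lia.
Qed.

Lemma ord_close (x y : K) : x != 0 -> V (ord x + 1) (y - x) -> y != 0 /\ ord y = ord x.
Proof.
move=> x0 yx.
have y0 : y != 0.
  by apply: contraTneq yx => ->; rewrite sub0r vgeN vgeE//; lia.
split=> //; apply/eqP; rewrite eq_le; apply/andP; split.
  rewrite leNgt; apply/negP => xy.
  have : V (ord x + 1) (y - (y - x)) by apply: vgeB => //; rewrite vgeE//; lia.
  by rewrite subKr vgeE//; lia.
rewrite -(vgeE _ y0) -(subrK x y); apply: vgeD; last by rewrite vgeE.
by apply: vgeW yx; lia.
Qed.

Lemma vge_unifX k (x : K) : V k x = V 0 (x * unif ^ (- k)).
Proof.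
have [->|x0] := eqVneq x 0; first by rewrite mul0r !vge0.
rewrite !vgeE ?mulf_neq0 ?unifX_neq0// ordM ?unifX_neq0// ord_unifX.
by rewrite subr_ge0.
Qed.

(** With fewer than two residue classes, [0] would have no representative or share it with [1],
    which would force [ord 1 >= 1]. *)
Lemma pf_q_gt1 : (1 < pf_q K)%N.
Proof.
have [rep [rep0 rep1]] := pf_residue K.
case E : (pf_q K) => [|[|//]] in rep rep0 rep1 *; exfalso.
  by have [[]] := rep1 0 (vge0 _).
have V1 : V 0 1 by rewrite vgeE ?oner_neq0// ord_one.
have [i [i0 _]] := rep1 0 (vge0 _); have [j [j0 _]] := rep1 1 V1.
have ij : j = i by rewrite (ord1 i) (ord1 j).
have := vgeB j0 i0; rewrite ij sub0r opprK subrK.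
by rewrite vgeE ?oner_neq0// ord_one.
Qed.

End Valuations.

Section Balls.
Variables (p : nat) (K : pfield p).
Local Notation V := (vge (@ord p K)).
Local Notation ord := (@ord p K).
Local Notation unif := (@unif p K).

Definition pball n (a : 'rV[K]_n) (k : int) : set 'rV[K]_n :=
  [set y | forall i, V k (y 0 i - a 0 i)].

Lemma pball_refl n (a : 'rV[K]_n) k : pball a k a.
Proof. by move=> i; rewrite subrr vge0. Qed.

Lemma pballC n (a b : 'rV[K]_n) k : pball a k b -> pball b k a.
Proof. by move=> ab i; rewrite vgeBC. Qed.

Lemma pball_trans n (a b c : 'rV[K]_n) k : pball a k b -> pball b k c -> pball a k c.
Proof. by move=> ab bc i; apply: vge_trans (bc i) (ab i). Qed.

Lemma pball_eq n (a b : 'rV[K]_n) k : pball a k b -> pball b k = pball a k.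
Proof.
move=> ab; rewrite eqEsubset; split=> c; first exact: pball_trans.
by apply: pball_trans; exact: pballC.
Qed.

Lemma pballW n (a : 'rV[K]_n) k l : l <= k -> pball a k `<=` pball a l.
Proof. by move=> lk b ab i; exact: vgeW lk (ab i). Qed.

Lemma nbhs_pballP n (a : 'rV[K]_n) (A : set 'rV[K]_n) :
  nbhs a A <-> exists k : int, pball a k `<=` A.
Proof.
split; last first.
  move=> [k kA]; exists (fun _ j => [set y : K | V k (y - a 0 j)]).
    by move=> i j; rewrite (ord1 i); exists k.
  by move=> N aN; apply: kA => i; exact: aN.
move=> [P aP PA].
have /choice[k kP] : forall j, exists k : int, forall y, V k (y - a 0 j) -> P 0 j y.
  by move=> j; have [k kP] := aP 0 j; exists k.
exists (\big[Num.max/0]_j k j) => N aN; apply: PA => i j; rewrite (ord1 i).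
by apply: kP; apply: vgeW (aN j); exact: le_bigmax.
Qed.

Lemma nbhs_pball n (a : 'rV[K]_n) k : nbhs a (pball a k).
Proof. by apply/nbhs_pballP; exists k. Qed.

Lemma open_pball n (a : 'rV[K]_n) k : open (pball a k).
Proof.
rewrite openE => b ab; apply/nbhs_pballP; exists k.
by rewrite (pball_eq ab).
Qed.

Lemma closed_pball n (a : 'rV[K]_n) k : closed (pball a k).
Proof.
rewrite -openC openE => b ab; apply/nbhs_pballP; exists k => c bc ac.
by apply: ab; apply: pball_trans ac (pballC bc).
Qed.

Lemma continuous_pballP n m (f : 'rV[K]_n -> 'rV[K]_m) (a : 'rV[K]_n) :
  {for a, continuous f} <->
  forall k : int, exists l : int, pball a l `<=` f @^-1` pball (f a) k.
Proof.
split=> [fc k|fc A /nbhs_pballP[k kA]].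
  by have /nbhs_pballP := fc _ (nbhs_pball (f a) k).
by have [l lk] := fc k; apply/nbhs_pballP; exists l => b /lk /kA.
Qed.

Lemma continuous_affine n (a b : 'rV[K]_n) (c : K) :
  continuous (fun x : 'rV[K]_n => a + c *: (x - b)).
Proof.
move=> x; apply/continuous_pballP => k.
exists (k - ord c) => y xy i; rewrite !mxE opprD addrACA subrr add0r -mulrBr.
rewrite opprD addrACA opprK addNr addr0.
have [->|c0] := eqVneq c 0; first by rewrite mul0r vge0.
have -> : k = ord c + (k - ord c) by rewrite addrC subrK.
by apply: vgeM => //; rewrite vgeE.
Qed.

(** Every ball is the image of a ball inside [A] under a homothety by a power of the uniformizer
    followed by a translation. *)
Lemma compact_pball n (x0 : 'rV[K]_n) (A : set 'rV[K]_n) :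
  compact A -> nbhs x0 A -> forall (a : 'rV[K]_n) k, compact (pball a k).
Proof.
move=> cA /nbhs_pballP[l lA] a k.
have cl : compact (pball x0 l).
  by apply: subclosed_compact cA lA; exact: closed_pball.
have -> : pball a k =
    (fun x : 'rV[K]_n => a + unif ^ (k - l) *: (x - x0)) @` pball x0 l.
  rewrite eqEsubset; split=> y; last first.
    move=> [x x0x <-] i; rewrite !mxE addrAC subrr add0r.
    rewrite vge_unifX mulrAC -expfzDr ?unif_neq0//.
    by rewrite (_ : k - l - k = - l); [rewrite mulrC -vge_unifX|lia].
  exists (x0 + unif ^ (l - k) *: (y - a)).
    move=> i; rewrite !mxE addrAC subrr add0r.
    rewrite vge_unifX mulrAC -expfzDr ?unif_neq0//.
    by rewrite (_ : l - k - l = - k); [rewrite mulrC -vge_unifX|lia].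
  rewrite addrAC subrr add0r scalerA -expfzDr ?unif_neq0//.
  by rewrite addrA subrK subrr expr0z scale1r subrKC.
apply: continuous_compact cl; apply: continuous_subspaceT.
exact: continuous_affine.
Qed.

(** [P b k] is read as a property of the ball [pball b k]. The hypothesis already lets the centre
    vary in a whole ball, so the largest exponent of a finite subcover works for all centres in
    [A]. *)
Lemma lebesgue_number n (A : set 'rV[K]_n) (P : 'rV[K]_n -> int -> Prop) :
  compact A ->
  (forall a, A a -> exists k0 : int, forall b k, pball a k0 b -> k0 <= k -> P b k) ->
  exists k0 : int, forall b k, A b -> k0 <= k -> P b k.
Proof.
move=> /compact_finite_cover cA h.
have /choice[k0 k0P] : forall a, exists k0 : int,
    A a -> forall b k, pball a k0 b -> k0 <= k -> P b k.
  by move=> a; have [/h[k0]|nA] := pselect (A a); [exists k0|exists 0].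
have [//||D DA AD] := cA _ A (fun a => pball a (k0 a)).
  by move=> a _; exact: open_pball.
  by move=> a Aa; exists a => //; exact: pball_refl.
exists (\big[Num.max/0]_(a <- enum_fset D) k0 a) => b k /AD[a /= aD ab] kk.
have Aa := set_mem (DA _ aD).
apply: (k0P a Aa) => //; apply: le_trans kk.
exact: le_bigmax_seq.
Qed.

End Balls.

(** * Haar measure and linear maps *)

Section Haar.
Variables (R : realType) (p : nat) (K : pfield p) (n : nat).
Local Notation V := (vge (@ord p K)).
Local Notation ord := (@ord p K).
Local Notation unif := (@unif p K).
Local Notation B := (borelKn K n).
Variables (mu : {measure set B -> \bar R}).
Hypothesis (mu_haar : normalized_haar mu).
Hypothesis cpt : forall (a : 'rV[K]_n) k, compact (pball a k).

Lemma borel_open (A : set 'rV[K]_n) : open A -> measurable (A : set B).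
Proof. exact: sub_sigma_algebra. Qed.

Lemma haarU (A C : set 'rV[K]_n) : measurable (A : set B) -> measurable (C : set B) ->
  A `&` C = set0 -> mu (A `|` C) = (mu A + mu C)%E.
Proof. exact: measureU. Qed.

Lemma haar_shift (a : 'rV[K]_n) (A : set 'rV[K]_n) : measurable (A : set B) ->
  mu ((fun x : 'rV[K]_n => x - a) @^-1` A) = mu A.
Proof. by have [+ _] := mu_haar => h; exact: (h (- a)). Qed.

Definition lbox (l : 'I_n -> int) : set 'rV[K]_n := [set y | forall i, V (l i) (y 0 i)].

Lemma lbox_cst k : lbox (fun=> k) = pball 0 k.
Proof. by apply/seteqP; split=> y h i; have := h i; rewrite !mxE subr0. Qed.

Lemma open_lbox l : open (lbox l).
Proof.
rewrite openE => x xl; apply/nbhs_pballP; exists (\big[Num.max/0]_i l i) => y xy i.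
rewrite -(subrK (x 0 i) (y 0 i)); apply: vgeD; last exact: xl.
by apply: vgeW (xy i); exact: le_bigmax.
Qed.

Lemma pball_shift (a : 'rV[K]_n) k :
  pball a k = (fun x : 'rV[K]_n => x - a) @^-1` pball 0 k.
Proof. by apply/seteqP; split=> y h i; have := h i; rewrite !mxE subr0. Qed.

Lemma haar_pball a k : mu (pball a k) = mu (pball 0 k).
Proof. by rewrite pball_shift haar_shift//; apply: borel_open; exact: open_pball. Qed.

Lemma haar_O : mu (pball 0 0) = 1%E.
Proof.
have [_ <-] := mu_haar; congr (mu _).
by apply/seteqP; split=> y h i; have := h i; rewrite /= /vring /= ?mxE subr0.
Qed.

Local Notation q := ((pf_q K)%:R : R).

Lemma q_gt1 : 1 < q. Proof. by rewrite ltr1n pf_q_gt1. Qed.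
Lemma q_gt0 : 0 < q. Proof. by apply: lt_trans q_gt1. Qed.
Lemma q_neq0 : q != 0. Proof. by rewrite gt_eqF// q_gt0. Qed.

(** [P^(l j)] is the disjoint union of [q] cosets of [P^(l j + 1)], represented by [unif ^ l j]
    times the residue representatives. Hence the box is a disjoint union of [q] translates of the
    smaller one. *)
Lemma lbox_step (j : 'I_n) l :
  mu (lbox l) = (q%:E * mu (lbox (fun i => l i + (i == j)%:R)%R))%E.
Proof.
have [rep [rep0 rep1]] := pf_residue K.
set l' := fun i => _.
have [a aE] : exists a : 'I_(pf_q K) -> 'rV[K]_n,
    forall r i, a r 0 i = if i == j then unif ^ (l j) * rep r else 0.
  exists (fun r => \row_i if i == j then unif ^ (l j) * rep r else 0).
  by move=> r i; rewrite mxE.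
pose F r := (fun x : 'rV[K]_n => x - a r) @^-1` lbox l'.
have Fo r : open (F r).
  apply: open_comp; last exact: open_lbox.
  move=> x _; have /= h := @continuous_affine p K n 0 (a r) 1 x.
  by move: h; under eq_fun do rewrite scale1r add0r.
have FE r y : F r y <-> (forall i, i != j -> V (l i) (y 0 i)) /\
    V (l j + 1) (y 0 j - unif ^ (l j) * rep r).
  split=> [h|[h1 h2] i].
    split=> [i ij|]; first by have := h i; rewrite /l' !mxE aE (negbTE ij) addr0 subr0.
    by have := h j; rewrite /l' !mxE aE eqxx.
  rewrite /l' !mxE aE; case: eqVneq => [->|ij]; first by [].
  by rewrite addr0 subr0 h1.
have shift x : V (l j + 1) (unif ^ l j * x) = V 1 x.
  rewrite vge_unifX opprD expfzDr ?unif_neq0// mulrACA -expfzDr ?unif_neq0// subrr.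
  by rewrite expr0z mul1r -vge_unifX.
have -> : lbox l = \big[setU/set0]_(r < pf_q K) F r.
  rewrite -bigcup_seq; apply/seteqP; split=> [y yl|y [r _ /FE[h1 h2]] i].
    have V0 : V 0 (y 0 j * unif ^ (- l j)) by rewrite -vge_unifX; exact: yl.
    have [r [h _]] := rep1 _ V0; exists r; first by rewrite /= mem_index_enum.
    apply/FE; split=> [i _|]; first exact: yl.
    rewrite -shift mulrBr mulrCA -expfzDr ?unif_neq0// subrr expr0z mulr1 in h.
    exact: h.
  have [->|/h1//] := eqVneq i j.
  rewrite -(subrK (unif ^ l j * rep r) (y 0 j)).
  apply: vgeD; first by apply: vgeW h2; rewrite lerDl.
  by rewrite mulrC; apply: vgeMl; rewrite ?rep0// vgeE ?unifX_neq0// ord_unifX.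
rewrite measure_bigsetU_ord//=; last 2 first.
- by move=> r; apply: borel_open; exact: Fo.
- move=> r s _ _ [y [/FE[_ yr] /FE[_ ys]]].
  rewrite vgeBC in yr; have := vge_trans yr ys; rewrite -mulrBr shift => rs.
  have [i [_ iu]] := rep1 (rep r) (rep0 r).
  by rewrite -(iu s rs); apply/esym/iu; rewrite subrr; exact: vge0.
rewrite (eq_bigr (fun=> mu (lbox l'))); last first.
  by move=> r _; rewrite haar_shift//; apply: borel_open; exact: open_lbox.
rewrite big_const_ord.
elim: (pf_q K) => [|k IH]; first by rewrite mul0e.
rewrite iterS IH -natr1 EFinD ge0_muleDl ?lee_fin//.
by rewrite mul1e addeC.
Qed.

(** Descent on the sum of the absolute values of the [l i] down to the unit polydisc, whose measure
    is normalized. For [l j > 0], [lbox_step] is applied to the larger box and solved for the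
    smaller one. *)
Lemma haar_lbox l : mu (lbox l) = (\prod_i q ^ (- l i))%:E.
Proof.
have [N] := ubnP (\sum_i `|l i|)%N; elim: N => // N IH in l *.
rewrite ltnS => lN.
have [/forallP l0|] := boolP [forall i, l i == 0].
  rewrite big1 => [|i _]; last by rewrite (eqP (l0 i)).
  rewrite (_ : l = fun=> 0); last by apply/funext => i; rewrite (eqP (l0 i)).
  by rewrite lbox_cst haar_O.
rewrite negb_forall => /existsP[j lj].
have upd (l' : 'I_n -> int) : (forall i, i != j -> l' i = l i) ->
    (`|l' j| < `|l j|)%N -> mu (lbox l') = (\prod_i q ^ (- l' i))%:E.
  move=> h1 h2; apply: IH; apply: leq_trans lN.
  rewrite (bigD1 j)//= [leqRHS](bigD1 j)//= -addSn leq_add//.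
  by apply: leq_sum => i ij; rewrite h1.
have prodE (l' : 'I_n -> int) :
    \prod_i q ^ (- l' i) = q * \prod_i q ^ (- (l' i + (i == j)%:R)) :> R.
  rewrite (bigD1 j)//= [in RHS](bigD1 j)//= eqxx mulrA; congr (_ * _).
    rewrite -[X in _ = X * _]expr1z -expfzDr ?q_neq0//; congr (_ ^ _).
    by rewrite opprD addrCA subrr addr0.
  by apply: eq_bigr => i /negbTE->; rewrite addr0.
have [l0|l0] := ltP 0 (l j).
  pose l' i := l i - (i == j)%:R.
  have El : l = fun i => l' i + (i == j)%:R by apply/funext => i; rewrite /l' subrK.
  have := lbox_step j l'; rewrite -El upd; last 2 first.
  - by move=> i /negbTE ij; rewrite /l' ij subr0.
  - by rewrite /l' eqxx; lia.
  rewrite prodE => /(congr1 (fun x => (q^-1)%:E * x)%E).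
  rewrite muleA -!EFinM mulrA mulVf ?q_neq0// !mul1r mul1e => <-.
  by congr (_%:E); apply: eq_bigr => i _; rewrite /l' subrK.
rewrite (lbox_step j) upd; last 2 first.
- by move=> i /negbTE ij; rewrite ij addr0.
- by rewrite eqxx; lia.
by rewrite -EFinM -prodE.
Qed.

End Haar.

(** * Scaling of Haar measure by invertible matrices *)

Section LinearScaling.
Variables (R : realType) (p : nat) (K : pfield p) (n : nat).
Local Notation V := (vge (@ord p K)).
Local Notation ord := (@ord p K).
Local Notation unif := (@unif p K).
Local Notation B := (borelKn K n).
Variables (mu : {measure set B -> \bar R}).
Hypothesis (mu_haar : normalized_haar mu).
Hypothesis cpt : forall (a : 'rV[K]_n) k, compact (pball a k).
Local Notation q := ((pf_q K)%:R : R).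

(** Matrices act on row vectors from the right, in accordance with [is_jacobian], where the rows
    correspond to the variables. *)
Definition mximg (J : 'M[K]_n) (A : set 'rV[K]_n) : set 'rV[K]_n :=
  (fun x => x *m J) @` A.

Lemma mximg_preimage J A : J \in unitmx -> mximg J A = (fun x => x *m invmx J) @^-1` A.
Proof.
move=> uJ; apply/seteqP; split=> [y [x Ax <-]|y Ay] /=; first by rewrite mulmxK.
by exists (y *m invmx J) => //; rewrite mulmxKV.
Qed.

Lemma mximgM J1 J2 A : mximg (J1 *m J2) A = mximg J2 (mximg J1 A).
Proof.
rewrite /mximg image_comp; apply: eq_imagel => x _ /=.
by rewrite mulmxA.
Qed.

Lemma mx_vge m1 m2 (M : 'M[K]_(m1, m2)) : exists c : int, forall i j, V c (M i j).
Proof.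
exists (- \big[Num.max/0]_i \big[Num.max/0]_j - ord (M i j)) => i j.
rewrite /vge lerNl; apply/orP; right.
apply: le_trans (le_bigmax _ (fun i => \big[Num.max/0]_j - ord (M i j)) i).
exact: le_bigmax.
Qed.

Lemma vge_mulmx k c (x : 'rV[K]_n) m (J : 'M[K]_(n, m)) :
  (forall i, V k (x 0 i)) -> (forall i j, V c (J i j)) ->
  forall j, V (k + c) ((x *m J) 0 j).
Proof. by move=> xk Jc j; rewrite mxE; apply: vge_sum => i _; exact: vgeM. Qed.

Lemma continuous_mulmx (J : 'M[K]_n) : continuous (fun x : 'rV[K]_n => x *m J).
Proof.
move=> x; apply/continuous_pballP => k; have [c Jc] := mx_vge J.
exists (k - c) => y xy j /=; have -> : k = (k - c) + c by rewrite subrK.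
rewrite (_ : _ - _ = ((y - x) *m J) 0 j); last by rewrite mulmxBl !mxE.
by apply: vge_mulmx => // i; rewrite !mxE; exact: xy.
Qed.

Lemma open_mximg J A : J \in unitmx -> open A -> open (mximg J A).
Proof.
move=> uJ oA; rewrite mximg_preimage//; apply: open_comp => // x _.
exact: continuous_mulmx.
Qed.

Lemma compact_mximg J A : compact A -> compact (mximg J A).
Proof.
by apply: continuous_compact; apply: continuous_subspaceT; exact: continuous_mulmx.
Qed.

Lemma mximgU J A C : mximg J (A `|` C) = mximg J A `|` mximg J C.
Proof. exact: image_setU. Qed.

Lemma mximgI0 J A C : J \in unitmx -> A `&` C = set0 ->
  mximg J A `&` mximg J C = set0.
Proof.
by move=> uJ AC0; rewrite !mximg_preimage// -preimage_setI AC0 preimage_set0.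
Qed.

Lemma mximg_ball J a k : J \in unitmx ->
  mximg J (pball a k) = (fun x : 'rV[K]_n => x - a *m J) @^-1` mximg J (pball 0 k).
Proof.
move=> uJ; rewrite !mximg_preimage// [pball a k]pball_shift.
by apply/seteqP; split=> x /=; rewrite mulmxBl mulmxK.
Qed.

Lemma haar_mximg_ball J a k : J \in unitmx ->
  mu (mximg J (pball a k)) = mu (mximg J (pball 0 k)).
Proof.
move=> uJ; rewrite mximg_ball// haar_shift//; apply: borel_open.
by apply: open_mximg => //; exact: open_pball.
Qed.

(** The point is that the same [N], the number of balls in a partition of [A], serves for [A] and
    for its image: translates of a ball have images that are translates of each other. *)
Lemma ball_count J (A : set 'rV[K]_n) k : J \in unitmx -> compact A ->
  (forall a, A a -> pball a k `<=` A) ->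
  exists N : nat, mu A = (N%:R%:E * mu (pball 0 k))%E /\
    mu (mximg J A) = (N%:R%:E * mu (mximg J (pball 0 k)))%E.
Proof.
move=> uJ cA Ak.
suff [_] : open A /\ exists N : nat, mu A = (N%:R%:E * mu (pball 0 k))%E /\
    mu (mximg J A) = (N%:R%:E * mu (mximg J (pball 0 k)))%E by [].
apply: (partition_ind (G := fun A => open A /\ exists N : nat,
    mu A = (N%:R%:E * mu (pball 0 k))%E /\
    mu (mximg J A) = (N%:R%:E * mu (mximg J (pball 0 k)))%E)
  (cell := fun a => pball a k) _ _ cA).
- by split; [exact: open0|exists 0; rewrite /mximg image_set0 measure0 !mul0e].
- move=> A1 A2 _ _ A12 [oA1 [N1 [m1 m1']]] [oA2 [N2 [m2 m2']]].
  split; first exact: openU.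
  exists (N1 + N2)%N; rewrite mximgU !haarU//;
    try (by apply: borel_open => //; exact: open_mximg); last exact: mximgI0.
  by rewrite m1 m1' m2 m2' natrD EFinD !ge0_muleDl ?lee_fin.
- by move=> x _; exact: open_pball.
- by move=> x _; exact: pball_refl.
- by move=> x y Ax xy; split; [exact: Ak xy|exact: pball_eq].
- move=> x _; split; first exact: open_pball.
  by exists 1; rewrite !mul1e haar_pball// haar_mximg_ball.
Qed.

Lemma open_unif (A : set 'rV[K]_n) : compact A -> open A ->
  exists k0 : int, forall k, k0 <= k -> forall a, A a -> pball a k `<=` A.
Proof.
move=> cA oA; have [|k0 h] := lebesgue_number (P := fun a k => pball a k `<=` A) cA.
  move=> a /oA/nbhs_pballP[k0 k0A]; exists k0 => b k ab k0k x bx; apply: k0A.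
  by apply: pball_trans ab _; exact: pballW bx.
by exists k0 => k k0k a Aa; exact: h.
Qed.

Definition modulus J := mu (mximg J (pball 0 0)).

Lemma haar_ball k : mu (pball 0 k) = ((q ^ (- k)) ^+ n)%:E.
Proof. by rewrite -lbox_cst haar_lbox// prodr_const card_ord. Qed.

(** [A] and the unit polydisc are cut into balls of one common exponent, so the unknown measure of
    the image of such a ball can be eliminated. *)
Lemma haar_mximg J A : J \in unitmx -> compact A -> open A ->
  mu (mximg J A) = (modulus J * mu A)%E.
Proof.
move=> uJ cA oA; have [k0 k0A] := open_unif cA oA.
(* [k >= 0] makes the unit polydisc a union of balls of exponent [k] as well. *)
pose k := Num.max 0 k0.
have k_ge0 : 0 <= k by rewrite le_max lexx.
have [N [-> ->]] : exists N : nat, mu A = (N%:R%:E * mu (pball 0 k))%E /\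
    mu (mximg J A) = (N%:R%:E * mu (mximg J (pball 0 k)))%E.
  by apply: ball_count => //; apply: k0A; rewrite le_max lexx orbT.
have [a a0|N' [N1 N2]] := ball_count uJ (@cpt 0 0) (k := k).
  by rewrite -(pball_eq a0); exact: pballW.
have : (N'%:R * (q ^ (- k)) ^+ n)%:E = 1%E :> \bar R.
  by rewrite -(haar_O mu_haar) N1 haar_ball.
rewrite /modulus N2 haar_ball => -[N'q].
rewrite muleCA; congr (_ * _)%E; rewrite -muleA muleCA -EFinM.
by rewrite N'q mule1.
Qed.

Lemma modulusM J1 J2 : J1 \in unitmx -> J2 \in unitmx ->
  modulus (J1 *m J2) = (modulus J1 * modulus J2)%E.
Proof.
move=> u1 u2; rewrite /modulus mximgM haar_mximg//.
- by rewrite muleC.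
- exact: compact_mximg.
- by apply: open_mximg => //; exact: open_pball.
Qed.

Lemma modulus1 : modulus 1%:M = 1%E.
Proof.
rewrite /modulus -[RHS](haar_O mu_haar); congr (mu _); rewrite -[RHS]image_id.
by apply: eq_imagel => x _; rewrite mulmx1.
Qed.

Definition int_mx m1 m2 (M : 'M[K]_(m1, m2)) := forall i j, V 0 (M i j).

Lemma modulus_int J : J \in unitmx -> int_mx J -> int_mx (invmx J) ->
  modulus J = 1%E.
Proof.
move=> uJ iJ iJV; rewrite /modulus -[RHS](haar_O mu_haar); congr (mu _).
have sub (M : 'M[K]_n) : int_mx M -> forall x : 'rV[K]_n, pball 0 0 x -> pball 0 0 (x *m M).
  move=> iM x x0 j; rewrite [X in _ - X]mxE subr0.
  by apply: (@vge_mulmx 0 0) => // i; have := x0 i; rewrite mxE subr0.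
rewrite mximg_preimage//; apply/seteqP; split=> x /= x0; last exact: sub.
by rewrite -(mulmxKV uJ x); exact: sub.
Qed.

Lemma vge_det m (M : 'M[K]_m) : int_mx M -> V 0 (\det M).
Proof.
move=> iM; apply: vge_sum => s _; apply: vgeMl.
  by case: (perm.odd_perm s); rewrite ?expr1 ?expr0 ?vgeN vgeE ?oner_neq0// ord_one.
elim/big_rec: _ => [|i x _]; first by rewrite vgeE ?oner_neq0// ord_one.
by move=> x0; apply: vgeMl.
Qed.

Lemma int_invmx (M : 'M[K]_n) : int_mx M -> V 0 (\det M)^-1 -> int_mx (invmx M).
Proof.
move=> iM dM i j; rewrite /invmx; case: ifP => // _; rewrite !mxE.
apply: vgeMl => //; rewrite /cofactor; apply: vgeMl.
  elim: (_ + _)%N => [|k IH]; first by rewrite expr0 vgeE ?oner_neq0// ord_one.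
  by rewrite exprS mulN1r vgeN.
by apply: vge_det => i' j'; rewrite !mxE.
Qed.

Lemma modulus_diag (d : 'rV[K]_n) : (forall i, d 0 i != 0) ->
  modulus (diag_mx d) = (\prod_i q ^ (- ord (d 0 i)))%:E.
Proof.
move=> d0; rewrite -(haar_lbox mu_haar) /modulus; congr (mu _).
apply/seteqP; split=> [_ [x x0 <-] i|x xl].
  rewrite mul_mx_diag mxE -(add0r (ord _)); apply: vgeM; last by rewrite vgeE.
  by have := x0 i; rewrite mxE subr0.
exists (\row_i (x 0 i / d 0 i)).
  move=> i; rewrite !mxE subr0 -(subrr (ord (d 0 i))).
  apply: vgeM; first exact: xl.
  by rewrite vgeE ?invr_neq0// ordV.
by apply/rowP => i; rewrite mul_mx_diag !mxE mulfVK.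
Qed.

Lemma diag_unitmx (d : 'rV[K]_n) : (forall i, d 0 i != 0) -> diag_mx d \in unitmx.
Proof. by move=> d0; rewrite unitmxE det_diag unitfE; apply/prodf_neq0 => i _. Qed.

(* Conjugating by a diagonal matrix of large powers of the uniformizer makes a
   unitriangular matrix integral. *)
Lemma modulus_unitri (T : 'M[K]_n) (wt : 'I_n -> int) : \det T = 1 ->
  (forall i, T i i = 1) ->
  (forall i j, i != j -> T i j != 0 -> 1 <= wt i - wt j) -> modulus T = 1%E.
Proof.
move=> dT T1 Tw; have [c Tc] := mx_vge T.
(* Conjugation multiplies [T i j] by [unif ^ (s * (wt i - wt j))], whose valuation is at least
   [s >= - c] when [T i j] is a nonzero off-diagonal entry. *)
pose s := `|c|; pose d : 'rV[K]_n := \row_i unif ^ (s * wt i).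
pose d' : 'rV[K]_n := \row_i unif ^ (- (s * wt i)).
have d0 i : d 0 i != 0 by rewrite mxE unifX_neq0.
have d'0 i : d' 0 i != 0 by rewrite mxE unifX_neq0.
have dd' : diag_mx d *m diag_mx d' = 1%:M.
  rewrite mulmx_diag -diag_const_mx; congr diag_mx; apply/rowP => i.
  by rewrite !mxE -expfzDr ?unif_neq0// subrr.
have uT : T \in unitmx by rewrite unitmxE dT unitr1.
have ud := diag_unitmx d0; have ud' := diag_unitmx d'0.
have : modulus (diag_mx d *m T *m diag_mx d') = 1%E.
  have uM : diag_mx d *m T *m diag_mx d' \in unitmx by rewrite !unitmx_mul ud uT.
  have iM : int_mx (diag_mx d *m T *m diag_mx d').
    move=> i j; rewrite mul_mx_diag mul_diag_mx !mxE.
    have [->|ij] := eqVneq i j.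
      rewrite T1 mulr1 -expfzDr ?unif_neq0// subrr expr0z.
      by rewrite vgeE ?oner_neq0// ord_one.
    have [->|Tij] := eqVneq (T i j) 0; first by rewrite mulr0 mul0r vge0.
    rewrite mulrAC -expfzDr ?unif_neq0// -mulrBr.
    apply: (@vgeW _ _ (s * (wt i - wt j) + c)); last first.
      by apply: vgeM => //; rewrite vgeE ?unifX_neq0// ord_unifX.
    have := Tw i j ij Tij; rewrite /s; nia.
  apply: modulus_int => //; apply: int_invmx => //.
  have := congr1 determinant dd'; rewrite det_mulmx det1 => ddet.
  by rewrite !det_mulmx dT mulr1 ddet invr1 vgeE ?oner_neq0// ord_one.
(* By multiplicativity the moduli of the two diagonal matrices cancel. *)
rewrite !modulusM ?unitmx_mul ?ud ?uT// => <-.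
by rewrite -muleA muleCA -modulusM// dd' modulus1 mule1.
Qed.

Lemma modulus_perm J : is_perm_mx J -> modulus J = 1%E.
Proof.
move=> /is_perm_mxP[s ->].
have ip (s' : 'S_n) : int_mx (perm_mx s').
  move=> i j; rewrite !mxE; case: eqP => _; last exact: vge0.
  by rewrite vgeE ?oner_neq0// ord_one.
apply: modulus_int => //; first exact: unitmx_perm.
apply: int_invmx => //; rewrite det_perm.
by case: (perm.odd_perm s); rewrite ?expr1 ?expr0 ?invrN1 ?invr1 ?vgeN vgeE ?oner_neq0// ord_one.
Qed.
End LinearScaling.

Section Modulus.
Variables (R : realType) (p : nat) (K : pfield p).
Local Notation ord := (@ord p K).
Local Notation q := ((pf_q K)%:R : R).

Lemma ord_prod I (r : seq I) (F : I -> K) : (forall i, F i != 0) ->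
  ord (\prod_(i <- r) F i) = \sum_(i <- r) ord (F i).
Proof.
move=> F0; elim: r => [|i r IH]; first by rewrite !big_nil ord_one.
rewrite !big_cons ordM// ?IH//.
by elim/big_rec: _ => [|j x _ x0]; rewrite ?oner_neq0// mulf_neq0.
Qed.

(** Multiplicativity reduces the claim to the factors of an LUP decomposition. The upper triangular
    factor splits further into a diagonal matrix and a unitriangular [W]; permutation and
    unitriangular matrices have modulus 1, so only the diagonal counts. *)
Lemma modulus_det n (mu : {measure set (borelKn K n) -> \bar R})
    (mu_haar : normalized_haar mu)
    (cpt : forall (a : 'rV[K]_n) k, compact (pball a k)) (J : 'M[K]_n) :
  J \in unitmx -> modulus mu J = (q ^ (- ord (\det J)))%:E.
Proof.
case: n => [|n] in mu mu_haar cpt J *.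
  move=> _; rewrite flatmx0 -(flatmx0 1%:M) det1 ord_one oppr0 expr0z.
  exact: modulus1.
move=> uJ; have := cormen_lup_correct J; have := cormen_lup_perm J.
have := cormen_lup_detL J; have := cormen_lup_lower J; have := cormen_lup_upper J.
case: (cormen_lup J) => -[P L] U /= U0 L0 dL pP PJ.
have uP : P \in unitmx by move/is_perm_mxP: pP => [s ->]; exact: unitmx_perm.
have uL : L \in unitmx by rewrite unitmxE dL unitr1.
have uU : U \in unitmx.
  have : P * J \in unitmx by rewrite unitmx_mul uP.
  by rewrite PJ unitmx_mul uL.
have dU : \det U = \prod_i U i i.
  rewrite -det_tr det_trig; first by apply: eq_bigr => i _; rewrite mxE.
  by apply/is_trig_mxP => i j ij; rewrite mxE U0.
have Ui i : U i i != 0.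
  by move: uU; rewrite unitmxE dU unitfE => /prodf_neq0; exact.
(* The weights increase with the index for the lower triangular [L] and decrease for the upper
   triangular [W]. *)
have mL : modulus mu L = 1%E.
  apply: (modulus_unitri mu_haar cpt (wt := fun i => (i : nat)%:Z)) => //.
    by move=> i; rewrite L0// eqxx.
  move=> i j ij; case: (leqP i j) => [/L0->|ji _]; last by lia.
  by rewrite (negbTE ij) eqxx.
pose d : 'rV[K]_n.+1 := \row_i U i i.
have d0 i : d 0 i != 0 by rewrite mxE.
pose W : 'M[K]_n.+1 := \matrix_(i, j) (U i j / U i i).
have ud := diag_unitmx d0.
have UE : U = diag_mx d *m W.
  by apply/matrixP => i j; rewrite mul_diag_mx !mxE mulrCA divff// mulr1.
have dW : \det W = 1.
  have : \det U != 0 by rewrite dU; apply/prodf_neq0.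
  have := congr1 determinant UE; rewrite det_mulmx det_diag.
  under eq_bigr do rewrite mxE.
  rewrite -dU => dUW dU0; apply: (mulfI dU0).
  by rewrite -dUW mulr1.
have WE i j : W i j = U i j / U i i by rewrite mxE.
have mW : modulus mu W = 1%E.
  apply: (modulus_unitri mu_haar cpt (wt := fun i => - (i : nat)%:Z)).
  - exact: dW.
  - by move=> i; rewrite WE divff.
  - move=> i j ij; rewrite WE; case: (ltnP j i) => [/U0->|ij']; first by rewrite mul0r eqxx.
    move=> _; have : (i : nat) != j by apply: contra_neq ij => /val_inj.
    by lia.
have -> : modulus mu J = modulus mu U.
  have := congr1 (modulus mu) PJ; rewrite !modulusM//.
  by rewrite modulus_perm// mL !mul1e.
have uW : W \in unitmx by rewrite unitmxE dW unitr1.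
rewrite UE modulusM// mW mule1 modulus_diag//; congr (_%:E).
have -> : ord (\det J) = ord (\det U).
  have := congr1 determinant PJ; rewrite !det_mulmx dL mul1r => <-.
  move/is_perm_mxP: pP => [s ->]; rewrite det_perm; case: (perm.odd_perm s).
    by rewrite expr1 mulN1r ordN.
  by rewrite expr0 mul1r.
rewrite dU ord_prod//; under eq_bigr do rewrite mxE.
elim/big_rec2: _ => [|i x y _ ->]; first by rewrite oppr0 expr0z.
by rewrite opprD expfzDr// q_neq0.
Qed.

End Modulus.

(** * Strict differentiability and change of variables *)

Section StrictDifferentiability.
Variables (p : nat) (K : pfield p).
Local Notation V := (vge (@ord p K)).
Local Notation ord := (@ord p K).
Local Notation unif := (@unif p K).

(* Unlike plain differentiability, this is enough for the local inversion
   theorem; unlike analyticity, it is immediately stable under composition. *)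
Definition sdiff n m (f : 'rV[K]_n -> 'rV[K]_m) (a : 'rV[K]_n) (J : 'M[K]_(n, m)) :=
  forall k : int, exists l : int, forall x y e, pball a l x -> pball a l y ->
    pball y e x -> pball ((x - y) *m J) (e + k) (f x - f y).

Lemma pball0B n (x y : 'rV[K]_n) k : pball y k x <-> (forall i, V k ((x - y) 0 i)).
Proof. by split=> h i; have := h i; rewrite !mxE. Qed.

Lemma sdiff_lip n m (f : 'rV[K]_n -> 'rV[K]_m) a J : sdiff f a J ->
  exists l c : int, forall x y e, pball a l x -> pball a l y ->
    pball y e x -> pball (f y) (e + c) (f x).
Proof.
move=> fJ; have [c Jc] := mx_vge J; have [l lP] := fJ c; exists l, c.
move=> x y e ax ay yx i.
rewrite (_ : _ - _ = (f x - f y) 0 i - ((x - y) *m J) 0 i + ((x - y) *m J) 0 i).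
  apply: vgeD; first exact: lP.
  by apply: vge_mulmx => //; exact/pball0B.
by rewrite subrK !mxE.
Qed.

Lemma sdiff_continuous n m (f : 'rV[K]_n -> 'rV[K]_m) a J :
  sdiff f a J -> {for a, continuous f}.
Proof.
move=> /sdiff_lip[l [c h]]; apply/continuous_pballP => k.
exists (Num.max l (k - c)) => x ax.
rewrite /= -(subrK c k); apply: h; last by apply: pballW ax; rewrite le_max lexx orbT.
  by apply: pballW ax; rewrite le_max lexx.
exact: pball_refl.
Qed.

Lemma sdiff_near n m (f g : 'rV[K]_n -> 'rV[K]_m) a J :
  (\forall x \near a, f x = g x) -> sdiff f a J -> sdiff g a J.
Proof.
move=> /nbhs_pballP[l0 fg] fJ k; have [l lP] := fJ k.
exists (Num.max l0 l) => x y e ax ay yx.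
have w z : pball a (Num.max l0 l) z -> pball a l z /\ f z = g z.
  by move=> az; split; [|apply: fg]; apply: pballW az; rewrite le_max lexx ?orbT.
by have [ax' <-] := w _ ax; have [ay' <-] := w _ ay; exact: lP.
Qed.

Lemma sdiff_comp n m r (f : 'rV[K]_n -> 'rV[K]_m) (g : 'rV[K]_m -> 'rV[K]_r) a J J' :
  sdiff f a J -> sdiff g (f a) J' -> sdiff (g \o f) a (J *m J').
Proof.
move=> fJ gJ k; have [c' Jc'] := mx_vge J'.
(* The total error is the error of [g] along the increment of [f], which has exponent [e + c], plus
   the image under [J'] of the error of [f], which loses [c']. The precisions [k - c] and [k - c']
   compensate for this. *)
have [l1 [c lip]] := sdiff_lip fJ; have [l2 l2P] := fJ (k - c').
have [l3 l3P] := gJ (k - c); have /continuous_pballP/(_ l3)[l4 l4P] := sdiff_continuous fJ.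
pose l := Num.max (Num.max l1 l2) l4.
have w z : pball a l z -> [/\ pball a l1 z, pball a l2 z & pball (f a) l3 (f z)].
  by move=> az; split; last apply: l4P; apply: pballW az; rewrite /l !le_max lexx ?orbT.
exists l => x y e /w[x1 x2 x3] /w[y1 y2 y3] yx i /=.
rewrite (_ : _ - _ = ((g (f x) - g (f y)) 0 i - ((f x - f y) *m J') 0 i) +
   ((f x - f y - (x - y) *m J) *m J') 0 i); last first.
  rewrite [(_ - _ *m J) *m J']mulmxBl [X in _ = _ + X]mxE.
  by rewrite [X in _ = _ + (_ + X)]mxE addrA subrK mulmxA.
apply: vgeD.
  rewrite (_ : e + k = e + c + (k - c)); last by lia.
  by apply: l3P => //; apply: lip.
rewrite (_ : e + k = e + (k - c') + c'); last by lia.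
by apply: vge_mulmx => //; apply/pball0B; exact: l2P.
Qed.

(** Both derivatives are tested on increments along a coordinate axis by a high power of the
    uniformizer. This transfers the determinant known for the matrix of partial derivatives to the
    strict derivative. *)
Lemma sdiff_jacobian n (f : 'rV[K]_n -> 'rV[K]_n) a J J' :
  sdiff f a J -> is_jacobian f a J' -> J' = J.
Proof.
move=> fJ fJ'; apply/matrixP => i j; apply/eqP; rewrite -subr_eq0; apply/eqP.
apply: vge_inj => k; have [l lP] := fJ k.
have /(fJ' i j) : nbhs (J' i j) [set d | V k (d - J' i j)] by exists k.
move=> [l' l'P]; pose t := unif ^ (Num.max l l').
have t0 : t != 0 by exact: unifX_neq0.
have ordt : ord t = Num.max l l' by exact: ord_unifX.
have /= := l'P t _ t0; rewrite subr0 vgeE// ordt le_max lexx orbT => /(_ isT) h.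
apply: vge_trans (_ : V k (_ - (f (a + t *: delta_mx 0 i) 0 j - f a 0 j) / t)) _.
  by rewrite vgeBC.
have h2 : pball a (ord t) (a + t *: delta_mx 0 i).
  move=> i'; rewrite !mxE addrAC subrr add0r eqxx/=.
  by case: eqP => _; rewrite ?mulr1 ?mulr0 ?vge0// vgeE.
have := lP _ _ _ (pballW _ h2) (pball_refl _ _) h2 j.
rewrite ordt le_max lexx => /(_ isT); rewrite [in _ + _ - a]addrAC subrr add0r.
rewrite -scalemxAl -rowE !mxE => h3.
have -> : (f (a + t *: delta_mx 0 i) 0 j - f a 0 j) / t - J i j =
  (f (a + t *: delta_mx 0 i) 0 j - f a 0 j - t * J i j) * t^-1.
  by rewrite [RHS]mulrBl mulrAC divff// mul1r.
rewrite (_ : k = Num.max l l' + k - ord t); last by rewrite ordt; lia.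
by apply: vgeM => //; rewrite vgeE ?invr_neq0// ordV.
Qed.

End StrictDifferentiability.

(** * Analytic functions are strictly differentiable *)

Section Analytic.
Variables (p : nat) (K : pfield p).
Local Notation V := (vge (@ord p K)).
Local Notation ord := (@ord p K).
Local Notation unif := (@unif p K).

(* The bounds satisfied by the values [P] and [Q] of a monomial of degree [d] at
   two points of the ball [pball 0 k] that are congruent modulo [P^e]. *)
Definition close_deg (k e : int) (d : nat) (P Q : K) :=
  [/\ V (d%:Z * k) P, V (d%:Z * k) Q & V (e + (d%:Z - 1) * k) (P - Q)].

Lemma close_deg1 k e : close_deg k e 0 1 1.
Proof.
by rewrite /close_deg mul0r subrr vge0 vgeE ?oner_neq0// ord_one.
Qed.

Lemma close_degM k e d d' P Q P' Q' : close_deg k e d P Q -> close_deg k e d' P' Q' ->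
  close_deg k e (d + d') (P * P') (Q * Q').
Proof.
move=> [dP dQ dPQ] [dP' dQ' dPQ']; rewrite /close_deg PoszD mulrDl; split.
- exact: vgeM.
- exact: vgeM.
rewrite (_ : P * P' - _ = (P - Q) * P' + Q * (P' - Q')); last by ring.
apply: vgeD.
  rewrite (_ : _ + _ = e + (d%:Z - 1) * k + d'%:Z * k); last by ring.
  exact: vgeM.
rewrite (_ : _ + _ = d%:Z * k + (e + (d'%:Z - 1) * k)); last by ring.
exact: vgeM.
Qed.

Lemma close_deg_monomial n k e (z w : 'rV[K]_n) (m : {ffun 'I_n -> nat}) :
  pball 0 k z -> pball 0 k w -> pball w e z ->
  close_deg k e (\sum_i m i)%N (monomial z m) (monomial w m).
Proof.
move=> z0 w0 zw; rewrite /monomial.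
elim/big_rec3: _ => [|i d P Q _ IH]; first exact: close_deg1.
apply: close_degM IH; elim: (m i) => [|j IH]; first by rewrite !expr0; exact: close_deg1.
rewrite !exprS -add1n; apply: close_degM IH; rewrite /close_deg mul1r subrr mul0r addr0.
by split => //; [have := z0 i|have := w0 i]; rewrite mxE subr0.
Qed.

(** Adding an index to a finite set beyond which all partial sums agree modulo [P^0] changes the sum
    by an integral element, so all but finitely many terms are integral. *)
Lemma has_sum_bounded (I : choiceType) (u : I -> K) l : has_sum u l ->
  exists C : int, forall i, V C (u i).
Proof.
move=> ul; have [A0 A0P] := ul 0.
exists (- \big[Num.max/0]_(i <- enum_fset A0) - ord (u i)) => i.
have [iA|iA] := boolP (i \in A0).
  rewrite /vge; apply/orP; right; rewrite lerNl.
  exact: (@le_bigmax_seq _ _ _ _ 0 i xpredT (fun i => - ord (u i)) iA isT).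
have : V 0 (u i).
  have h1 := A0P _ (fsubset_refl A0).
  have h2 := A0P _ (fsubsetU1 i A0).
  have := vgeB h2 h1; rewrite opprB subrKA big_fsetU1//=.
  by rewrite addrK.
by apply: vgeW; rewrite oppr_le0; exact: bigmax_ge_id.
Qed.

End Analytic.

Section AnalyticStrict.
Variables (p : nat) (K : pfield p).
Local Notation V := (vge (@ord p K)).
Local Notation ord := (@ord p K).
Local Notation unif := (@unif p K).

Definition mdeg n (m : {ffun 'I_n -> nat}) := (\sum_i m i)%N.
Definition mdelta n (i : 'I_n) : {ffun 'I_n -> nat} := [ffun j => (j == i) : nat].

Lemma monomial_mdelta n (z : 'rV[K]_n) i : monomial z (mdelta i) = z 0 i.
Proof.
rewrite /monomial (bigD1 i)//= ffunE eqxx expr1 big1 ?mulr1// => j ji.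
by rewrite ffunE (negbTE ji) expr0.
Qed.

Lemma mdeg_eq1 n (m : {ffun 'I_n -> nat}) : (mdeg m == 1)%N = (m \in codom (@mdelta n)).
Proof.
apply/eqP/codomP => [|[i ->]]; last first.
  rewrite /mdeg (bigD1 i)//= ffunE eqxx big1 ?addn0// => j ji.
  by rewrite ffunE (negbTE ji).
move=> m1; have [i mi] : exists i, m i != 0%N.
  apply/existsP; apply: contra_eqT m1 => /existsPn m0.
  by rewrite /mdeg big1// => i _; apply/eqP; have := m0 i; rewrite negbK.
exists i; apply/ffunP => j; rewrite ffunE.
move: m1; rewrite /mdeg (bigD1 i)//=; case: eqVneq => [-> //|ji]; first lia.
by rewrite (bigD1 j)//=; lia.
Qed.

Lemma mdelta_inj n : injective (@mdelta n).
Proof.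
by move=> i j /ffunP/(_ i); rewrite !ffunE eqxx; case: eqVneq.
Qed.

Lemma analytic_sdiff1 n (f : 'rV[K]_n -> K) a : analytic_at f a ->
  exists L : 'cV[K]_n, forall k : int, exists l : int, forall x y e,
    pball a l x -> pball a l y -> pball y e x ->
    V (e + k) (f x - f y - ((x - y) *m L) 0 0).
Proof.
move=> [c /nbhs_pballP[l0 fc]].
(* Cauchy's estimate: summability at the single point [a + x0], whose increments all have valuation
   [l0], bounds every coefficient. *)
pose x0 : 'rV[K]_n := const_mx (unif ^ l0).
have mon_x0 m : monomial x0 m = (unif ^ l0) ^+ mdeg m.
  by rewrite /monomial/mdeg expr_sum; apply: eq_bigr => i _; rewrite mxE.
have [C CP] : exists C : int, forall m, V (C - l0 * (mdeg m)%:Z) (c m).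
  have ax0 : pball a l0 (a + x0).
    by move=> i; rewrite !mxE addrAC subrr add0r vgeE ?unifX_neq0// ord_unifX.
  have [C CP] := has_sum_bounded (fc _ ax0); exists C => m.
  have := CP m; rewrite addrAC subrr add0r mon_x0 => h.
  have u0 : (unif ^ l0) ^+ mdeg m != 0 by rewrite expf_neq0// unifX_neq0.
  rewrite -(mulfK u0 (c m)); apply: vgeM => //.
  by rewrite vgeE ?invr_neq0// ordV// ordX ?unifX_neq0// ord_unifX mulrC.
exists (\col_i c (mdelta i)) => k.
(* In degree [d >= 2] the error has valuation at least [C - l0 * d + e + (d - 1) * l]. As [l >= l0],
   the worst case is [d = 2], where the bound [e + k] asks for [l >= k - C + 2 * l0]. *)
pose l := Num.max l0 (k - C + 2 * l0).
have l0l : l0 <= l by rewrite /l le_max lexx.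
have lk : k - C + 2 * l0 <= l by rewrite /l le_max lexx orbT.
exists l => x y e ax ay yx.
have [A1 A1P] := fc _ (pballW l0l ax) (e + k).
have [A2 A2P] := fc _ (pballW l0l ay) (e + k).
(* One finite set approximates both values. It contains all exponents of degree one, which give the
   linear part; the term of degree zero cancels in the difference. *)
pose A := (A1 `|` A2 `|` [fset m | m in codom (@mdelta n)])%fset.
have {}A1P := A1P A (fsubset_trans (fsubsetUl _ _) (fsubsetUl _ _)).
have {}A2P := A2P A (fsubset_trans (fsubsetUr _ _) (fsubsetUl _ _)).
pose D m := c m * (monomial (x - a) m - monomial (y - a) m).
have -> : ((x - y) *m (\col_i c (mdelta i))) 0 0 = \sum_(m <- A | mdeg m == 1%N) D m.
  rewrite -big_filter (perm_big (codom (@mdelta n))); last first.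
    apply: uniq_perm; first by rewrite filter_uniq// fset_uniq.
      by rewrite map_inj_uniq ?enum_uniq//; exact: mdelta_inj.
    move=> m; rewrite mem_filter mdeg_eq1; apply: andb_idr => mA.
    by rewrite !inE mA orbT.
  rewrite big_map big_enum/= mxE; apply: eq_bigr => i _.
  rewrite /D !monomial_mdelta !mxE mulrC; congr (_ * _).
  by rewrite opprB addrA subrK.
have -> : f x - f y - \sum_(m <- A | mdeg m == 1%N) D m =
   (\sum_(m <- A) c m * monomial (y - a) m - f y) -
   (\sum_(m <- A) c m * monomial (x - a) m - f x) +
   \sum_(m <- A | mdeg m != 1%N) D m.
  have : \sum_(m <- A) D m = \sum_(m <- A) c m * monomial (x - a) m -
    \sum_(m <- A) c m * monomial (y - a) m.
    by rewrite -sumrB; apply: eq_bigr => m _; rewrite /D mulrBr.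
  rewrite (bigID (fun m => mdeg m == 1%N))/= => /(canRL (addKr _)) ->.
  by rewrite addrC; ring.
apply: vgeD; first exact: vgeB.
apply: vge_sum => m m1.
have xa0 : pball 0 l (x - a) by move=> i; rewrite !mxE subr0; exact: ax.
have ya0 : pball 0 l (y - a) by move=> i; rewrite !mxE subr0; exact: ay.
have xya : pball (y - a) e (x - a).
  by move=> i; rewrite !mxE opprB addrA subrK; exact: yx.
have [_ _ h] := close_deg_monomial m xa0 ya0 xya; rewrite -/(mdeg m) in h.
have [m0|m0] := eqVneq (mdeg m) 0%N.
  rewrite /D (_ : monomial (x - a) m = monomial (y - a) m) ?subrr ?mulr0 ?vge0//.
  rewrite /monomial; apply: eq_bigr => i _.
  suff -> : m i = 0%N by rewrite !expr0.
  by apply/eqP; move/eqP: m0; rewrite sum_nat_eq0 => /forallP/(_ i).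
apply: vgeW (vgeM (CP m) h).
have : exists d : nat, mdeg m = d.+2 by case: (mdeg m) m0 m1 => [|[|d]]// _ _; exists d.
move=> [d ->]; nia.
Qed.

Lemma analytic_sdiff n m (f : 'rV[K]_n -> 'rV[K]_m) a : vanalytic_at f a ->
  exists J, sdiff f a J.
Proof.
move=> fa; have /choice[L LP] := fun j => analytic_sdiff1 (fa j).
exists (\matrix_(i, j) L j i 0) => k.
have /choice[l lP] := fun j => LP j k.
exists (\big[Num.max/0]_j l j) => x y e ax ay yx j.
have w z : pball a (\big[Num.max/0]_j l j) z -> pball a (l j) z.
  by apply: pballW; exact: le_bigmax.
have := lP j x y e (w _ ax) (w _ ay) yx; congr (is_true (V _ _)).
rewrite !mxE; congr (_ - _).
by apply: eq_bigr => i _; rewrite !mxE.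
Qed.

End AnalyticStrict.

(** * Images of small balls and change of variables *)

Section LocalChange.
Variables (R : realType) (p : nat) (K : pfield p) (n : nat).
Local Notation V := (vge (@ord p K)).
Local Notation ord := (@ord p K).
Local Notation unif := (@unif p K).
Local Notation B := (borelKn K n).
Local Notation q := ((pf_q K)%:R : R).

(* No completeness is needed: surjectivity onto the linear image of the ball
   comes from the given continuous local inverse [g]. *)
Lemma sdiff_ball (f g : 'rV[K]_n -> 'rV[K]_n) a J : sdiff f a J -> J \in unitmx ->
  {for f a, continuous g} -> g (f a) = a -> (\forall z \near f a, f (g z) = z) ->
  exists k0 : int, forall b k, pball a k0 b -> k0 <= k ->
    f @` pball b k = (fun z : 'rV[K]_n => z - f b) @^-1` mximg J (pball 0 k).
Proof.
move=> fJ uJ gc ga /nbhs_pballP[l1 fg].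
have [c Jc] := mx_vge (invmx J); have [d Jd] := mx_vge J.
(* [c] bounds [invmx J], so [f] followed by [invmx J] moves differences of points as the identity
   does, up to an error one unit of valuation smaller than the difference. *)
have [l lP] := fJ (1 - c).
have err x y e : pball a l x -> pball a l y -> pball y e x ->
    pball (x - y) (e + 1) ((f x - f y) *m invmx J).
  move=> ax ay yx; apply/pball0B.
  have -> : (f x - f y) *m invmx J - (x - y) =
      (f x - f y - (x - y) *m J) *m invmx J by rewrite [RHS]mulmxBl mulmxK.
  rewrite (_ : e + 1 = e + (1 - c) + c); last by lia.
  by apply: vge_mulmx => //; apply/pball0B; exact: lP.
have [l2 [c2 lip]] := sdiff_lip fJ.
have /continuous_pballP/(_ l)[l3 l3P] := gc; rewrite ga in l3P.
pose l4 := Num.max l1 l3.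
pose k0 := Num.max (Num.max l l2) (Num.max (l4 - c2) (l4 - d)).
have k0P : [/\ l <= k0, l2 <= k0, l4 - c2 <= k0 & l4 - d <= k0].
  by rewrite /k0 !le_max !lexx ?orbT.
have [kl kl2 kl4 kl4'] := k0P.
exists k0 => b k ab k0k; rewrite mximg_preimage//.
have abl : pball a l b by exact: pballW ab.
apply/seteqP; split=> [_ [x bx <-]|z bz] /=.
  have axl : pball a l x.
    by apply: pball_trans abl _; apply: pballW bx; exact: le_trans k0k.
  have h := err x b k axl abl bx.
  move=> i; rewrite [X in _ - X]mxE subr0 -[_ 0 i](subrK ((x - b) 0 i)).
  by apply: vgeD; [apply: vgeW (h i); rewrite lerDl|rewrite !mxE; exact: bx].
have z4 : pball (f a) l4 z.
  have h1 : pball (f a) l4 (f b).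
    apply: pballW (_ : pball (f a) (k0 + c2) _); first by rewrite -lerBlDr.
    by apply: lip => //; [exact: pballW ab|exact: pball_refl].
  apply: pball_trans h1 _; apply/pball0B => i.
  rewrite -(mulmxKV uJ (z - f b)); apply: (@vgeW _ _ (k + d)); first by lia.
  by apply: vge_mulmx => // j; have := bz j; rewrite [X in _ - X]mxE subr0.
have fgz : f (g z) = z by apply: fg; apply: pballW z4; rewrite /l4 le_max lexx.
have agz : pball a l (g z).
  by apply: l3P; apply: pballW z4; rewrite /l4 le_max lexx orbT.
exists (g z) => //.
(* Successive approximation: if [g z] agrees with [b] up to exponent [l + N], [err] improves the
   agreement by one unit, until [k] is reached. *)
have step : forall N : nat, (l + N%:Z <= k) -> pball b (l + N%:Z) (g z).
  elim=> [_|N IH lN]; first by rewrite addr0; apply: pball_trans agz; exact: pballC.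
  have {}IH := IH ltac:(lia).
  have h := err _ _ _ agz abl IH; rewrite fgz in h.
  apply/pball0B => i; rewrite (_ : (g z - b) 0 i =
    ((z - f b) *m invmx J) 0 i - (((z - f b) *m invmx J) 0 i - (g z - b) 0 i)).
    apply: vgeB.
      by apply: vgeW lN _; have := bz i; rewrite [X in _ - X]mxE subr0.
    by apply: vgeW (h i); lia.
  by rewrite subKr.
have lk : l <= k by exact: le_trans k0k.
have := step `|k - l|%N; rewrite gez0_abs ?subr_ge0// subrKC; exact.
Qed.

Variables (mu : {measure set B -> \bar R}).
Hypothesis (mu_haar : normalized_haar mu).
Hypothesis cpt : forall (a : 'rV[K]_n) k, compact (pball a k).

(** [sdiff_ball] settles small balls, [lebesgue_number] makes their size uniform on [A], and
    injectivity keeps the images disjoint. Constant valuation of the determinant is enough for the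
    later use, since polydiscs are first cut into pieces where each divisor coordinate has constant
    valuation. *)
Lemma haar_change (f g : 'rV[K]_n -> 'rV[K]_n) (A : set 'rV[K]_n) (m : int) :
  compact A -> open A ->
  {in A &, injective f} ->
  (forall a, A a -> exists J, [/\ sdiff f a J, J \in unitmx & ord (\det J) = m]) ->
  (forall a, A a -> [/\ {for f a, continuous g}, g (f a) = a &
    \forall z \near f a, f (g z) = z]) ->
  open (f @` A) /\ mu (f @` A) = ((q ^ (- m))%:E * mu A)%E.
Proof.
move=> cA oA fi fJ fg.
pose G (C : set 'rV[K]_n) := [/\ open C, open (f @` C) &
  mu (f @` C) = ((q ^ (- m))%:E * mu C)%E].
have [|k0 k0P] := lebesgue_number (P := fun a k => pball a k `<=` A /\ G (pball a k)) cA.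
  move=> a Aa; have [J [aJ uJ dJ]] := fJ _ Aa; have [gc ga fgz] := fg _ Aa.
  have [k1 k1P] := sdiff_ball aJ uJ gc ga fgz.
  have /nbhs_pballP[k2 k2A] := oA _ Aa.
  exists (Num.max k1 k2) => b k ab; rewrite ge_max => /andP[k1k k2k].
  have kk : forall x, pball b k x -> A x.
    move=> x bx; apply: k2A.
    apply: pball_trans (pballW _ bx) => //.
    by apply: pballW ab; rewrite le_max lexx orbT.
  split=> //; rewrite /G k1P//; last by apply: pballW ab; rewrite le_max lexx.
  have ob := open_mximg uJ (@open_pball p K n 0 k).
  split; first exact: open_pball.
    apply: open_comp ob => x _.
    have /= h := @continuous_affine p K n 0 (f b) 1 x.
    by move: h; under eq_fun do rewrite scale1r add0r.
  rewrite haar_shift//; last exact: borel_open.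
  rewrite haar_mximg//; last exact: open_pball.
  by rewrite modulus_det// dJ (haar_pball mu_haar b).
suff [] : G A by [].
apply: (partition_ind (G := G) (cell := fun a => pball a k0) _ _ cA).
- by rewrite /G image_set0 !measure0 mule0; split => //; exact: open0.
- move=> A1 A2 A1A A2A A12 [oA1 of1 m1] [oA2 of2 m2].
  rewrite /G image_setU; split; [exact: openU|exact: openU|].
  rewrite !haarU//; try exact: borel_open; last first.
    apply/seteqP; split=> // _ [[x xA1 <-] [y yA2 fxy]].
    have xy : y = x by apply: fi => //; apply/mem_set; (exact: A2A || exact: A1A).
    have : (A1 `&` A2) x by split=> //; rewrite -xy.
    by rewrite A12.
  by rewrite m1 m2 ge0_muleDr.
- by move=> x _; exact: open_pball.
- by move=> x _; exact: pball_refl.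
- move=> x y Ax xy; split; last exact: pball_eq.
  by have [/(_ y xy)] := k0P _ _ Ax (lexx _).
- by move=> x Ax; have [] := k0P _ _ Ax (lexx _).
Qed.

End LocalChange.

(** * Integration over disjoint unions *)

Section RealIntegral.
Context d (T : measurableType d) (R : realType) (mu : {measure set T -> \bar R}).

(** The explicit bound [m] on the integral of the absolute value carries integrability through
    countable unions, where it is summed along with the value [z]. *)
Definition rint (V : set T) (h : T -> R) (z m : R) := [/\ measurable V,
  measurable_fun V h, (\int[mu]_(x in V) (h x)%:E = z%:E)%E
  & (\int[mu]_(x in V) `|h x|%:E <= m%:E)%E].

Lemma rint_integrable V h z m : rint V h z m -> mu.-integrable V (EFin \o h).
Proof.
move=> [mV mh _ hm]; apply/integrableP; split; first exact/measurable_EFinP.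
by apply: le_lt_trans (ltry m); exact: hm.
Qed.

Lemma rint_cst (V : set T) h (a c : R) : measurable V -> mu V = c%:E ->
  (forall x, V x -> h x = a) -> rint V h (a * c) (`|a| * c).
Proof.
move=> mV Vc ha; split=> //.
- by apply: (eq_measurable_fun (cst a)) => [x /set_mem/ha//|].
- rewrite (eq_integral (cst a%:E)) ?integral_cst ?Vc// => x /set_mem/ha ->//.
- rewrite (eq_integral (cst `|a|%:E)) ?integral_cst ?Vc// => x /set_mem/ha ->//.
Qed.

Lemma rint_ext (V : set T) h h' (z m : R) : (forall x, V x -> h x = h' x) ->
  rint V h z m -> rint V h' z m.
Proof.
move=> hh [mV mh zh hm]; split=> //.
- by apply: eq_measurable_fun mh => x /set_mem/hh.
- by rewrite -zh; apply: eq_integral => x /set_mem/hh ->.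
- rewrite (eq_integral (fun x => `|h x|%:E))// => x /set_mem/hh ->.
  by [].
Qed.

Lemma rintU (V W : set T) h z m z' m' : V `&` W = set0 -> rint V h z m ->
  rint W h z' m' -> rint (V `|` W) h (z + z') (m + m').
Proof.
move=> VW [mV mhV zV hV] [mW mhW zW hW].
have mU : measurable_fun (V `|` W) h by apply/measurable_funU.
have dis : [disjoint V & W] by apply/disj_setPS; rewrite VW.
split=> //; first exact: measurableU.
  by rewrite integral_setU ?zV ?zW//; exact/measurable_EFinP.
rewrite ge0_integral_setU ?EFinD ?leeD//.
by apply/measurable_EFinP; exact: measurableT_comp.
Qed.

Lemma rint_bigcup (F : nat -> set T) h (z m : nat -> R) (z0 m0 : R) :
  trivIset setT F -> (forall k, rint (F k) h (z k) (m k)) ->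
  (forall N, \sum_(k < N) m k <= m0) ->
  (\sum_(k < N) z k @[N --> \oo] --> z0) ->
  rint (\bigcup_k F k) h z0 m0.
Proof.
move=> tF hF mm0 zz0.
have mF k : measurable (F k) by have [] := hF k.
have mh : measurable_fun (\bigcup_k F k) h.
  by apply/measurable_fun_bigcup => // k; have [] := hF k.
have mU : measurable (\bigcup_k F k) by exact: bigcup_measurable.
have mabs : measurable_fun (\bigcup_k F k) (fun x => `|h x|%:E).
  by apply/measurable_EFinP; exact: measurableT_comp.
have habs : (\int[mu]_(x in \bigcup_k F k) `|h x|%:E <= m0%:E)%E.
  rewrite ge0_integral_bigcup//.
  apply: lime_le.
    by apply: is_cvg_ereal_nneg_natsum_cond => n _ _; exact: integral_ge0.
  apply: nearW => N; apply: (@le_trans _ _ (\sum_(0 <= k < N) (m k)%:E)%E).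
    by apply: lee_sum => k _; have [] := hF k.
  by rewrite sumEFin lee_fin big_mkord.
split=> //.
have int : mu.-integrable (\bigcup_k F k) (EFin \o h).
  apply/integrableP; split; first exact/measurable_EFinP.
  by apply: le_lt_trans (ltry m0); exact: habs.
rewrite (integral_bigcup tF mF int); apply/cvg_lim => //.
rewrite (_ : (fun n => _) = EFin \o (fun N => \sum_(k < N) z k)).
  by apply: cvg_EFin => //; exact: nearW.
apply/funext => N /=; rewrite big_mkord -sumEFin; apply: eq_bigr => k _.
by have [] := hF k.
Qed.

End RealIntegral.

Section ComplexIntegral.
Context d (T : measurableType d) (R : realType) (mu : {measure set T -> \bar R}).
Local Notation C := R[i].
Local Notation Re := (@complex.Re R).
Local Notation Im := (@complex.Im R).

Definition cint (V : set T) (h : T -> C) (z : C) (m : R) :=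
  rint mu V (Re \o h) (Re z) m /\ rint mu V (Im \o h) (Im z) m.

Definition cmod (z : C) : R := Re `|z|.

Lemma cmodE z : `|z| = (cmod z)%:C.
Proof. by rewrite /cmod; case: z. Qed.

Lemma cmod_ge0 z : 0 <= cmod z.
Proof. by rewrite -lecR -cmodE normr_ge0. Qed.

Lemma cmodM z w : cmod (z * w) = cmod z * cmod w.
Proof.
have := normrM z w; rewrite !cmodE -rmorphM => h.
exact: complexI h.
Qed.

Lemma cmodX z n : cmod (z ^+ n) = cmod z ^+ n.
Proof.
elim: n => [|n IH]; first by rewrite !expr0 /cmod normr1.
by rewrite !exprS cmodM IH.
Qed.

Lemma Re_le_cmod z : `|Re z| <= cmod z.
Proof. by rewrite -lecR -cmodE; exact: normc_ge_Re. Qed.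

Lemma Im_le_cmod z : `|Im z| <= cmod z.
Proof.
have := Re_le_cmod (z * 'i%C); rewrite cmodM [cmod 'i%C](_ : _ = 1).
  by case: z => a b /=; rewrite !mulr0 !mulr1 sub0r normrN.
by rewrite /cmod /= expr0n/= add0r expr1n sqrtr1.
Qed.

Lemma Re_real z (c : R) : Re (z * c%:C) = Re z * c.
Proof. by case: z => a b /=; rewrite mulr0 subr0. Qed.

Lemma Im_real z (c : R) : Im (z * c%:C) = Im z * c.
Proof. by case: z => a b /=; rewrite mulr0 add0r. Qed.

Lemma rint_le V h z m m' : m <= m' -> rint mu V h z m -> rint mu V h z m'.
Proof.
by move=> mm' [? ? ? hm]; split=> //; apply: le_trans hm _; rewrite lee_fin.
Qed.

Lemma cint_cst (V : set T) h (a : C) (c : R) : 0 <= c -> measurable V -> mu V = c%:E ->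
  (forall x, V x -> h x = a) -> cint V h (a * c%:C) (cmod a * c).
Proof.
move=> c0 mV Vc ha; split.
  rewrite Re_real; apply: (@rint_le _ _ _ (`|Re a| * c)).
    by rewrite ler_wpM2r// Re_le_cmod.
  by apply: rint_cst => // x /ha /= ->.
rewrite Im_real; apply: (@rint_le _ _ _ (`|Im a| * c)).
  by rewrite ler_wpM2r// Im_le_cmod.
by apply: rint_cst => // x /ha /= ->.
Qed.

Lemma cint0 (V : set T) h : measurable V -> (forall x, V x -> h x = 0) ->
  cint V h 0 0.
Proof.
move=> mV h0; have r0 (g : T -> R) : (forall x, V x -> g x = 0) -> rint mu V g 0 0.
  move=> g0; split=> //.
  - by apply: (eq_measurable_fun (cst (0:R))) => [x /set_mem/g0//|].
  - by rewrite (eq_integral (cst 0%:E)) ?integral_cst ?mul0e// => x /set_mem/g0 ->.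
  - rewrite (eq_integral (cst 0%:E)) ?integral_cst ?mul0e// => x /set_mem/g0 ->.
    by rewrite normr0.
by split; apply: r0 => x /h0 /= ->.
Qed.

Lemma cint_ext (V : set T) h h' z m : (forall x, V x -> h x = h' x) ->
  cint V h z m -> cint V h' z m.
Proof.
by move=> hh [hr hi]; split; [apply: rint_ext hr|apply: rint_ext hi] => x /hh /= ->.
Qed.

Lemma cintU (V W : set T) h z m z' m' : V `&` W = set0 -> cint V h z m ->
  cint W h z' m' -> cint (V `|` W) h (z + z') (m + m').
Proof.
by move=> VW [hr hi] [hr' hi']; split; rewrite raddfD; exact: rintU.
Qed.

Lemma cint_bigU (I : choiceType) (s : seq I) (F : I -> set T) h (z : I -> C) (m : I -> R) :
  uniq s -> (forall i j, i \in s -> j \in s -> F i `&` F j !=set0 -> i = j) ->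
  (forall i, i \in s -> cint (F i) h (z i) (m i)) ->
  cint (\big[setU/set0]_(i <- s) F i) h (\sum_(i <- s) z i) (\sum_(i <- s) m i).
Proof.
elim: s => [|i s IH]; first by rewrite !big_nil => *; exact: cint0.
move=> /= /andP[ins us] dis hs; rewrite !big_cons; apply: cintU.
- apply/seteqP; split=> // x [ix]; rewrite -bigcup_seq => -[j /= js jx].
  have ij : i = j by apply: dis; rewrite ?inE ?eqxx ?js ?orbT//; exists x.
  by move: ins; rewrite ij js.
- by apply: hs; rewrite mem_head.
- by apply: IH => // [j k js ks|j js]; [apply: dis|apply: hs]; rewrite inE ?js ?ks orbT.
Qed.

Lemma geom_sum (F : fieldType) (r : F) N : r != 1 ->
  \sum_(k < N) r ^+ k = (1 - r ^+ N) / (1 - r).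
Proof.
move=> r1; have r10 : 1 - r != 0 by rewrite subr_eq0 eq_sym.
apply: (canRL (mulfK r10)).
by rewrite -[RHS]opprB subrX1 -[r - 1]opprB mulNr opprK mulrC.
Qed.

Lemma cint_geometric (F : nat -> set T) h (r z : C) (m : R) : 0 <= m ->
  cmod r < 1 -> trivIset setT F ->
  (forall k, cint (F k) h (r ^+ k * z) (cmod r ^+ k * m)) ->
  cint (\bigcup_k F k) h (z / (1 - r)) (m / (1 - cmod r)).
Proof.
move=> m0 r1 tF hF.
have rn1 : r != 1 by apply: contraTneq r1 => ->; rewrite /cmod normr1 ltxx.
have msum N : \sum_(k < N) cmod r ^+ k * m <= m / (1 - cmod r).
  rewrite -mulr_suml geom_sum; last by rewrite lt_eqF.
  rewrite mulrC mulrA ler_pM2r ?invr_gt0 ?subr_gt0// ler_piMr//.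
  by rewrite gerBl exprn_ge0// cmod_ge0.
have zsum N : \sum_(k < N) r ^+ k * z = z / (1 - r) - r ^+ N * (z / (1 - r)).
  by rewrite -mulr_suml geom_sum// mulrBl mul1r mulrBl mulrC mulrAC -mulrA.
have cv : cmod (r ^+ N * (z / (1 - r))) @[N --> \oo] --> (0 : R).
  under eq_fun do rewrite cmodM cmodX.
  rewrite -(mul0r (cmod (z / (1 - r)))); apply: cvgMr_tmp.
  by apply: cvg_expr; rewrite ger0_norm ?cmod_ge0.
(* [f] stands for the real or the imaginary part. *)
have cvz (f : C -> R) : (forall w, `|f w| <= cmod w) ->
    (forall w w', f (w - w') = f w - f w') ->
    (f (\sum_(k < N) r ^+ k * z) @[N --> \oo] --> f (z / (1 - r)))%classic.
  move=> f1 fB; under eq_fun do rewrite zsum fB.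
  suff : (f (z / (1 - r)) - f (r ^+ N * (z / (1 - r))) @[N --> \oo] -->
      f (z / (1 - r)) - 0)%classic by rewrite subr0.
  apply: cvgB; first exact: cvg_cst.
  apply: norm_cvg0; apply: squeeze_cvgr cv; last exact: cvg_cst.
  by apply: nearW => N; rewrite normr_ge0 f1.
split.
  apply: (rint_bigcup tF (fun k => (hF k).1) msum).
  under eq_fun do rewrite -raddf_sum.
  by apply: cvz => [w|w w']; [exact: Re_le_cmod|rewrite raddfB].
apply: (rint_bigcup tF (fun k => (hF k).2) msum).
under eq_fun do rewrite -raddf_sum.
by apply: cvz => [w|w w']; [exact: Im_le_cmod|rewrite raddfB].
Qed.

End ComplexIntegral.

(** * Rational functions with prescribed poles *)

Section RationalFunctions.
Variables (F : numFieldType) (A : set F).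

(* The variable is [q^-s], so that zeros of the denominator at [0] are harmless
   and [f] is prescribed only outside [0] and [A]. *)
Definition ratfun (d : nat) (f : F -> F) := exists P Q : {poly F},
  [/\ Q != 0, forall x, x != 0 -> root Q x -> A x,
      forall x, x != 0 -> (mup x Q <= d)%N
    & forall x, x != 0 -> ~ A x -> f x = P.[x] / Q.[x]].

Lemma ratfun_ext d f g : (forall x, x != 0 -> ~ A x -> g x = f x) ->
  ratfun d f -> ratfun d g.
Proof.
move=> fg [P [Q [Q0 QA Qd fE]]]; exists P, Q; split=> // x x0 nAx.
by rewrite fg// fE.
Qed.

Lemma ratfunW d d' f : (d <= d')%N -> ratfun d f -> ratfun d' f.
Proof.
move=> dd [P [Q [Q0 QA Qd fE]]]; exists P, Q; split=> // x x0.
exact: leq_trans (Qd _ x0) dd.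
Qed.

Lemma ratfun_cst d c : ratfun d (fun=> c).
Proof.
exists c%:P, 1; split; first exact: oner_neq0.
- by move=> x _; rewrite (negbTE (root1 _)).
- by move=> x _; rewrite mupNroot // root1.
- by move=> x _ _; rewrite !hornerE divr1.
Qed.

Lemma ratfunM d d' f g : ratfun d f -> ratfun d' g ->
  ratfun (d + d') (fun x => f x * g x).
Proof.
move=> [P [Q [Q0 QA Qd fE]]] [P' [Q' [Q0' QA' Qd' gE]]].
exists (P * P'), (Q * Q'); split; first by rewrite mulf_neq0.
- by move=> x x0; rewrite rootM => /orP[/QA|/QA']; exact.
- by move=> x x0; rewrite mupM// leq_add ?Qd ?Qd'.
- by move=> x x0 nA; rewrite fE// gE// !hornerM mulf_div.
Qed.

(* The common denominator is the least common multiple, so that the orders of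
   the poles do not add up. *)
Lemma ratfunD d f g : ratfun d f -> ratfun d g -> ratfun d (fun x => f x + g x).
Proof.
move=> [P [Q [Q0 QA Qd fE]]] [P' [Q' [Q0' QA' Qd' gE]]].
pose D := gcdp Q Q'; pose Q1 := Q %/ D; pose Q1' := Q' %/ D.
have D0 : D != 0 by rewrite gcdp_eq0 (negbTE Q0).
have QE : Q = Q1 * D by rewrite divpK// dvdp_gcdl.
have QE' : Q' = Q1' * D by rewrite divpK// dvdp_gcdr.
have Q10 : Q1 != 0 by apply: contraNneq Q0 => h; rewrite QE h mul0r.
have Q10' : Q1' != 0 by apply: contraNneq Q0' => h; rewrite QE' h mul0r.
have cop : coprimep Q1 Q1' by apply: coprimep_div_gcd; rewrite Q0.
exists (P * Q1' + P' * Q1), (Q1 * Q'); split; first by rewrite mulf_neq0.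
- move=> x x0; rewrite rootM => /orP[h|h]; last exact: QA'.
  by apply: QA => //; rewrite QE rootM h.
- move=> x x0; have [r|nr] := boolP (root Q1 x).
    have r' : ~~ root Q1' x by rewrite /root (coprimep_root cop r).
    by rewrite QE' mulrCA mupMr// -QE Qd.
  by rewrite mupMr// Qd'.
- move=> x x0 nA; rewrite fE// gE//.
  have nz T : (forall x, x != 0 -> root T x -> A x) -> T.[x] != 0.
    by move=> TA; apply/negP => Tx; apply: nA; apply: TA.
  have := nz _ QA; have := nz _ QA'.
  rewrite QE QE' !(hornerM, hornerD) !mulf_eq0 !negb_or => /andP[? ?] /andP[? ?].
  by field; apply/and3P.
Qed.

Lemma ratfun_sum d (I : Type) (s : seq I) (f : I -> F -> F) :
  (forall i, ratfun d (f i)) -> ratfun d (fun x => \sum_(i <- s) f i x).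
Proof.
move=> fd; elim: s => [|i s IH].
  by apply: ratfun_ext (ratfun_cst _ 0) => x _ _; rewrite big_nil.
by apply: ratfun_ext (ratfunD (fd i) IH) => x _ _; rewrite big_cons.
Qed.

Lemma ratfun_prod (I : Type) (s : seq I) (f : I -> F -> F) (d : I -> nat) :
  (forall i, ratfun (d i) (f i)) ->
  ratfun (\sum_(i <- s) d i) (fun x => \prod_(i <- s) f i x).
Proof.
move=> fd; elim: s => [|i s IH].
  by apply: ratfun_ext (ratfun_cst _ 1) => x _ _; rewrite big_nil.
by rewrite big_cons; apply: ratfun_ext (ratfunM (fd i) IH) => x _ _; rewrite big_cons.
Qed.

Lemma ratfun_exprz (m : int) : ratfun 0 (fun x => x ^ m).
Proof.
have rX k x : x != 0 -> ~~ root ('X^k : {poly F}) x.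
  by move=> x0; rewrite /root !hornerE expf_neq0.
case: m => k.
  exists 'X^k, 1; split; first exact: oner_neq0.
  - by move=> x _; rewrite (negbTE (root1 _)).
  - by move=> x _; rewrite mupNroot // root1.
  - by move=> x _ _; rewrite !hornerE divr1.
exists 1, 'X^(k.+1); split; first by rewrite -size_poly_eq0 size_polyXn.
- by move=> x x0; rewrite (negbTE (rX _ _ x0)).
- by move=> x x0; rewrite mupNroot ?rX.
- by move=> x x0 _; rewrite !hornerE NegzE -exprnN.
Qed.

Lemma mup_le1 (Q : {poly F}) x : Q != 0 -> ~~ root Q^`() x -> (mup x Q <= 1)%N.
Proof.
move=> Q0; apply: contraR; rewrite mup_leq// negbK => /dvdpP[T ->].
rewrite /root derivM expr2 derivM !(hornerD, hornerM) hornerN hornerX hornerC subrr.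
by rewrite !(mulr0, mul0r, addr0).
Qed.

(** The denominator is [1 - c X^N], or [X^|N| - c] after clearing the negative power. Its derivative
    is a nonzero multiple of a power of [X], so its nonzero roots are simple. *)
Lemma ratfun_geom (c : F) (N : int) : c != 0 -> N != 0 ->
  (forall x, x != 0 -> c * x ^ N = 1 -> A x) ->
  ratfun 1 (fun x => (1 - c * x ^ N)^-1).
Proof.
case: N => [[//|k]|k] c0 _ cA.
  pose Q : {poly F} := 1 - c *: 'X^(k.+1).
  have Qx x : Q.[x] = 1 - c * x ^ k.+1 by rewrite /Q !hornerE.
  have Q0 : Q != 0.
    apply/eqP => Q0; have := Qx 0; rewrite Q0 horner0 -exprnP expr0n/= mulr0 subr0.
    by move=> /eqP; rewrite eq_sym oner_eq0.
  exists 1, Q; split.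
  - exact: Q0.
  - by move=> x x0; rewrite /root Qx subr_eq0 => /eqP h; apply: cA.
  - move=> x x0; apply: mup_le1 => //.
    rewrite /Q /root derivB derivZ derivXn -(polyC1 F) derivC sub0r !hornerE.
    rewrite hornerMn hornerXn /= oppr_eq0 mulf_eq0 (negbTE c0) -mulr_natl.
    by rewrite mulf_eq0 pnatr_eq0 expf_eq0 (negbTE x0) andbF.
  - by move=> x x0 _; rewrite Qx !hornerE.
pose Q : {poly F} := 'X^(k.+1) - c%:P.
have Qx x : Q.[x] = x ^+ k.+1 - c by rewrite /Q !hornerE.
have Q0 : Q != 0 by rewrite -size_poly_eq0 size_XnsubC.
have cx x : x != 0 -> 1 - c * x ^ Negz k = (x ^+ k.+1 - c) / x ^+ k.+1.
  by move=> x0; rewrite NegzE -exprnN mulrBl mulfV// expf_neq0.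
exists 'X^(k.+1), Q; split=> //.
- move=> x x0; rewrite /root Qx subr_eq0 => /eqP h; apply: cA => //.
  by rewrite NegzE -exprnN -h mulfV// expf_neq0.
- move=> x x0; apply: mup_le1 => //.
  rewrite /Q /root derivB derivXn derivC subr0 hornerMn hornerXn/=.
  by rewrite -mulr_natl mulf_neq0 ?expf_neq0// pnatr_eq0.
- by move=> x x0 _; rewrite cx// Qx !hornerE invf_div.
Qed.

(** A root of the cancelled factor is [0] or lies in [A], so the quotient is unchanged where it is
    prescribed. Coprimality gives [pole_order] its meaning. *)
Lemma ratfun_coprime d f : ratfun d f -> exists P Q : {poly F},
  [/\ Q != 0, coprimep P Q, forall x, x != 0 -> root Q x -> A x,
      forall x, x != 0 -> (mup x Q <= d)%N
    & forall x, x != 0 -> ~ A x -> f x = P.[x] / Q.[x]].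
Proof.
move=> [P [Q [Q0 QA Qd fE]]]; pose D := gcdp P Q.
have D0 : D != 0 by rewrite gcdp_eq0 (negbTE Q0) andbF.
have PE : P = P %/ D * D by rewrite divpK// dvdp_gcdl.
have QE : Q = Q %/ D * D by rewrite divpK// dvdp_gcdr.
have Q10 : Q %/ D != 0 by apply: contraNneq Q0 => h; rewrite QE h mul0r.
exists (P %/ D), (Q %/ D); split=> //.
- by apply: coprimep_div_gcd; rewrite Q0 orbT.
- by move=> x x0 r; apply: QA => //; rewrite QE rootM r.
- by move=> x x0; apply: leq_trans (Qd _ x0); rewrite [in leqRHS]QE mupM// leq_addr.
- move=> x x0 nA; rewrite fE// {1}PE {1}QE !hornerM -mulf_div divff ?mulr1//.
  by apply/negP => Dx; apply: nA; apply: QA => //; rewrite QE rootM /root Dx orbT.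
Qed.

End RationalFunctions.

(** * Poles in the variable [s] *)

Section Poles.
Variable R : realType.
Local Notation C := R[i].

(** The remainder [r] of [x] modulo [2 pi] satisfies [1 = cos r = 1 - 2 sin(r/2)^2], while
    [sin(r/2) > 0] unless [r = 0]. *)
Lemma cos_eq1 (x : R) : cos x = 1 -> exists k : int, x = 2 * pi * k%:~R.
Proof.
move=> cx; have pi2 : 0 < 2 * pi :> R by rewrite mulr_gt0// pi_gt0.
pose k := Num.floor (x / (2 * pi)); pose r := x - 2 * pi * k%:~R.
have cosk (m : int) y : cos (y + 2 * pi * m%:~R) = cos y :> R.
  have h (j : nat) z : cos (z + 2 * pi * j%:R) = cos z :> R.
    by rewrite mulr_natr mulr_natl (periodicn (@cosD2pi R)).
  case: m => j; first exact: h.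
  have := h j.+1 (y - 2 * pi * j.+1%:R); rewrite subrK => ->.
  by rewrite NegzE mulrNz mulrN.
have [r0 r2] : 0 <= r /\ r < 2 * pi.
  have /andP[h1 h2] := floor_itv (x / (2 * pi)).
  rewrite ler_pdivlMr// -/k in h1; rewrite ltr_pdivrMr// -/k in h2.
  rewrite subr_ge0 mulrC h1; split=> //.
  by rewrite ltrBlDr -[X in X + _]mulr1 -mulrDr mulrC addrC -intrD1.
have cr : cos r = 1.
  by rewrite -cx -[in RHS](subrK (2 * pi * k%:~R) x) cosk.
exists k; apply/eqP; rewrite -subr_eq0 -/r; apply: contraT => rn0.
have rp : 0 < r by rewrite lt_def rn0.
have : 0 < sin (r / 2) by apply: sin_gt0_pi; rewrite divr_gt0//= ltr_pdivrMr// mulrC.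
have : cos (r / 2 + r / 2) = 1 by rewrite -splitr.
rewrite cosD; have := cos2Dsin2 (r / 2); rewrite !expr2.
nra.
Qed.

Lemma cpowD (a : R) (s s' : C) : cpow a (s + s') = cpow a s * cpow a s'.
Proof.
case: s => x y; case: s' => x' y'; rewrite /cpow /= !mulrDl expRD cosD sinD.
by apply/eqP; rewrite eq_complex /=; apply/andP; split; apply/eqP; ring.
Qed.

Lemma cpow0 (a : R) : cpow a 0 = 1.
Proof. by rewrite /cpow /= !mul0r expR0 cos0 sin0 mulr1 mulr0. Qed.

Lemma cpow_neq0 (a : R) s : cpow a s != 0.
Proof.
apply/eqP => a0; have := cpowD a s (- s).
by rewrite subrr cpow0 a0 mul0r => /eqP; rewrite oner_eq0.
Qed.

Lemma cpowN (a : R) s : cpow a (- s) = (cpow a s)^-1.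
Proof.
apply: (mulfI (cpow_neq0 a s)).
by rewrite -cpowD subrr cpow0 divff// cpow_neq0.
Qed.

Lemma cpowX (a : R) s n : cpow a s ^+ n = cpow a (s *+ n).
Proof.
elim: n => [|n IH]; first by rewrite expr0 mulr0n cpow0.
by rewrite exprS mulrS cpowD IH.
Qed.

Lemma cpowXz (a : R) s (m : int) : cpow a s ^ m = cpow a (s *~ m).
Proof.
case: m => n; first exact: cpowX.
by rewrite NegzE -exprnN mulrNz cpowN cpowX.
Qed.

Lemma cmod_cpow (a : R) s : cmod (cpow a s) = expR (complex.Re s * ln a).
Proof.
rewrite /cmod /cpow /= !exprMn -mulrDr cos2Dsin2 mulr1 sqrtr_sqr.
by rewrite ger0_norm// expR_ge0.
Qed.

(** Comparing moduli gives the real part of [s]. Dividing by the modulus, the real part of the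
    equation says that a cosine is 1, which gives the imaginary part. *)
Lemma cpow_pole (a : R) (s : C) (N : int) (v : nat) : 1 < a -> N != 0 ->
  cpow a (- s) ^ N = (a ^+ v)%:C ->
  exists k : int, s = (- v%:R / N%:~R) +i* (2 * pi * k%:~R / (N%:~R * ln a)).
Proof.
move=> a1 N0; rewrite cpowXz => h.
have lna : 0 < ln a by rewrite ln_gt0.
have a0 : 0 < a by apply: lt_trans a1.
have Nr : N%:~R != 0 :> R by rewrite intr_eq0.
case: s h => x y h.
have sN : (- (x +i* y)) *~ N = (- (x * N%:~R)) +i* (- (y * N%:~R)).
  rewrite mulNrz -mulrzr; apply/eqP; rewrite eq_complex.
  have -> : (N%:~R : C) = (N%:~R : R)%:C by rewrite rmorph_int.
  by rewrite /= !mulr0 subr0 add0r !eqxx.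
rewrite sN in h.
have := congr1 (@cmod R) h; rewrite cmod_cpow /=.
rewrite (_ : cmod (a ^+ v)%:C = a ^+ v); last first.
  by rewrite /cmod /= expr0n/= addr0 sqrtr_sqr ger0_norm// exprn_ge0// ltW.
rewrite -[X in X ^+ v]lnK ?posrE// -expRM_natl => /expR_inj hx.
have xE : x = - v%:R / N%:~R.
  have : - (x * N%:~R) = v%:R by apply: (mulIf (lt0r_neq0 lna)); rewrite hx -mulr_natl.
  by move=> <-; rewrite opprK mulfK.
have := congr1 (@complex.Re R) h; rewrite /cpow /=.
rewrite -[X in _ = X ^+ v]lnK ?posrE// -expRM_natl hx.
move=> /(canRL (mulKf (lt0r_neq0 (expR_gt0 _)))); rewrite mulVf ?gt_eqF ?expR_gt0//.
(* The angle is [- y * N * ln a], hence the sign of the witness. *)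
move=> /cos_eq1[k hk]; exists (- k); rewrite xE; congr (_ +i* _).
apply: (mulIf (lt0r_neq0 lna)); apply: (mulIf Nr).
rewrite mulrNz mulrN mulNr -hk; field.
by rewrite Nr lt0r_neq0.
Qed.

End Poles.

(** * Characters *)

Section Characters.
Variables (R : realType) (p : nat) (K : pfield p).
Local Notation C := R[i].
Local Notation V := (vge (@ord p K)).
Local Notation ord := (@ord p K).
Local Notation unif := (@unif p K).

Lemma vunit1 : vunit (1 : K).
Proof. by split; [exact: oner_neq0|exact: ord_one]. Qed.

Lemma vunit_near1 (e : int) (x : K) : 1 <= e -> V e (x - 1) -> vunit x.
Proof.
move=> e1 xe; have := @ord_close _ _ 1 x (oner_neq0 K).
rewrite ord_one add0r => /(_ (vgeW e1 xe))[x0 ox].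
by split.
Qed.

Lemma vunit_ac (x : K) : x != 0 -> vunit (x * unif ^ (- ord x)).
Proof.
move=> x0; split; first by rewrite mulf_neq0 ?unifX_neq0.
by rewrite [LHS]ordM ?unifX_neq0// ord_unifX subrr.
Qed.

Lemma near1X (e : int) (x : K) n : 0 <= e -> V e (x - 1) -> V e (x ^+ n - 1).
Proof.
move=> e0 xe; elim: n => [|n IH]; first by rewrite expr0 subrr vge0.
have -> : x ^+ n.+1 - 1 = (x - 1) * (x ^+ n - 1) + ((x ^+ n - 1) + (x - 1)).
  by rewrite exprS; ring.
apply: vgeD; last exact: vgeD.
by apply: vgeMl => //; exact: vgeW xe.
Qed.

(* As long as the powers of [z] stay close to [1], squaring expands their
   distance to [1] by a factor at least 3/2. *)
Lemma no_small_subgroup (z : C) : (forall n : nat, `|z ^+ n - 1| <= 2^-1) -> z = 1.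
Proof.
move=> zs.
have step n : 3 / 2 * `|z ^+ n - 1| <= `|z ^+ (n + n) - 1|.
  have -> : z ^+ (n + n) - 1 = (z ^+ n + 1) * (z ^+ n - 1) by rewrite exprD; ring.
  rewrite normrM ler_wpM2r//.
  have -> : z ^+ n + 1 = 2 - (1 - z ^+ n) by ring.
  apply: le_trans (lerB_dist _ _); rewrite distrC.
  have -> : (3 / 2 : C) = 2 - 2^-1 by field.
  by rewrite normr_nat lerB.
have grow k : (3 / 2) ^+ k * `|z - 1| <= 2^-1.
  apply: (@le_trans _ _ `|z ^+ (2 ^ k) - 1|) => //.
  elim: k => [|k IH]; first by rewrite expr0 mul1r expn0 expr1.
  rewrite expnS mul2n -addnn; apply: le_trans (step _).
  by rewrite exprS -mulrA ler_wpM2l// divr_ge0.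
apply/eqP; rewrite -subr_eq0; apply/negPn/negP => z1.
have lin (k : nat) : 1 + k%:R / 2 <= (3 / 2 : R) ^+ k.
  elim: k => [|k IH]; first by rewrite mul0r addr0 expr0.
  rewrite exprS -natr1; apply: le_trans (ler_wpM2l _ IH); last by rewrite divr_ge0.
  have := ler0n R k; nra.
have c0 : 0 < cmod (z - 1) by rewrite -ltcR -cmodE normr_gt0.
have := grow (Num.truncn (cmod (z - 1))^-1).+1; rewrite cmodE.
have -> : (3 / 2 : C) = (3 / 2 : R)%:C by rewrite rmorphM fmorphV !rmorph_nat.
have -> : (2^-1 : C) = (2^-1 : R)%:C by rewrite fmorphV rmorph_nat.
rewrite -rmorphXn -rmorphM lecR.
set k := (Num.truncn _).+1 => h.
have := lin k => lk.
have kc : (cmod (z - 1))^-1 < k%:R by exact: truncnS_gt.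
have : 1 < k%:R * cmod (z - 1) by rewrite -ltr_pdivrMr// mul1r.
nra.
Qed.

(** For large [e] continuity puts the values of [chi] on the group [1 + P^e] close to 1, and powers
    of these values are again such values. The condition [1 <= e] makes [1 + P^e] consist of
    units. *)
Lemma conductor (chi : K -> C) : unit_character chi ->
  exists e : int, 1 <= e /\ forall x, V e (x - 1) -> chi x = 1.
Proof.
move=> [chi0 chiM chic].
have chi1 : chi 1 = 1.
  have := chiM _ _ vunit1 vunit1; rewrite mulr1 -[LHS]mulr1 => /(mulfI (chi0 _ vunit1)).
  by [].
have : nbhs (1 : subspace (@vunit p K)) [set x | `|chi x - 1| <= 2^-1].
  suff : nbhs (chi 1 : C^o) [set z : C^o | `|z - 1| <= 2^-1] by move/(chic (1 : K)).
  rewrite chi1; apply/nbhs_ballP; exists (2^-1 : C); first by rewrite /= invr_gt0.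
  by move=> z /=; rewrite /ball /= distrC => /ltW.
move=> /(nbhs_subspace_ex _ vunit1)[W [k kW] UW].
have kP x : V k (x - 1) -> vunit x -> `|chi x - 1| <= 2^-1.
  move=> /kW Wx ux; have : (W `&` @vunit p K) x by split.
  by rewrite -UW => -[].
exists (Num.max 1 k); split; first by rewrite le_max lexx.
move=> x xe; apply: no_small_subgroup => n.
have xu m : vunit (x ^+ m).
  apply: (@vunit_near1 1) => //.
  by apply: near1X => //; apply: vgeW xe; rewrite le_max lexx.
have chiX m : chi (x ^+ m) = chi x ^+ m.
  elim: m => [|m IH]; first by rewrite !expr0.
  by rewrite !exprS chiM// ?IH//; have := xu 1%N; rewrite expr1.
rewrite -chiX; apply: kP; last exact: xu.
have : V (Num.max 1 k) (x ^+ n - 1) by apply: near1X => //; rewrite le_max ler01.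
by apply: vgeW; rewrite le_max lexx orbT.
Qed.

Lemma quasi_unit_character (w : K -> C) : quasicharacter w -> unit_character w.
Proof.
move=> [w0 wM wc]; split.
- by move=> x [x0 _]; exact: w0.
- by move=> x y [x0 _] [y0 _]; exact: wM.
- apply: continuous_in_subspaceT => x /set_mem[x0 _]; exact: wc.
Qed.

(** The quasicharacter [omega_s(x) chi(ac x)] with [t = q^-s]. Taking [t] as the variable makes its
    values monomials in [t]. *)
Definition qchar (chi : K -> C) (t : C) (x : K) : C :=
  t ^ (ord x) * chi (x * unif ^ (- ord x)).

Lemma quasi_qchar (w chi : K -> C) : quasicharacter w ->
  (forall x, vunit x -> w x = chi x) ->
  forall x, x != 0 -> w x = qchar chi (w unif) x.
Proof.
move=> [w0 wM _] wchi x x0.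
have u0 := unif_neq0 K.
have w1 : w 1 = 1.
  have := wM 1 1 (oner_neq0 K) (oner_neq0 K); rewrite mulr1 -[LHS]mulr1.
  by move=> /(mulfI (w0 _ (oner_neq0 K))).
have wX (y : K) n : y != 0 -> w (y ^+ n) = w y ^+ n.
  by move=> y0; elim: n => [|n IH]; rewrite ?expr0// !exprS wM ?expf_neq0// IH.
have wXz m : w (unif ^ m) = w unif ^ m.
  case: m => n; first exact: wX.
  rewrite NegzE -!exprnN; apply: (mulfI (w0 _ (expf_neq0 n.+1 u0))).
  rewrite -wM ?expf_neq0 ?invr_neq0 ?expf_neq0// mulfV ?expf_neq0// w1 wX//.
  by rewrite mulfV// expf_neq0 ?w0.
rewrite /qchar -wchi; last exact: vunit_ac.
rewrite -wXz -wM ?mulf_neq0 ?unifX_neq0// mulrCA -expfzDr// subrr.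
by rewrite expr0z mulr1.
Qed.

Section QChar.
Variables (chi : K -> C) (t : C) (e : int).
Hypotheses (chiP : unit_character chi) (t0 : t != 0).
Hypothesis (e1 : 1 <= e).
Hypothesis (chie : forall x, V e (x - 1) -> chi x = 1).

Lemma qcharM (x y : K) : x != 0 -> y != 0 ->
  qchar chi t (x * y) = qchar chi t x * qchar chi t y.
Proof.
move=> x0 y0; have [_ chiM _] := chiP.
rewrite /qchar [RHS]mulrACA -chiM; try exact: vunit_ac.
by rewrite ordM// opprD !expfzDr ?unif_neq0// [x * _ * _]mulrACA.
Qed.

Lemma qchar_neq0 (x : K) : x != 0 -> qchar chi t x != 0.
Proof.
move=> x0; have [chi0 _ _] := chiP.
by rewrite mulf_neq0 ?expfz_neq0// chi0//; exact: vunit_ac.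
Qed.

Lemma qchar1 : qchar chi t 1 = 1.
Proof. by rewrite /qchar ord_one oppr0 !expr0z mulr1 mul1r chie// subrr vge0. Qed.

Lemma qchar_close (x y : K) : x != 0 -> V (ord x + e) (y - x) ->
  qchar chi t y = qchar chi t x.
Proof.
move=> x0 yx; have [y0 oy] : y != 0 /\ ord y = ord x.
  by apply: ord_close => //; apply: vgeW yx; rewrite lerD2l.
have yE : y = x * (y / x) by rewrite mulrCA divff// mulr1.
have yx1 : V e (y / x - 1).
  rewrite (_ : _ - 1 = (y - x) / x); last by rewrite mulrBl divff.
  rewrite (_ : e = ord x + e + - ord x); last by lia.
  by apply: vgeM => //; rewrite vgeE ?invr_neq0// ordV.
rewrite yE qcharM// ?mulf_neq0 ?invr_neq0//.
have [_ ou] := vunit_near1 e1 yx1.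
by rewrite [X in _ * X]/qchar [ord _]ou oppr0 !expr0z mulr1 mul1r chie// mulr1.
Qed.

Lemma qcharX (x : K) n : x != 0 -> qchar chi t (x ^+ n) = qchar chi t x ^+ n.
Proof.
move=> x0; elim: n => [|n IH]; first by rewrite !expr0 qchar1.
by rewrite !exprS qcharM ?expf_neq0// IH.
Qed.

Lemma qcharV (x : K) : x != 0 -> qchar chi t x^-1 = (qchar chi t x)^-1.
Proof.
move=> x0; apply: (mulfI (qchar_neq0 x0)).
by rewrite -qcharM ?invr_neq0// divff// qchar1 divff// qchar_neq0.
Qed.

Lemma qchar_unifX m : qchar chi t (unif ^ m) = t ^ m.
Proof.
rewrite /qchar ord_unifX -expfzDr ?unif_neq0// subrr expr0z chie ?mulr1//.
by rewrite subrr vge0.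
Qed.

Lemma qchar_prod I (s : seq I) (P : pred I) (F : I -> K) : (forall i, P i -> F i != 0) ->
  qchar chi t (\prod_(i <- s | P i) F i) = \prod_(i <- s | P i) qchar chi t (F i).
Proof.
move=> F0; suff [] : \prod_(i <- s | P i) F i != 0 /\
  qchar chi t (\prod_(i <- s | P i) F i) = \prod_(i <- s | P i) qchar chi t (F i) by [].
elim/big_rec2: _ => [|i y x Pi [x0 <-]]; first by rewrite oner_neq0 qchar1.
by rewrite mulf_neq0 ?F0// qcharM// F0.
Qed.

End QChar.

(** The units have finitely many classes modulo [P^e] because the points of the compact unit
    polydisc whose first coordinate is a unit are partitioned into open slabs by the class of that
    coordinate; this takes [n > 0]. *)
Lemma unit_reps n (cpt : forall (a : 'rV[K]_n) k, compact (pball a k))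
    (n0 : (0 < n)%N) (e : int) : 1 <= e ->
   exists us : seq K, [/\ uniq us, forall u, u \in us -> vunit u,
    forall x, vunit x -> exists2 u, u \in us & V e (x - u)
  & forall u u', u \in us -> u' \in us -> V e (u - u') -> u = u'].
Proof.
move=> e1; case: n => [//|n] in cpt n0 *.
pose G (A : set 'rV[K]_n.+1) := A `<=` [set x : 'rV[K]_n.+1 | vunit (x 0 0)] ->
  exists us : seq K, [/\ uniq us, forall u, u \in us -> vunit u,
    forall x, A x -> exists2 u, u \in us & V e (x 0 0 - u),
    forall u, u \in us -> exists2 x, A x & V e (x 0 0 - u)
  & forall u u', u \in us -> u' \in us -> V e (u - u') -> u = u'].
pose A := [set x : 'rV[K]_n.+1 | pball 0 0 x /\ vunit (x 0 0)].
pose cell (a : 'rV[K]_n.+1) := [set x : 'rV[K]_n.+1 | pball 0 0 x /\ V e (x 0 0 - a 0 0)].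
have ocell a : open (cell a).
  rewrite openE => x [x0 xa]; apply/nbhs_pballP; exists e => y xy; split.
    by apply: pball_trans x0 _; apply: pballW xy; lia.
  by apply: vge_trans (xy 0) xa.
have cu (a x : 'rV[K]_n.+1) : vunit (a 0 0) -> V e (x 0 0 - a 0 0) -> vunit (x 0 0).
  move=> [a0 oa] xa; have [||x0 ox] := @ord_close _ _ (a 0 0) (x 0 0).
  - by [].
  - by rewrite [ord _]oa; apply: vgeW xa.
  by split=> //; rewrite [LHS]ox.
have cA : compact A.
  apply: subclosed_compact (@cpt 0 0) _; last by move=> x [].
  rewrite -openC openE => x nAx; apply/nbhs_pballP; exists e => y xy [y0 yu]; apply: nAx.
  split; first by apply: pball_trans y0 _; apply: pballC; apply: pballW xy; lia.
  by apply: (cu y) => //; rewrite vgeBC; exact: xy.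
have : G A.
  apply: (partition_ind (G := G) (cell := cell) _ _ cA) => //.
  - by move=> _; exists [::].
  - move=> B1 B2 B1A B2A _ h1 h2 _.
    have [|us1 [u1 v1 c1 d1 i1]] := h1; first by move=> x /B1A[].
    have [|us2 [u2 v2 c2 d2 i2]] := h2; first by move=> x /B2A[].
    (* Disjoint parts can still share classes of the first coordinate, so representatives of classes
       already present are dropped. *)
    pose us2' := [seq u <- us2 | ~~ has (fun u' => V e (u - u')) us1].
    exists (us1 ++ us2'); split.
    + rewrite cat_uniq u1 filter_uniq// andbT/=; apply/hasPn => u.
      rewrite mem_filter => /andP[/hasPn h _]; apply/negP => /h.
      by rewrite subrr vge0.
    + by move=> u; rewrite mem_cat mem_filter => /orP[/v1//|/andP[_ /v2]].
    + move=> x [/c1[u uu xu]|/c2[u uu xu]]; first by exists u => //; rewrite mem_cat uu.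
      have [/hasP[u' uu' h]|h] := boolP (has (fun u' => V e (u - u')) us1).
        by exists u'; [rewrite mem_cat uu'|exact: vge_trans xu h].
      by exists u => //; rewrite mem_cat mem_filter h uu orbT.
    + move=> u; rewrite mem_cat mem_filter => /orP[/d1[x xB xu]|/andP[_ /d2[x xB xu]]].
        by exists x => //; left.
      by exists x => //; right.
    + move=> u u'; rewrite !mem_cat !mem_filter.
      move=> /orP[uu|/andP[/hasPn h uu]] /orP[uu'|/andP[/hasPn h' uu']].
      * exact: i1.
      * by rewrite vgeBC => /(negP (h' _ uu)).
      * by move=> /(negP (h _ uu')).
      * exact: i2.
  - by move=> x [x0 xu]; split=> //; rewrite subrr vge0.
  - move=> x y [x0 xu] [y0 yx]; split; first by split=> //; exact: (cu x).
    apply/seteqP; split=> z [z0 zx]; split=> //; first exact: vge_trans zx yx.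
    by apply: vge_trans zx _; rewrite vgeBC.
  - move=> x [x0 xu] _; exists [:: x 0 0]; split=> //.
    + by move=> u; rewrite inE => /eqP->.
    + by move=> y [_ yx]; exists (x 0 0); rewrite ?mem_head.
    + by move=> u; rewrite inE => /eqP->; exists x; [split|]; rewrite ?subrr ?vge0.
    + by move=> u u'; rewrite !inE => /eqP-> /eqP->.
case=> [x []//|us [u v c _ i]]; exists us; split=> // x xu.
have [|u0 uu] := c (const_mx x); last by rewrite mxE => xu'; exists u0.
split; last by rewrite /= mxE.
move=> j; rewrite !mxE subr0; case: xu => x0 ox.
by rewrite vgeE// [ord _]ox.
Qed.

End Characters.

(** * Monomial integrals over polydiscs *)

Section BoxIntegral.
Variables (R : realType) (p : nat) (K : pfield p) (n : nat).
Local Notation C := R[i].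
Local Notation V := (vge (@ord p K)).
Local Notation ord := (@ord p K).
Local Notation unif := (@unif p K).
Local Notation B := (borelKn K n).
Local Notation q := ((pf_q K)%:R : R).
Variables (mu : {measure set B -> \bar R}).
Hypothesis (mu_haar : normalized_haar mu).
Hypothesis cpt : forall (a : 'rV[K]_n) k, compact (pball a k).
Variables (chi : K -> C) (t : C) (e : int).
Hypotheses (chiP : unit_character chi) (t0 : t != 0) (e1 : 1 <= e).
Hypothesis (chie : forall x, V e (x - 1) -> chi x = 1).
Variable us : seq K.
Hypotheses (us_uniq : uniq us) (us_unit : forall u, u \in us -> vunit u).
Hypothesis us_rep : forall x, vunit x -> exists2 u, u \in us & V e (x - u).
Hypothesis us_inj : forall u u', u \in us -> u' \in us -> V e (u - u') -> u = u'.

Variables (J : pred 'I_n) (N : 'I_n -> int) (v : 'I_n -> nat) (k : int).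
Hypothesis NJ : forall i, ~~ J i -> N i = 0 /\ v i = 1%N.
Variables (W : set 'rV[K]_n) (phi : 'rV[K]_n -> 'rV[K]_n) (h : 'rV[K]_n -> C).
Variables (kap : C) (kap0 : R).
Hypothesis kap0_ge0 : 0 <= kap0.
(** [J] marks the coordinates whose hyperplanes belong to the divisor; the others may vanish. *)
Definition offdiv (y : 'rV[K]_n) := forall i, J i -> y 0 i != 0.
Hypothesis phi_inj : forall y y', W y -> offdiv y -> W y' -> offdiv y' ->
  phi y = phi y' -> y = y'.
Hypothesis phi_change : forall (A : set 'rV[K]_n) (m : 'I_n -> int),
  compact A -> open A ->
  (forall y, A y -> [/\ W y, offdiv y & forall i, J i -> ord (y 0 i) = m i]) ->
  measurable (phi @` A : set B) /\
  mu (phi @` A) = ((kap0 * \prod_i q ^ (- (((v i)%:Z - 1) * m i)))%:E * mu A)%E.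
Hypothesis h_phi : forall y, W y -> offdiv y ->
  h (phi y) = kap * \prod_i qchar chi t (y 0 i) ^ (N i).

(* [None] stands for the punctured disc [P^k \ 0] and [Some (a, l)] for the
   disc [a + P^l]. *)
Definition box (d : 'I_n -> option (K * int)) : set 'rV[K]_n :=
  [set y : 'rV[K]_n | forall i, if d i is Some (a, l) then is_true (V l (y 0 i - a))
           else V k (y 0 i) /\ y 0 i != 0].

(** In a divisor coordinate the bound [ord a + e <= l] makes both the valuation and [qchar] constant
    on [a + P^l]. *)
Definition cell_ok (d : 'I_n -> option (K * int)) := forall i,
  if d i is Some (a, l) then J i -> a != 0 /\ ord a + e <= l else is_true (J i).

(** The integral of [qchar(y)^N |y|^(v-1)] over [a + P^l] when the integrand is constant there. *)
Definition disc_int i (a : K) (l : int) : C :=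
  qchar chi t a ^ (N i) * (q ^ (- (((v i)%:Z - 1) * ord a)) * q ^ (- l))%:C.

Definition euler_ratio i : C := t ^ (N i) * (q ^ (- (v i)%:Z))%:C.

(** The punctured disc is the union, over [m >= k] and [u] in [us], of the discs
    [u * unif ^ m + P^(m + e)]. By [disc_int_shift] their integrals form geometric series that start
    at exponent [k]. *)
Definition coord_int i (o : option (K * int)) : C :=
  if o is Some (a, l) then disc_int i a l
  else (\sum_(u <- us) disc_int i u e) * euler_ratio i ^ k / (1 - euler_ratio i).

(** The same integral for the absolute value of the integrand, which supplies the bound in
    [cint]. *)
Definition coord_mod i (o : option (K * int)) : R :=
  if o is Some (a, l) then cmod (disc_int i a l)
  else (\sum_(u <- us) cmod (disc_int i u e)) * cmod (euler_ratio i) ^ k /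
       (1 - cmod (euler_ratio i)).

Let qn0 : q != 0. Proof. by rewrite q_neq0. Qed.
Let q0 : 0 < q. Proof. exact: q_gt0. Qed.

Lemma cmod_prod I (s : seq I) (F : I -> C) :
  cmod (\prod_(i <- s) F i) = \prod_(i <- s) cmod (F i).
Proof.
elim: s => [|i s IH]; first by rewrite !big_nil /cmod normr1.
by rewrite !big_cons cmodM IH.
Qed.

Lemma cmodV (z : C) : cmod z^-1 = (cmod z)^-1.
Proof.
by apply: complexI; rewrite -cmodE normfV cmodE fmorphV.
Qed.

Lemma cmodXz (z : C) (m : int) : cmod (z ^ m) = cmod z ^ m.
Proof. by case: m => j; rewrite ?NegzE -?exprnN ?cmodV cmodX. Qed.

Lemma cmod_real (c : R) : 0 <= c -> cmod c%:C = c.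
Proof. by move=> c0; apply: complexI; rewrite -cmodE ger0_norm// ler0c. Qed.

Lemma euler_ratio_neq0 i : euler_ratio i != 0.
Proof.
rewrite mulf_neq0 ?expfz_neq0//.
by rewrite -(rmorph0 (real_complex R)) (inj_eq (@complexI R)) expfz_neq0.
Qed.

(** Substituting [y * unif ^ m] for [y] brings out [t^(N m)] from the character and [q^(- v m)] from
    [|y|^(v-1) dy]. *)
Lemma disc_int_shift i u m : vunit u ->
  disc_int i (u * unif ^ m) (m + e) = disc_int i u e * euler_ratio i ^ m.
Proof.
move=> [u0 ou]; rewrite /disc_int /euler_ratio ordM ?unifX_neq0// ord_unifX.
rewrite (qcharM chiP t0)// ?unifX_neq0// (qchar_unifX t chie)//.
rewrite [ord u]ou !mulr0 oppr0 expr0z add0r mul1r.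
have -> : q ^ (- (((v i)%:Z - 1) * m)) * q ^ (- (m + e)) =
    q ^ (- e) * (q ^ (- (v i)%:Z)) ^ m.
  by rewrite exprz_exp -!expfzDr//; congr (_ ^ _); ring.
rewrite !expfzMl !exprz_exp (mulrC m) rmorphM.
have -> : (q ^ (- (v i)%:Z))%:C ^ m = ((q ^ (- (v i)%:Z)) ^ m)%:C.
  by rewrite [RHS]rmorphXz// unitfE expfz_neq0.
by rewrite exprz_exp; ring.
Qed.

Lemma shellP u m (y : K) : vunit u -> V (m + e) (y - u * unif ^ m) ->
  y != 0 /\ ord y = m.
Proof.
move=> [u0 ou] h1.
have um : u * unif ^ m != 0 by rewrite mulf_neq0 ?unifX_neq0.
have om : ord (u * unif ^ m) = m.
  by rewrite ordM ?unifX_neq0// ord_unifX [ord u]ou add0r.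
have [|y0 oy] := @ord_close _ _ _ y um; last by rewrite oy om.
by rewrite om; apply: vgeW h1; rewrite lerD2l.
Qed.

Lemma box_offdiv d : cell_ok d -> box d `<=` offdiv.
Proof.
move=> ok y yd i Ji; have := yd i; have := ok i.
case: (d i) => [[a l]|_ []//] /(_ Ji)[a0 al] yl.
have [] // := ord_close a0 (_ : V _ (y 0 i - a)).
apply: vgeW yl; apply: le_trans al; by rewrite lerD2l.
Qed.

Lemma box_const (d : 'I_n -> K * int) : cell_ok (Some \o d) ->
  box (Some \o d) `<=` W ->
  cint mu (phi @` box (Some \o d)) h
    (kap * kap0%:C * \prod_i disc_int i (d i).1 (d i).2)
    (cmod (kap * kap0%:C) * \prod_i cmod (disc_int i (d i).1 (d i).2)).
Proof.
move=> ok sW; set D := box _.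
have DE y : D y <-> forall i, V (d i).2 (y 0 i - (d i).1).
  by split=> yd i; have := yd i; rewrite /=; case: (d i).
pose a : 'rV[K]_n := \row_i (d i).1.
have Dl : D = (fun x : 'rV[K]_n => x - a) @^-1` lbox (fun i => (d i).2).
  by apply/seteqP; split=> y; rewrite DE => yd i; have := yd i; rewrite !mxE.
have oD : open D.
  rewrite openE => y /DE yd; apply/nbhs_pballP.
  exists (\big[Num.max/0]_i (d i).2) => z yz; apply/DE => i.
  by apply: vge_trans (yd i); apply: vgeW (yz i); exact: le_bigmax.
have cD : compact D.
  pose l := - \big[Num.max/0]_i - (d i).2.
  apply: subclosed_compact (@cpt a l) _.
    rewrite -openC openE => y nDy; apply/nbhs_pballP.
    exists (\big[Num.max/0]_i (d i).2) => z yz /DE zd; apply: nDy; apply/DE => i.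
    apply: vge_trans (zd i); rewrite vgeBC.
    by apply: vgeW (yz i); exact: le_bigmax.
  move=> y /DE yd i; rewrite mxE; apply: vgeW (yd i).
  by rewrite /l lerNl; exact: (le_bigmax 0 (fun i => - (d i).2)).
have Dnz y i : D y -> J i -> y 0 i != 0 /\ ord (y 0 i) = ord (d i).1.
  move=> /DE/(_ i) yd Ji; have := ok i; rewrite /=; case: (d i) yd => b l /= yb /(_ Ji)[b0 bl].
  by apply: ord_close => //; apply: vgeW yb; lia.
have [|mD muD] := phi_change (m := fun i => ord (d i).1) cD oD.
  by move=> y Dy; split; [exact: sW|exact: (box_offdiv ok Dy)|move=> i /(Dnz y i Dy)[]].
have muDE : mu (phi @` D) = (kap0 * \prod_i (q ^ (- (((v i)%:Z - 1) * ord (d i).1)) *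
    q ^ (- (d i).2)))%:E.
  rewrite muD Dl haar_shift//; last by apply: borel_open; exact: open_lbox.
  by rewrite haar_lbox// -EFinM big_split/= mulrA.
pose z := kap * \prod_i qchar chi t (d i).1 ^ (N i).
set c := kap0 * _ in muDE.
have c0 : 0 <= c.
  by rewrite mulr_ge0// prodr_ge0// => i _; rewrite mulr_ge0// exprz_ge0// ltW.
have hz x : (phi @` D) x -> h x = z.
  move=> [y Dy <-]; rewrite h_phi; [|exact: sW|exact: (box_offdiv ok Dy)].
  congr (_ * _); apply: eq_bigr => i _.
  have [Ji|nJ] := boolP (J i); last by have [-> _] := NJ nJ; rewrite !expr0z.
  have := ok i; move/DE/(_ i): Dy; rewrite /=; case: (d i) => b l /= yb /(_ Ji)[b0 bl].
  congr (_ ^ _); apply: (qchar_close chiP t0 e1 chie) => //.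
  exact: vgeW yb.
have zc : z * c%:C = kap * kap0%:C * \prod_i disc_int i (d i).1 (d i).2.
  rewrite /z /c rmorphM mulrACA; congr (_ * _).
  by rewrite rmorph_prod -big_split.
have := cint_cst c0 mD muDE hz; rewrite zc -cmod_prod -cmodM -zc cmodM.
by rewrite (cmod_real c0).
Qed.

(** Induction on the number of punctured coordinates. One of them is cut into shells and these into
    discs on which the character is constant; the remaining coordinates contribute a common factor
    to the geometric series over the shells. *)
Lemma box_int d : cell_ok d -> box d `<=` W ->
  (forall i, d i = None -> cmod (euler_ratio i) < 1) ->
  cint mu (phi @` box d) h (kap * kap0%:C * \prod_i coord_int i (d i))
    (cmod (kap * kap0%:C) * \prod_i coord_mod i (d i)).
Proof.
have [M] := ubnP #|[pred i | d i == None]|; elim: M => // M IH in d *.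
rewrite ltnS => dM ok sW dr.
have [/existsP[i0 /eqP di0]|] := boolP [exists i, d i == None]; last first.
  move=> /existsPn dS.
  have /choice[d' dd'] : forall i, exists al, d i = Some al.
    by move=> i; have := dS i; case: (d i) => // al _; exists al.
  have E : d = Some \o d' by apply/funext => i; rewrite dd'.
  move: ok sW; rewrite E => ok sW; have := box_const ok sW.
  by congr (cint _ _ _ (_ * _) (_ * _)); apply: eq_bigr => i _ /=; case: (d' i).
have Ji0 : J i0 by have := ok i0; rewrite di0.
pose upd j u i := if i == i0 then Some (u * unif ^ (k + j%:Z), k + j%:Z + e) else d i.
have upd_shell j u y : u \in us -> box (upd j u) y -> y 0 i0 != 0 /\ ord (y 0 i0) = k + j%:Z.
  move=> uu yd; have := yd i0; rewrite /upd eqxx.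
  by apply: shellP; exact: us_unit.
have upd_sub j u : u \in us -> box (upd j u) `<=` box d.
  move=> uu y yd i; have [->|ii0] := eqVneq i i0.
    rewrite di0; have [y0 oy] := upd_shell _ _ _ uu yd.
    by split=> //; rewrite vgeE// oy lerDl.
  by have := yd i; rewrite /upd (negbTE ii0).
have upd_ok j u : u \in us -> cell_ok (upd j u).
  move=> uu i; rewrite /upd; case: eqVneq => [_|_]; last exact: ok.
  have [u0 ou] := us_unit uu => _.
  rewrite mulf_neq0 ?unifX_neq0// ordM ?unifX_neq0// ord_unifX [ord u]ou add0r.
  by [].
pose rest := \prod_(i | i != i0) coord_int i (d i).
pose rest' := \prod_(i | i != i0) coord_mod i (d i).
have Gupd j u : u \in us -> \prod_i coord_int i (upd j u i) =
    euler_ratio i0 ^+ j * (disc_int i0 u e * euler_ratio i0 ^ k * rest).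
  move=> uu; rewrite (bigD1 i0)//= {1}/upd eqxx /= disc_int_shift; last exact: us_unit.
  rewrite expfzDr ?euler_ratio_neq0// -exprnP.
  rewrite (eq_bigr (fun i => coord_int i (d i))) => [|i /negbTE ii0]; last by rewrite /upd ii0.
  by rewrite -/rest; ring.
have Gupd' j u : u \in us -> \prod_i coord_mod i (upd j u i) =
    cmod (euler_ratio i0) ^+ j * (cmod (disc_int i0 u e) * cmod (euler_ratio i0) ^ k * rest').
  move=> uu; rewrite (bigD1 i0)//= {1}/upd eqxx /= disc_int_shift; last exact: us_unit.
  rewrite expfzDr ?euler_ratio_neq0// -exprnP (cmodM (disc_int _ _ _)).
  rewrite (cmodM (euler_ratio i0 ^ k)) cmodX cmodXz.
  rewrite (eq_bigr (fun i => coord_mod i (d i))) => [|i /negbTE ii0]; last by rewrite /upd ii0.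
  by rewrite -/rest'; ring.
have dW y : box d y -> W y /\ offdiv y.
  by move=> dy; split; [exact: sW|exact: (box_offdiv ok dy)].
have IHj j : cint mu (\big[setU/set0]_(u <- us) (phi @` box (upd j u))) h
   (\sum_(u <- us) (kap * kap0%:C * \prod_i coord_int i (upd j u i)))
   (\sum_(u <- us) (cmod (kap * kap0%:C) * \prod_i coord_mod i (upd j u i))).
  apply: cint_bigU => //.
    move=> u u' uu uu' [_ [[y yu <-] [y' yu' yy']]].
    have [Wy oy] := dW _ (upd_sub _ _ uu _ yu).
    have [Wy' oy'] := dW _ (upd_sub _ _ uu' _ yu').
    have E := phi_inj Wy' oy' Wy oy yy'; rewrite {}E {y' Wy' oy' yy'} in yu'.
    apply: us_inj => //; have := yu i0; have := yu' i0; rewrite /upd eqxx.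
    move=> h1; rewrite vgeBC => h2; have := vge_trans h2 h1.
    rewrite -mulrBl vge_unifX -mulrA -expfzDr ?unif_neq0//.
    by rewrite (_ : _ + - _ = - e) -?vge_unifX//; ring.
  move=> u uu; apply: IH.
  - apply: leq_trans dM; apply: proper_card; apply/properP; split.
      by apply/fintype.subsetP => i; rewrite !inE /upd; case: (eqVneq i i0).
    by exists i0; rewrite !inE ?di0// /upd eqxx.
  - exact: upd_ok.
  - by move=> y /(upd_sub _ _ uu)/sW.
  - by move=> i; rewrite /upd; case: eqVneq => // _; exact: dr.
have -> : phi @` box d = \bigcup_j \big[setU/set0]_(u <- us) (phi @` box (upd j u)).
  apply/seteqP; split=> [_ [y yd <-]|z [j _]]; last first.
    rewrite -bigcup_seq => -[u /= uu [y yu <-]]; exists y => //.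
    exact: upd_sub yu.
  have := yd i0; rewrite di0 => -[ky y0]; rewrite vgeE// in ky.
  have [u uu yu] := us_rep (vunit_ac y0).
  (* The shell is determined by the valuation of the coordinate, and the disc in it by the class of
     its angular component. *)
  pose mk := ord (y 0 i0) - k; exists (absz mk) => //.
  rewrite -bigcup_seq; exists u => //; exists y => //.
  move=> i; rewrite /upd; case: eqVneq => [->|_]; last exact: yd.
  rewrite gez0_abs ?subr_ge0// /mk subrKC.
  have -> : y 0 i0 - u * unif ^ ord (y 0 i0) =
      (y 0 i0 * unif ^ (- ord (y 0 i0)) - u) * unif ^ ord (y 0 i0).
    by rewrite mulrBl -mulrA -expfzDr ?unif_neq0// addNr expr0z mulr1.
  rewrite addrC; apply: vgeM => //.
  by rewrite vgeE ?unifX_neq0// ord_unifX.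
have rlt := dr _ di0; have cr0 := cmod_ge0 (euler_ratio i0).
have tF : trivIset setT (fun j => \big[setU/set0]_(u <- us) (phi @` box (upd j u))).
  move=> j j' _ _ [x []]; rewrite -!bigcup_seq => -[u /= uu [y yu <-]] [u' /= uu' [y' yu' yy']].
  have [Wy oy] := dW _ (upd_sub _ _ uu _ yu).
  have [Wy' oy'] := dW _ (upd_sub _ _ uu' _ yu').
  have E := phi_inj Wy' oy' Wy oy yy'.
  have [_ h1] := upd_shell _ _ _ uu yu; have [_ h2] := upd_shell _ _ _ uu' yu'.
  by move: h2; rewrite E h1; lia.
pose z := kap * kap0%:C * ((\sum_(u <- us) disc_int i0 u e) * euler_ratio i0 ^ k * rest).
pose m := cmod (kap * kap0%:C) *
  ((\sum_(u <- us) cmod (disc_int i0 u e)) * cmod (euler_ratio i0) ^ k * rest').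
have m0 : 0 <= m.
  rewrite mulr_ge0 ?cmod_ge0// mulr_ge0//.
    by rewrite mulr_ge0 ?exprz_ge0// sumr_ge0// => u _; exact: cmod_ge0.
  rewrite prodr_ge0// => i _; case E: (d i) => [[a l]|]; first exact: cmod_ge0.
  rewrite /= divr_ge0 ?subr_ge0 ?(ltW (dr _ E))//.
  rewrite mulr_ge0 ?exprz_ge0 ?cmod_ge0// sumr_ge0// => u _; exact: cmod_ge0.
have := @cint_geometric _ _ _ mu _ h (euler_ratio i0) z m m0 rlt tF _.
rewrite (_ : z / _ = kap * kap0%:C * \prod_i coord_int i (d i)); last first.
  by rewrite (bigD1 i0)//= di0 /= -/rest /z; ring.
rewrite (_ : m / _ = cmod (kap * kap0%:C) * \prod_i coord_mod i (d i)); last first.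
  by rewrite (bigD1 i0)//= di0 /= -/rest' /m; ring.
apply=> j; have := IHj j; congr (cint _ _ _ _ _).
  rewrite big_seq (eq_bigr (fun u => euler_ratio i0 ^+ j * (kap * kap0%:C *
    (disc_int i0 u e * (euler_ratio i0 ^ k * rest))))); last first.
    by move=> u uu; rewrite Gupd//; ring.
  by rewrite -big_seq -mulr_sumr -mulr_sumr -mulr_suml /z !mulrA.
rewrite big_seq (eq_bigr (fun u => cmod (euler_ratio i0) ^+ j * (cmod (kap * kap0%:C) *
    (cmod (disc_int i0 u e) * (cmod (euler_ratio i0) ^ k * rest'))))); last first.
  by move=> u uu; rewrite Gupd'//; ring.
by rewrite -big_seq -mulr_sumr -mulr_sumr -mulr_suml /m !mulrA.
Qed.

End BoxIntegral.

Section RatfunCoord.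
Variables (R : realType) (p : nat) (K : pfield p) (n : nat).
Local Notation C := R[i].
Local Notation q := ((pf_q K)%:R : R).

Lemma ratfun_qchar (A : set C) (chi : K -> C) (a : K) (m : int) :
  ratfun A 0 (fun t => qchar chi t a ^ m).
Proof.
have := ratfunM (ratfun_exprz A (ord a * m))
  (ratfun_cst A 0 (chi (a * unif K ^ (- ord a)) ^ m)).
by apply: ratfun_ext => x _ _; rewrite /qchar expfzMl exprz_exp.
Qed.

Lemma ratfun_coord (A : set C) (chi : K -> C) (e : int) (us : seq K)
    (N : 'I_n -> int) (v : 'I_n -> nat) (k : int) i (o : option (K * int)) :
  (o = None -> N i != 0 -> forall x, x != 0 -> euler_ratio K x N v i = 1 -> A x) ->
  ratfun A 1 (fun t => coord_int chi t e us N v k i o).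
Proof.
have rd a l : ratfun A 0 (fun t => disc_int chi t N v i a l).
  exact: (ratfunM (ratfun_qchar A chi a (N i)) (ratfun_cst A 0 _)).
case: o => [[a l]|] h /=; first exact: ratfunW (rd a l).
have c0 : ((q ^ (- (v i)%:Z))%:C : C) != 0.
  rewrite -(rmorph0 (real_complex R)) (inj_eq (@complexI R)) expfz_neq0//.
  exact: q_neq0.
have rk : ratfun A 0 (fun t => euler_ratio K t N v i ^ k).
  have := ratfunM (ratfun_exprz A (N i * k))
    (ratfun_cst A 0 ((q ^ (- (v i)%:Z))%:C ^ k)).
  by apply: ratfun_ext => x _ _; rewrite /euler_ratio expfzMl exprz_exp.
apply: (@ratfunM _ _ 0 1); first by apply: (@ratfunM _ _ 0 0) => //; exact: ratfun_sum.
(* If [N i = 0] the ratio does not involve [t], so this factor is a constant and brings no pole. *)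
have [N0|N0] := eqVneq (N i) 0.
  apply: ratfun_ext (ratfun_cst A 1 (1 - (q ^ (- (v i)%:Z))%:C)^-1) => x _ _.
  by rewrite /euler_ratio N0 expr0z mul1r.
have hA x : x != 0 -> (q ^ (- (v i)%:Z))%:C * x ^ N i = 1 -> A x.
  by move=> x0 xc; apply: h => //; rewrite /euler_ratio mulrC.
apply: ratfun_ext (ratfun_geom c0 N0 hA) => x _ _.
by rewrite /euler_ratio mulrC.
Qed.

End RatfunCoord.

(** * Embedded resolutions *)

Lemma open_mem_nbhs (T : topologicalType) (A : set T) x : open A -> A x -> nbhs x A.
Proof. by move=> oA Ax; apply: open_nbhs_nbhs. Qed.

Section Manifolds.
Variables (p : nat) (K : pfield p) (n : nat).
Local Notation V := (vge (@ord p K)).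

(** Local charts are compared only with charts of the atlas, so the transition is factored through
    one of these. Strict differentiability survives the composition by the chain rule, without
    composing power series. *)
Lemma compat_sdiff (X : kmanifold K n) (c c' : chart K n X) x :
  local_chart c -> local_chart c' -> cdom c x -> cdom c' x ->
  exists J, sdiff (cmap c' \o cinv c) (cmap c x) J.
Proof.
move=> [cc ca] [cc' ca'] cx cx'; have [c0 c0a c0x] := atlas_cover x.
have [a1 _] := ca _ c0a _ cx c0x; have [_ a2] := ca' _ c0a _ cx' c0x.
have [J1 s1] := analytic_sdiff a1; have [J2 s2] := analytic_sdiff a2.
have [od oi cK _ icont] := cc; have [od0 _ cK0 _ _] := atlas_chart c0a.
exists (J1 *m J2).
have E : (cmap c0 \o cinv c) (cmap c x) = cmap c0 x by rewrite /= cK.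
rewrite -E in s2; apply: sdiff_near (sdiff_comp s1 s2).
have ic : {for cmap c x, continuous (cinv c)} by apply: icont; exists x.
have : nbhs (cinv c (cmap c x)) (cdom c0) by rewrite cK//; exact: open_mem_nbhs.
move=> /ic h; have {}h : nbhs (cmap c x) (cinv c @^-1` cdom c0) := h.
by apply: filterS h => y y0 /=; rewrite cK0.
Qed.

Lemma vec_analytic_continuous m (X : kmanifold K n) (u : X -> 'rV[K]_m) x :
  (forall j, man_analytic_at (fun z => u z 0 j) x) -> {for x, continuous u}.
Proof.
move=> ua; have [c ca cx] := atlas_cover x; have [od oi cK ccont icont] := atlas_chart ca.
have [J sJ] : exists J, sdiff (u \o cinv c) (cmap c x) J.
  by apply: analytic_sdiff => j; exact: ua.
have uc : {for x, continuous ((u \o cinv c) \o cmap c)}.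
  by apply: continuous_comp; [exact: ccont|exact: sdiff_continuous sJ].
move=> A Au; have uA : nbhs x (((u \o cinv c) \o cmap c) @^-1` A).
  by apply: uc; rewrite /= cK.
have dx : nbhs x (cdom c) by exact: open_mem_nbhs.
suff : nbhs x (u @^-1` A) by [].
by apply: filterS2 uA dx => z /= + zc; rewrite cK.
Qed.

Lemma man_analytic_continuous (X : kmanifold K n) (u : X -> K) x :
  man_analytic_at u x -> {for x, continuous u}.
Proof.
move=> ua; have : {for x, continuous (fun z => \row_(j < 1) u z : 'rV[K]_1)}.
  apply: vec_analytic_continuous => j.
  by rewrite (_ : (fun z => _) = u)//; apply/funext => z; rewrite mxE.
move=> uc A [k kA].
have h : nbhs x ((fun z => \row_(j < 1) u z) @^-1` pball (\row_(j < 1) u x) k).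
  by apply: uc; exact: nbhs_pball.
suff : nbhs x (u @^-1` A) by [].
by apply: filterS h => z /(_ 0); rewrite !mxE; exact: kA.
Qed.

End Manifolds.

(** Exponent 0 outside the first [r] indices lets the later products run over all [n]
    coordinates. *)
Lemma prod_widen_insub (F : comNzRingType) (r n : nat) (rn : (r <= n)%N) (y : 'I_n -> F)
    (m : 'I_r -> nat) :
  \prod_(j < r) y (widen_ord rn j) ^+ m j =
  \prod_(i < n) y i ^+ (oapp m 0%N (insub (i : nat))).
Proof.
rewrite [RHS](bigID (fun i : 'I_n => (i < r)%N))/= [X in _ = _ * X]big1 ?mulr1.
  rewrite (big_ord_narrow rn); apply: eq_bigr => j _; congr (_ ^+ _).
  by rewrite (_ : insub _ = Some j)// /= -[RHS]valK.
by move=> i /negbTE ir; rewrite insubF.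
Qed.

(** * Integration over clopen pieces of the resolution *)

Section ZetaFunction.
Variables (R : realType) (p : nat) (K : pfield p) (n : nat).
Local Notation C := R[i].
Local Notation V := (vge (@ord p K)).
Local Notation ord := (@ord p K).
Local Notation unif := (@unif p K).
Local Notation B := (borelKn K n).
Local Notation q := ((pf_q K)%:R : R).
Variables (mu : {measure set B -> \bar R}).
Hypothesis (mu_haar : normalized_haar mu).
Hypothesis cpt : forall (a : 'rV[K]_n) k, compact (pball a k).
Hypothesis n0 : (0 < n)%N.
Variables (U : set 'rV[K]_n) (f g : 'rV[K]_n -> K) (Phi : 'rV[K]_n -> C).
Hypothesis Phi_lc : forall x, \forall y \near x, Phi y = Phi x.
Variables (S : resolution_data K n) (S_res : embedded_resolution U f g S).
Variable (chi : K -> C).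
Hypothesis chiP : unit_character chi.

Local Notation sigma := (@res_map _ _ _ S).
Local Notation D := (zero_divisor U f g).
Local Notation SD := (sigma @^-1` D).
Local Notation Tpm := (T_plus Phi S `|` T_minus Phi S).

Definition pole_value (x : C) := exists t, Tpm t /\ x ^ (res_N t) = (q ^+ (res_v t))%:C.

(** Convergence of all geometric series attached to [T_plus] and [T_minus]; [in_stripP] derives it
    from [beta < Re s < alpha]. *)
Definition in_strip (t : C) := t != 0 /\ forall j, Tpm j ->
  cmod (t ^ (res_N j) * (q ^ (- (res_v j)%:Z))%:C) < 1.

(** [F] comes before [t]: one rational function serves the whole strip, while the bound [m] may vary
    with [t]. *)
Definition good (W : set S) := exists F : C -> C, ratfun pole_value n F /\
  forall t, in_strip t -> exists m,
    cint mu (sigma @` (W `\` SD)) (zeta_integrand Phi f g (qchar chi t)) (F t) m.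

Lemma sigma_inj x y : ~ SD x -> ~ SD y -> sigma x = sigma y -> x = y.
Proof.
have [_ _ [[k [[_ _ kK _ _] _]] _] _ _] := S_res.
by move=> Dx Dy xy; rewrite -(kK x Dx) -(kK y Dy) /= xy.
Qed.

Lemma sigma_continuous x : {for x, continuous sigma}.
Proof.
have [[_ sa _] _ _ _ _] := S_res.
by apply: vec_analytic_continuous => j; exact: sa.
Qed.

Lemma good0 : good set0.
Proof.
exists (fun=> 0); split; first exact: ratfun_cst.
by move=> t _; exists 0; rewrite set0D image_set0; exact: cint0.
Qed.

Lemma goodU W1 W2 : W1 `&` W2 = set0 -> good W1 -> good W2 -> good (W1 `|` W2).
Proof.
move=> W12 [F1 [r1 h1]] [F2 [r2 h2]]; exists (fun t => F1 t + F2 t).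
split; first exact: ratfunD.
move=> t ct; have [m1 c1] := h1 _ ct; have [m2 c2] := h2 _ ct; exists (m1 + m2).
rewrite setDUl image_setU; apply: cintU => //.
apply/seteqP; split=> // _ [[x [Wx Dx] <-] [y [Wy Dy] yx]].
have E := sigma_inj Dy Dx yx.
have : (W1 `&` W2) x by split=> //; rewrite -E.
by rewrite W12.
Qed.

(** [monomial_at] with exponents on all [n] coordinates. Off the divisor they are 0 for [f] and [g]
    and 1 for [v], so that such coordinates disappear from the integrand and from the Jacobian. *)
Lemma monomial_coords b : exists (c : chart K n S) (J : pred 'I_n)
    (Nf Ng v : 'I_n -> nat) (eta epsf epsg : S -> K),
  [/\ [/\ local_chart c, cdom c b &
        forall i x, J i -> cdom c x -> cmap c x 0 i = 0 -> SD x],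
      (forall i, J i -> exists j, [/\ res_E j b, Nf i = res_Nf j,
         Ng i = res_Ng j & v i = res_v j]) /\
      (forall i, ~~ J i -> [/\ Nf i = 0%N, Ng i = 0%N & v i = 1%N]),
      [/\ unit_germ b eta, unit_germ b epsf & unit_germ b epsg],
      \forall x \near b, exists2 M : 'M[K]_n,
        is_jacobian (sigma \o cinv c) (cmap c x) M &
        \det M = eta x * \prod_i cmap c x 0 i ^+ (v i).-1 &
      \forall x \near b,
        f (sigma x) = epsf x * \prod_i cmap c x 0 i ^+ Nf i /\
        g (sigma x) = epsg x * \prod_i cmap c x 0 i ^+ Ng i].
Proof.
have [_ _ _ [DE _ _] /(_ b)[r [rn [e [c [eta [epsf [epsg]]]]]]]] := S_res.
move=> /= [[ei eE] [lc cb yE] units jac fg].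
pose od T (d : T) (F : 'I_r -> T) (i : 'I_n) := oapp F d (insub (i : nat)).
exists c, (fun i => (i < r)%N), (od _ 0%N (fun j => res_Nf (e j))),
  (od _ 0%N (fun j => res_Ng (e j))), (od _ 1%N (fun j => res_v (e j))), eta, epsf, epsg.
split=> //.
- split=> // i x ir cx y0.
  have : res_E (e (Ordinal ir)) x.
    by apply/yE => //; rewrite -y0; congr (cmap _ _ _ _); exact: val_inj.
  move=> Ex; have : (\bigcup_j @res_E _ _ _ S j) x by exists (e (Ordinal ir)).
  by rewrite -DE.
- split=> i ir.
    exists (e (Ordinal ir)); rewrite /od insubT/=; split=> //.
    by apply/eE; exists (Ordinal ir).
  by rewrite /od insubF//; exact: negbTE.
- apply: filterS jac => x [M jM dM]; exists M => //.
  rewrite dM prod_widen_insub; congr (_ * _); apply: eq_bigr => i _; congr (_ ^+ _).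
  by rewrite /od; case: insub.
- by apply: filterS fg => x; rewrite !prod_widen_insub.
Qed.

Lemma unit_germ_near (u : S -> K) b (k : int) : unit_germ b u ->
  \forall x \near b, V (ord (u b) + k) (u x - u b).
Proof.
move=> [/nbhs_singleton/man_analytic_continuous uc _].
have h : nbhs (u b) [set z | V (ord (u b) + k) (z - u b)] by exists (ord (u b) + k).
exact: (uc _ h).
Qed.

(** All clopen subsets of [W0] are allowed, because a finite cover by such neighbourhoods is later
    made disjoint by intersections and complements. *)
Lemma local_good b : Phi (sigma b) != 0 ->
  exists W0 : set S, [/\ open W0, closed W0, W0 b &
    forall W, open W -> closed W -> W `<=` W0 -> good W].
Proof.
move=> Phib.
have [e [e1 chie]] := conductor chiP.
have [us [us_uniq us_unit us_rep us_inj]] := unit_reps cpt n0 e1.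
have [c [J [Nf [Ng [v [eta [epsf [epsg [[lc cb yD] [JE nJE] [ueta uf ug] jac fg]]]]]]]]] :=
  monomial_coords b.
have [[oc oi cK cc ic] _] := lc.
have [_ eta0] := ueta; have [_ epsf0] := uf; have [_ epsg0] := ug.
have [[sU _ _] _ [[k2 lc2] simg] [_ _ vpos] _] := S_res.
have [[_ oi2 kK _ kc] _] := lc2.
pose phi := sigma \o cinv c.
(* The precision [e] makes [qchar] constant on the units [epsf] and [epsg]; for [eta], of which only
   the valuation counts, precision 1 is enough. *)
pose Q (x : S) := [/\ Phi (sigma x) = Phi (sigma b),
  V (ord (epsf b) + e) (epsf x - epsf b),
  V (ord (epsg b) + e) (epsg x - epsg b),
  V (ord (eta b) + 1) (eta x - eta b) &
  (exists2 M : 'M[K]_n, is_jacobian phi (cmap c x) M &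
    \det M = eta x * \prod_i cmap c x 0 i ^+ (v i).-1) /\
  (f (sigma x) = epsf x * \prod_i cmap c x 0 i ^+ Nf i /\
    g (sigma x) = epsg x * \prod_i cmap c x 0 i ^+ Ng i)].
have [k0 k0P] : exists k0 : int,
    pball (cmap c b) k0 `<=` [set y | cimg c y /\ Q (cinv c y)].
  apply/nbhs_pballP.
  have cib : cimg c (cmap c b) by exists b.
  have P1 : \forall x \near b, Phi (sigma x) = Phi (sigma b).
    exact: (sigma_continuous (Phi_lc (sigma b))).
  have P2 : nbhs (cinv c (cmap c b)) [set x | Q x].
    rewrite cK//; near=> x; split.
    - by near: x; exact: P1.
    - by near: x; exact: unit_germ_near.
    - by near: x; exact: unit_germ_near.
    - by near: x; exact: unit_germ_near.
    - by split; near: x; [exact: jac|exact: fg].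
  have P3 : nbhs (cmap c b) (cinv c @^-1` [set x | Q x]) := ic _ cib _ P2.
  have P4 : nbhs (cmap c b) (cimg c) by exact: open_mem_nbhs oi cib.
  by near=> y; split; near: y.
pose B0 := pball (cmap c b) k0.
have ciB y : B0 y -> cimg c y by move=> /k0P[].
have icK y : cimg c y -> cdom c (cinv c y) /\ cmap c (cinv c y) = y.
  by move=> [x cx <-]; rewrite cK.
pose W0 := [set x | cdom c x /\ B0 (cmap c x)].
have oW0 : open W0.
  rewrite openE => x [cx Bx]; apply: filterI; first exact: open_mem_nbhs.
  exact: (cc x cx _ (open_mem_nbhs (@open_pball p K n (cmap c b) k0) Bx)).
have cW0 : compact W0.
  have -> : W0 = cinv c @` B0.
    apply/seteqP; split=> [x [cx Bx]|_ [y By <-]]; first by exists (cmap c x) => //; rewrite cK.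
    by have [h1 h2] := icK _ (ciB _ By); split=> //; rewrite h2.
  apply: continuous_compact; last exact: cpt.
  by apply: continuous_in_subspaceT => y /set_mem/ciB; exact: ic.
exists W0; split=> //; first exact: compact_closed (@kman_hausdorff _ _ _ S) cW0.
  by split=> //; exact: pball_refl.
move=> W oW cW WW0.
pose A := [set y | B0 y /\ W (cinv c y)].
have oA : open A.
  rewrite openE => y [By Wy]; apply: filterI.
    exact: (open_mem_nbhs (@open_pball p K n (cmap c b) k0) By).
  exact: (ic y (ciB _ By) _ (open_mem_nbhs oW Wy)).
have cA : compact A.
  have -> : A = cmap c @` W.
    apply/seteqP; split=> [y [By Wy]|_ [x Wx <-]].
      by exists (cinv c y) => //; have [] := icK _ (ciB _ By).
    by have [cx Bx] := WW0 _ Wx; split=> //; rewrite cK.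
  apply: continuous_compact; last exact: subclosed_compact cW cW0 WW0.
  by apply: continuous_in_subspaceT => x /set_mem/WW0[cx _]; exact: cc.
have [k /(_ k (lexx _)) kA] := open_unif cA oA.
have WE : W = cinv c @` A.
  apply/seteqP; split=> [x Wx|_ [y [By Wy] <-]]//.
  by have [cx Bx] := WW0 _ Wx; exists (cmap c x); [split=> //|]; rewrite cK.
(* On a cell each coordinate either ranges over the disc [P^k] around the divisor
   or stays in a disc on which [qchar] is constant. *)
pose cell (a : 'rV[K]_n) := [set y : 'rV[K]_n | forall i,
  if J i && V k (a 0 i) then is_true (V k (y 0 i))
  else is_true (V (k + e) (y 0 i - a 0 i))].
have kke : k <= k + e by lia.
have cell_sub a : A a -> cell a `<=` A.
  move=> Aa y ay; apply: (kA a Aa) => i; have := ay i.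
  by case: ifP => [/andP[_ ka] ky|_]; [exact: vgeB|exact: vgeW].
have AB y : A y -> B0 y by case.
rewrite WE.
apply: (partition_ind (G := fun A' => good (cinv c @` A')) (cell := cell) _ _ cA).
- by rewrite image_set0; exact: good0.
- move=> A1 A2 A1A A2A A12 g1 g2; rewrite image_setU; apply: goodU => //.
  apply/seteqP; split=> // _ [[y y1 <-] [z z2 zy]].
  have [_ yE] := icK y (ciB _ (AB _ (A1A _ y1))).
  have [_ zE] := icK z (ciB _ (AB _ (A2A _ z2))).
  have : (A1 `&` A2) y by split=> //; rewrite -yE -zy zE.
  by rewrite A12.
- move=> a Aa; rewrite openE => y ay; apply/nbhs_pballP; exists (k + e) => z yz i.
  have := ay i; case: ifP => [_ ky|_ ky].
    by rewrite -(subrK (y 0 i) (z 0 i)); apply: vgeD => //; exact: vgeW (yz i).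
  exact: vge_trans (yz i) ky.
- move=> a Aa i; case: ifP => [/andP[]//|_].
  by rewrite subrr vge0.
- move=> a y Aa ay; split; first exact: cell_sub ay.
  (* Whether a divisor coordinate lies in [P^k] is constant on a cell, hence cells are equivalence
     classes. *)
  have yk i : J i && V k (y 0 i) = J i && V k (a 0 i).
    case Ji : (J i) => //=; have := ay i; rewrite Ji /=; case: ifP => [_ ->//|ka h].
    apply: contraFF ka => ky; rewrite -(subKr (y 0 i) (a 0 i)); apply: vgeB => //.
    exact: vgeW h.
  apply/seteqP; split=> z hz i; have := hz i; rewrite yk; have := ay i; case: ifP => //.
    by move=> _ h1 h2; exact: vge_trans h2 h1.
  by move=> _ h1 h2; apply: vge_trans h2 _; rewrite vgeBC.
move=> a Aa.
pose N i := (Nf i)%:Z - (Ng i)%:Z.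
have NJ i : ~~ J i -> N i = 0 /\ v i = 1%N.
  by move=> /nJE[Nf0 Ng0 ->]; rewrite /N Nf0 Ng0.
(* If [a 0 i] is not in [P^k] its valuation is less than [k], so the exponent [k + e] satisfies
   [cell_ok]. *)
pose d i := if J i && V k (a 0 i) then None else Some (a 0 i, k + e).
have okd : cell_ok e J d.
  move=> i; rewrite /d; case: ifP => [/andP[]//|+ Ji].
  by rewrite Ji /= /vge => /negbT; rewrite negb_or => /andP[-> ?]; split=> //; lia.
have box_cell : box k d `<=` cell a.
  by move=> y dy i; have := dy i; rewrite /d; case: ifP => // _ [].
have boxB : box k d `<=` B0 by move=> y /box_cell/(cell_sub a Aa)/AB.
have nz (y : 'rV[K]_n) (m : 'I_n -> nat) : offdiv J y -> (forall i, ~~ J i -> m i = 0%N) ->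
    forall i, y 0 i ^+ m i != 0.
  move=> oy m0 i; have [Ji|nJ] := boolP (J i); first by rewrite expf_neq0// oy.
  by rewrite m0// expr0 oner_neq0.
have eps_nz x : Q x -> [/\ epsf x != 0, epsg x != 0, eta x != 0 & ord (eta x) = ord (eta b)].
  move=> [_ h1 h2 h3 _].
  have [||? _] := @ord_close _ _ (epsf b) (epsf x); first by [].
    by apply: vgeW h1; rewrite lerD2l.
  have [||? _] := @ord_close _ _ (epsg b) (epsg x); first by [].
    by apply: vgeW h2; rewrite lerD2l.
  by have [||? ?] := @ord_close _ _ (eta b) (eta x).
have fg_nz y : B0 y -> offdiv J y ->
    [/\ ~ SD (cinv c y), f (phi y) != 0 & g (phi y) != 0].
  move=> By oy; have [ciy Qy] := k0P _ By; have [ef eg _ _] := eps_nz _ Qy.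
  have [_ _ _ _ [_ [fE gE]]] := Qy; have [_ yE] := icK _ ciy; rewrite yE in fE gE.
  have f0 : f (phi y) != 0.
    rewrite /phi /= fE mulf_neq0//; apply/prodf_neq0 => i _; apply: nz => // j.
    by case/nJE.
  have g0 : g (phi y) != 0.
    rewrite /phi /= gE mulf_neq0//; apply/prodf_neq0 => i _; apply: nz => // j.
    by case/nJE.
  by split=> // -[_ [/eqP|/eqP]]; [rewrite (negbTE f0)|rewrite (negbTE g0)].
(* Removing the divisor from the cell punctures exactly the discs around the hyperplanes [y_i = 0]:
   elsewhere on the cell [f] and [g] do not vanish. *)
have imgE : sigma @` (cinv c @` cell a `\` SD) = phi @` box k d.
  apply/seteqP; split=> [_ [_ [[y ay <-] nD] <-]|_ [y dy <-]].
    exists y => // i; have := ay i; rewrite /d; case: ifP => [/andP[Ji _] ky|//].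
    split=> //; apply/eqP => y0; apply: nD.
    have [cy yE] := icK _ (ciB _ (AB _ (cell_sub _ Aa _ ay))).
    by apply: (yD i) => //; rewrite yE.
  exists (cinv c y) => //; split; first by exists y => //; exact: box_cell.
  by have [] := fg_nz _ (boxB _ dy) (box_offdiv e1 okd dy).
have csb : csupp Phi (sigma b) by apply: subset_closure.
(* As [Phi (sigma b) != 0], every component through [b] meets the preimage of the support, so those
   with [N i != 0] belong to [T_plus] or [T_minus]. *)
have TpmJ i : J i -> N i != 0 -> exists2 j, Tpm j & N i = res_N j /\ v i = res_v j.
  move=> /JE[j [Eb NfE NgE vE]] Ni0.
  have NE : N i = res_N j by rewrite /N NfE NgE.
  exists j => //; have [Np|Nn] := ltP 0 (N i).
    by left; split; [rewrite -NE|exists b].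
  by right; split; [rewrite -NE lt_def eq_sym Ni0|exists b].
have v_gt0 i : (0 < v i)%N.
  have [/JE[j [_ _ _ ->]]//|/nJE[_ _ ->]//] := boolP (J i).
have q1 : 1 < q := q_gt1 R K.
have qn0 : q != 0 := q_neq0 R K.
pose kap t := Phi (sigma b) * (qchar chi t (epsf b) ^ 1 * qchar chi t (epsg b) ^ (-1)).
pose kap0 : R := q ^ (- ord (eta b)).
exists (fun t => kap t * kap0%:C * \prod_i coord_int chi t e us N v k i (d i)); split.
  have r1 : ratfun pole_value 0 (fun t => kap t * kap0%:C).
    apply: (@ratfunM _ _ 0 0); last exact: ratfun_cst.
    apply: (@ratfunM _ _ 0 0); first exact: ratfun_cst.
    by apply: (@ratfunM _ _ 0 0); exact: ratfun_qchar.
  have r2 : ratfun pole_value (\sum_(i < n) 1)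
      (fun t => \prod_i coord_int chi t e us N v k i (d i)).
    apply: (@ratfun_prod _ _ _ _ _ (fun=> 1%N)) => i; apply: ratfun_coord => di Ni x x0 xr.
    have Ji : J i by have := okd i; rewrite di.
    have [j Tj [NE vE]] := TpmJ _ Ji Ni.
    exists j; split=> //; rewrite -NE -vE; move: xr; rewrite /euler_ratio.
    have qv : (q ^ (- (v i)%:Z))%:C = ((q ^+ v i)%:C)^-1 :> C.
      by rewrite -exprnN -fmorphV.
    rewrite qv => /(canRL (mulfVK _)) ->; first by rewrite mul1r.
    by rewrite -(rmorph0 (real_complex R)) (inj_eq (@complexI R)) expf_neq0.
  have := ratfunM r1 r2; rewrite sum_nat_const card_ord muln1 add0n.
  by [].
move=> t [t0 tconv]; rewrite imgE.
exists (cmod (kap t * kap0%:C) * \prod_i coord_mod chi t e us N v k i (d i)).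
have kap0_ge0 : 0 <= kap0 by rewrite exprz_ge0// ltW// (lt_trans ltr01).
have pinj y y' : B0 y -> offdiv J y -> B0 y' -> offdiv J y' -> phi y = phi y' -> y = y'.
  move=> By oy By' oy' yy'; have [Dy _ _] := fg_nz _ By oy; have [Dy' _ _] := fg_nz _ By' oy'.
  have := sigma_inj Dy Dy' yy' => E.
  by have [_ <-] := icK _ (ciB _ By); have [_ <-] := icK _ (ciB _ By'); rewrite E.
apply: (box_int mu_haar cpt chiP t0 e1 chie us_uniq us_unit us_rep us_inj NJ
  kap0_ge0 pinj _ _ okd boxB) => [A' m cA' oA' A'P|y By oy|i di].
- have vm i : ((v i).-1)%:Z = (v i)%:Z - 1 by have := v_gt0 i; lia.
  pose mm := ord (eta b) + \sum_i ((v i)%:Z - 1) * m i.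
  have mmE : q ^ (- mm) = kap0 * \prod_i q ^ (- (((v i)%:Z - 1) * m i)).
    rewrite /mm opprD expfzDr//; congr (_ * _).
    by elim/big_rec2: _ => [|i x z _ <-]; rewrite ?oppr0 ?expr0z// opprD expfzDr.
  have A'P2 y : A' y -> [/\ B0 y, offdiv J y, ~ SD (cinv c y) &
      cdom c (cinv c y) /\ cmap c (cinv c y) = y].
    move=> /A'P[By oy _]; have [nD _ _] := fg_nz _ By oy.
    by split=> //; apply: icK; exact: ciB.
  have [|y A'y|y A'y|oim mim] :=
    @haar_change R p K n mu mu_haar cpt phi (cmap c \o k2) A' mm cA' oA'.
  + move=> y y' /set_mem/A'P[By oy _] /set_mem/A'P[By' oy' _]; exact: pinj.
  + have [By oy nD [cy yE]] := A'P2 _ A'y; have [_ _ my] := A'P _ A'y.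
    have [_ Qy] := k0P _ By; have [_ _ _ _ [[M jM dM] _]] := Qy.
    have [_ _ eta_nz etaE] := eps_nz _ Qy; rewrite yE in dM jM.
    (* Off the divisor [sigma] is itself a local chart, so [phi] is a transition map between charts
       near [y]. *)
    have [M' sM'] : exists M', sdiff phi y M'.
      by have := compat_sdiff lc lc2 cy nD; rewrite yE.
    have EM : M = M' := sdiff_jacobian sM' jM; subst M'.
    have pnz i : y 0 i ^+ (v i).-1 != 0 by apply: (nz y (fun i => (v i).-1)) => // j /nJE[_ _ ->].
    exists M; split=> //.
      by rewrite unitmxE unitfE dM mulf_neq0//; apply/prodf_neq0.
    rewrite dM ordM//; last by apply/prodf_neq0.
    rewrite etaE ord_prod//; congr (_ + _); apply: eq_bigr => i _.
    have [Ji|/nJE[_ _ ->]] := boolP (J i); last by rewrite expr0 ord_one subrr mul0r.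
    by rewrite ordX ?oy// my// vm.
  + have [By oy nD [cy yE]] := A'P2 _ A'y.
    have k2phi : k2 (phi y) = cinv c y by rewrite /phi /=; exact: kK.
    have ci2 : cimg (Chart (~` SD) sigma k2) (phi y) by exists (cinv c y).
    have k2c : {for phi y, continuous k2} by exact: kc.
    split; last 2 first.
    * by rewrite /= k2phi yE.
    * have N1 : nbhs (phi y) (cimg (Chart (~` SD) sigma k2)) := open_mem_nbhs oi2 ci2.
      have N2' : nbhs (k2 (phi y)) (cdom c) by rewrite k2phi; exact: open_mem_nbhs.
      have N2 : nbhs (phi y) (k2 @^-1` cdom c) := k2c _ N2'.
      near=> z.
      have cz : cdom c (k2 z) by near: z; exact: N2.
      have [x' nDx' zE] : cimg (Chart (~` SD) sigma k2) z by near: z; exact: N1.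
      by rewrite /phi /= cK// -zE; congr sigma; exact: kK.
    * apply: continuous_comp => //; rewrite k2phi; exact: cc.
  split; first exact: borel_open.
  by rewrite mim mmE.
- have [ciy Qy] := k0P _ By; have [PE h1 h2 _ [_ [fE gE]]] := Qy.
  have [ef eg _ _] := eps_nz _ Qy; have [_ yE] := icK _ ciy; rewrite yE in fE gE.
  have [_ f0 g0] := fg_nz _ By oy.
  have qX (m : 'I_n -> nat) : (forall i, ~~ J i -> m i = 0%N) ->
      qchar chi t (\prod_i y 0 i ^+ m i) = \prod_i qchar chi t (y 0 i) ^+ m i.
    move=> m0; rewrite (qchar_prod chiP t0 chie); last by move=> i _; exact: nz.
    apply: eq_bigr => i _; have [Ji|nJ] := boolP (J i).
      by rewrite (qcharX chiP t0 chie)// oy.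
    by rewrite m0// !expr0 (qchar1 t chie).
  have prnz (m : 'I_n -> nat) : (forall i, ~~ J i -> m i = 0%N) ->
      \prod_i y 0 i ^+ m i != 0.
    by move=> m0; apply/prodf_neq0 => i _; exact: nz.
  have mf0 i : ~~ J i -> Nf i = 0%N by case/nJE.
  have mg0 i : ~~ J i -> Ng i = 0%N by case/nJE.
  rewrite /zeta_integrand [X in X * _]PE /kap -mulrA; congr (_ * _).
  rewrite (qcharM chiP t0)// ?invr_neq0// (qcharV chiP t0 chie)//.
  rewrite [f (phi y)]fE [g (phi y)]gE !(qcharM chiP t0) ?prnz// !qX//.
  rewrite (qchar_close chiP t0 e1 chie epsf0 h1) (qchar_close chiP t0 e1 chie epsg0 h2).
  rewrite invfM mulrACA expr1z -exprN1; congr (_ * _).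
  rewrite -prodfV -big_split; apply: eq_bigr => i _ /=.
  have [Ji|nJ] := boolP (J i); last first.
    by rewrite mf0// mg0// !expr0 invr1 mulr1 (NJ i nJ).1 expr0z.
  by rewrite /N expfzDr ?(qchar_neq0 chiP t0)// ?oy// exprnN.
- have Ji : J i by have := okd i; rewrite di.
  (* A component with [N i = 0] is in neither index set; its ratio [q^-v] is below 1 because
     [v > 0]. *)
  rewrite /euler_ratio; have [N0|Nn0] := eqVneq (N i) 0.
    rewrite N0 expr0z mul1r cmod_real ?exprz_ge0 ?(ltW (lt_trans _ q1))//.
    rewrite -exprnN invf_lt1 ?exprn_gt0 ?(lt_trans _ q1)// exprn_egt1//.
    by rewrite -lt0n.
  by have [j Tj [-> ->]] := TpmJ _ Ji Nn0; exact: tconv.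
Unshelve. all: by end_near.
Qed.

(** The first neighbourhood cuts [W] into two clopen parts: one lies inside it, the other is covered
    by the remaining neighbourhoods. *)
Lemma finite_good (s : seq S) (W0 : S -> set S) (W : set S) :
  (forall b, b \in s -> open (W0 b) /\ closed (W0 b)) ->
  (forall b W', b \in s -> open W' -> closed W' -> W' `<=` W0 b -> good W') ->
  open W -> closed W -> (forall x, W x -> exists2 b, b \in s & W0 b x) -> good W.
Proof.
elim: s W => [|b s IH] W oc gd oW cW Ws.
  by rewrite (_ : W = set0); [exact: good0|apply/seteqP; split=> // x /Ws[]].
have [ob cb] := oc b (mem_head _ _).
have -> : W = (W `&` W0 b) `|` (W `&` ~` W0 b) by rewrite -setIUr setUv setIT.
apply: goodU.
- by apply/seteqP; split=> // x [[_ ?] [_ +]]; exact.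
- apply: gd (mem_head _ _) _ _ _; [exact: openI|exact: closedI|by move=> x []].
- apply: IH.
  + by move=> b' b's; apply: oc; rewrite inE b's orbT.
  + by move=> b' W' b's; apply: gd; rewrite inE b's orbT.
  + by apply: openI => //; exact: closed_openC.
  + by apply: closedI => //; exact: open_closedC.
  + move=> x [/Ws[b' + xb'] nx]; rewrite inE => /predU1P[E|b's]; last by exists b'.
    by case: nx; rewrite -E.
Qed.

Lemma zeta_good : compact (csupp Phi) -> csupp Phi `<=` U ->
  exists F : C -> C, ratfun pole_value n F /\ forall t, in_strip t -> exists m,
    cint mu (U `\` D) (zeta_integrand Phi f g (qchar chi t)) (F t) m.
Proof.
move=> cPhi PhiU.
have [[sU _ proper] _ [[k2 lc2] simg] _ _] := S_res.
(* Since [Phi] is locally constant, the set where it does not vanish is clopen, so it equals its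
   closure and its preimage is compact and clopen. *)
have oPhi : open [set x | Phi x != 0].
  rewrite openE => x Px; suff : nbhs x [set y | Phi y = Phi x].
    by apply: filterS => y /= ->.
  exact: Phi_lc.
have cPhi0 : closed [set x | Phi x != 0].
  rewrite -openC openE => x /= /negP/negPn/eqP Px; suff : nbhs x [set y | Phi y = Phi x].
    by apply: filterS => y /= ->; rewrite Px eqxx.
  exact: Phi_lc.
have csE : csupp Phi = [set x | Phi x != 0].
  by apply/esym/closure_id.
pose Z := sigma @^-1` csupp Phi.
have cZ : compact Z by exact: proper.
have oZ : open Z by rewrite /Z csE; apply: open_comp => // x _; exact: sigma_continuous.
have clZ : closed Z.
  by rewrite /Z csE; apply: closed_comp => // x _; exact: sigma_continuous.
have /choice[W0 W0P] : forall b : S, exists W0 : set S, Z b ->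
    [/\ open W0, closed W0, W0 b & forall W, open W -> closed W -> W `<=` W0 -> good W].
  move=> b; have [Zb|nZ] := pselect (Z b); last by exists set0.
  by have [|W0 h] := @local_good b; [move: Zb; rewrite /Z csE|exists W0].
have [|b Zb|s sZ Zs] := compact_finite_cover cZ (D := Z) (f := W0).
- by move=> b /W0P[].
- by exists b => //; have [] := W0P _ Zb.
have [F [rF hF]] : good Z.
  apply: (@finite_good (enum_fset s) W0) => //.
  - by move=> b /sZ/set_mem/W0P[].
  - by move=> b W' /sZ/set_mem/W0P[_ _ _]; exact.
exists F; split=> // t ct; have [m c1] := hF _ ct; exists m.
have oUD : open (U `\` D).
  by have [[_ + _ _ _] _] := lc2; rewrite /cimg /= simg.
(* The second part is where the integrand vanishes; the first is the image of the part of the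
   resolution lying over the support. *)
have -> : U `\` D = sigma @` (Z `\` SD) `|` ((U `\` D) `&` ~` csupp Phi).
  apply/seteqP; split=> [x UDx|x [[y [Zy Dy] <-]|[]//]]; last by split.
  have [Px|nPx] := pselect (csupp Phi x); last by right.
  left; move: (UDx); rewrite -simg => -[y Dy yx]; exists y => //.
  by split=> //; rewrite /Z /= yx.
rewrite -(addr0 (F t)) -(addr0 m); apply: cintU => //.
  by apply/seteqP; split=> // _ [[x [Zx _] <-] [_]].
apply: cint0.
  apply: borel_open; apply: openI => //; apply: closed_openC.
  by rewrite csE.
by move=> x [_]; rewrite csE /zeta_integrand => /negP/negPn/eqP ->; rewrite mul0r.
Qed.

End ZetaFunction.

(** * The strip of convergence *)

Section ConvergenceStrip.
Variables (R : realType) (p : nat) (K : pfield p) (n : nat).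
Local Notation C := R[i].
Local Notation q := ((pf_q K)%:R : R).
Variables (Phi : 'rV[K]_n -> C) (S : resolution_data K n).
Local Notation Tpm := (T_plus Phi S `|` T_minus Phi S).

Lemma exprz_expR (m : int) : q ^ m = expR (m%:~R * ln q).
Proof.
have q0 := q_gt0 R K; case: m => j; first by rewrite expRM_natl lnK// posrE.
by rewrite NegzE mulrNz mulNr expRN expRM_natl lnK ?posrE// exprnN.
Qed.

Lemma cmod_qpow_ratio (s : C) (N : int) (v : nat) :
  cmod (qpow K (- s) ^ N * (q ^ (- v%:Z))%:C) =
  expR (- (complex.Re s * N%:~R + v%:R) * ln q).
Proof.
have q0 := q_gt0 R K; rewrite cmodM /qpow cpowXz cmod_cpow cmod_real ?exprz_ge0 ?ltW//.
rewrite exprz_expR -expRD; congr expR.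
have -> : complex.Re ((- s) *~ N) = - (complex.Re s * N%:~R).
  rewrite -mulrzr; have -> : (N%:~R : C) = (N%:~R : R)%:C by rewrite rmorph_int.
  by rewrite Re_real raddfN mulNr.
by rewrite mulrNz; ring.
Qed.

(** The ratio has modulus [q^-(N Re s + v)], which is below 1 exactly when [N Re s > - v]: a lower
    bound on [Re s] for [N > 0], an upper bound for [N < 0]. *)
Lemma in_stripP (s : C) :
  (beta Phi S < (complex.Re s)%:E < alpha Phi S)%E -> in_strip Phi S (qpow K (- s)).
Proof.
move=> /andP[bs sa]; split; first exact: cpow_neq0.
move=> j Tj; rewrite cmod_qpow_ratio expR_lt1 pmulr_llt0 ?ln_gt0 ?q_gt1//.
rewrite oppr_lt0; case: Tj => Tj; have [Nj _] := Tj.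
  have Nr : 0 < (res_N j)%:~R :> R by rewrite ltr0z.
  have : ((- (res_v j)%:R / (res_N j)%:~R)%:E <= beta Phi S)%E.
    by apply: ereal_sup_ubound; exists j.
  move=> /le_lt_trans/(_ bs); rewrite lte_fin ltr_pdivrMr//; lra.
have Nr : 0 < (- res_N j)%:~R :> R by rewrite ltr0z oppr_gt0.
have : (alpha Phi S <= ((res_v j)%:R / `|res_N j|%:~R)%:E)%E.
  by apply: ereal_inf_lbound; exists j.
move=> /(lt_le_trans sa); rewrite ltr0_norm// lte_fin ltr_pdivlMr// mulrNz; lra.
Qed.

Lemma in_strip_nonpole (t : C) : in_strip Phi S t -> ~ pole_value Phi S t.
Proof.
move=> [t0 ht] [j [Tj tj]]; have := ht _ Tj; rewrite tj -rmorphM.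
rewrite -exprnN divff ?expf_neq0 ?q_neq0//.
by rewrite cmod_real ?ler01// ltxx.
Qed.

End ConvergenceStrip.

Section ComplexIntegralDefs.
Variables (R : realType) (p : nat) (K : pfield p) (n : nat).
Variable mu : {measure set (borelKn K n) -> \bar R}.

Lemma cint_cintegrable (D : set 'rV[K]_n) h z m : cint mu D h z m ->
  cintegrable mu D h /\ cintegral mu D h = z.
Proof.
move=> [hr hi]; split.
  by split; [exact: rint_integrable hr|exact: rint_integrable hi].
case: z hr hi => x y [_ _ hx _] [_ _ hy _]; rewrite /cintegral /Rintegral.
by congr (_ +i* _); [exact: (congr1 fine hx)|exact: (congr1 fine hy)].
Qed.

End ComplexIntegralDefs.

Theorem theorem3p2 (R : realType) (p : nat) (p_prime : prime p)
    (K : pfield p) (n : nat)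
    (mu : {measure set (borelKn K n) -> \bar R})
    (mu_haar : normalized_haar mu)
    (U : set 'rV[K]_n) (U_open : open U)
    (f g : 'rV[K]_n -> K)
    (f_analytic : analytic_on U f) (g_analytic : analytic_on U g)
    (f_neq0 : exists2 x, U x & f x != 0)
    (g_neq0 : exists2 x, U x & g x != 0)
    (fg_nonconstant :
      ~ exists a : K, forall x, U x -> g x != 0 -> f x / g x = a)
    (Phi : 'rV[K]_n -> R[i]) (Phi_test : test_function Phi)
    (Phi_supp : csupp Phi `<=` U)
    (S : resolution_data K n) (S_res : embedded_resolution U f g S)
    (S_supp : exists V, [/\ open V, csupp Phi `<=` V, V `<=` U
      & composition_of_blowups_over (@res_map _ _ _ S) V]) :
  (forall w : K -> R[i], Omega (beta Phi S) (alpha Phi S) w ->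
     zeta_converges mu U Phi f g w) /\
  (forall chi : K -> R[i], unit_character chi ->
     exists P Q : {poly R[i]},
       [/\ Q != 0, coprimep P Q,
           (forall w : K -> R[i], Omega (beta Phi S) (alpha Phi S) w ->
              (forall x, vunit x -> w x = chi x) ->
              Q.[w (unif K)] != 0 /\
              zeta mu U Phi f g w = P.[w (unif K)] / Q.[w (unif K)]),
           (forall s : R[i], (0 < pole_order K Q s)%N ->
              exists t (k : int), (T_plus Phi S `|` T_minus Phi S) t /\
                s = (- (res_v t)%:R / (res_N t)%:~R) +i*
                    (2 * pi * k%:~R / ((res_N t)%:~R * ln (pf_q K)%:R))) &
           (forall s : R[i], (pole_order K Q s <= n)%N)]).
Proof.
have [Phi_lc Phi_cpt] := Phi_test.
(* [K^0] is a single point, on which [f / g] would be constant. *)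
have n_gt0 : (0 < n)%N.
  rewrite lt0n; apply/eqP => n0; apply: fg_nonconstant.
  have [x0 _ _] := f_neq0; exists (f x0 / g x0) => x _ _.
  by rewrite (_ : x = x0)//; apply/rowP => i; have := ltn_ord i; rewrite {2}n0.
have main (chi : K -> R[i]) : unit_character chi ->
    exists F : R[i] -> R[i], ratfun (pole_value Phi S) n F /\
    forall t, in_strip Phi S t -> exists m,
      cint mu (U `\` zero_divisor U f g) (zeta_integrand Phi f g (qchar chi t)) (F t) m.
  move=> chiP; have [[x0 Phix0]|Phi0] := pselect (exists x, Phi x != 0).
    apply: zeta_good => // a k.
    apply: (compact_pball (x0 := x0) Phi_cpt).
    apply: filterS (Phi_lc x0) => y yx0; apply: subset_closure => /=.
    by rewrite yx0.
  exists (fun=> 0); split; first exact: ratfun_cst.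
  move=> t _; exists 0; apply: cint0.
    have [_ _ [[k [[_ + _ _ _] _]] simg] _ _] := S_res.
    by rewrite /cimg /= simg; exact: borel_open.
  move=> x _; rewrite /zeta_integrand (_ : Phi x = 0) ?mul0r//.
  by apply/eqP; apply: contrapT => /negP h; apply: Phi0; exists x.
have omega (w chi : K -> R[i]) F : Omega (beta Phi S) (alpha Phi S) w ->
    (forall x, vunit x -> w x = chi x) ->
    (forall t, in_strip Phi S t -> exists m,
      cint mu (U `\` zero_divisor U f g) (zeta_integrand Phi f g (qchar chi t)) (F t) m) ->
    in_strip Phi S (w (unif K)) /\ zeta_converges mu U Phi f g w /\
    zeta mu U Phi f g w = F (w (unif K)).
  move=> [wq [s [ws bsa]]] wchi hF.
  have wstrip : in_strip Phi S (w (unif K)) by rewrite ws; exact: in_stripP.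
  split=> //; have [m c1] := hF _ wstrip.
  apply: cint_cintegrable; apply: cint_ext c1 => x [Ux nDx].
  have [f0 g0] : f x != 0 /\ g x != 0.
    by split; apply/eqP => h; apply: nDx; split=> //; [left|right].
  rewrite /zeta_integrand; congr (_ * _); apply/esym/(quasi_qchar wq wchi).
  by rewrite mulf_neq0// invr_neq0.
split=> [w wO|chi chiP].
  (* For convergence at [w], the character of the units is the restriction of [w] itself. *)
  have [F [_ hF]] := main _ (quasi_unit_character wO.1).
  by have [_ []] := omega w w F wO (fun=> fun=> erefl) hF.
have [F [/ratfun_coprime[P [Q [Q0 PQ Qpole Qn FE]]] hF]] := main _ chiP.
have poleE s : (0 < pole_order K Q s)%N -> pole_value Phi S (qpow K (- s)).
  move=> h; apply: Qpole; first exact: cpow_neq0.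
  by apply: contraTT h => /mupNroot h; rewrite /pole_order h.
exists P, Q; split=> //.
- move=> w wO wchi; have [wstrip [_ ->]] := omega w chi F wO wchi hF.
  have nA := in_strip_nonpole wstrip; have [w0 _] := wstrip.
  split; last exact: FE.
  by apply/negP => Qw; apply: nA; exact: Qpole.
- move=> s /poleE[j [Tj jE]].
  have N0 : res_N j != 0 by case: Tj => -[Nj _]; [rewrite gt_eqF|rewrite lt_eqF].
  have [k sE] := cpow_pole (q_gt1 R K) N0 jE.
  by exists j, k.
- by move=> s; apply: Qn; exact: cpow_neq0.
Qed.
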